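(* Let $X$ be a proper cocompact CAT(0) space. Then the stabiliser in $\mathrm{Isom}(X)$ of every refined flat of $X$ is an amenable closed subgroup of $\mathrm{Isom}(X)$.
   Context: A metric space is proper if its closed balls are compact. $\mathrm{Isom}(X)$ is the full isometry group with the compact-open topology (a locally compact group); $X$ is cocompact if $\mathrm{Isom}(X)$ acts cocompactly on $X$, i.e. there is a compact $K\subseteq X$ with $\mathrm{Isom}(X)\cdot K=X$. $\partial X$ is the visual boundary. Transverse space: for a CAT(0) space $X$ and $\xi\in\partial X$, consider the set of all geodesic rays $r\colon\mathbf{R}_+\to X$ pointing to $\xi$, with the pseudometric $d_\xi(r,r')=\inf_{t,t'\ge 0} d(r(t),r'(t'))$. The transverse space $X_\xi$ is the Hausdorff metric completion of this pseudometric space; it is a complete CAT(0) space, and the stabiliser $\mathrm{Isom}(X)_\xi$ of $\xi$ acts on it canonically by isometries. Refining sequence: a finite sequence $(\xi_1,\dots,\xi_k)$, $k\ge 0$, with $\xi_1\in\partial X$ and $\xi_{i+1}\in\partial X_{\xi_1,\dots,\xi_i}$ for $i\geq 1$, where $X_{\xi_1,\dots,\xi_{i+1}}=(X_{\xi_1,\dots,\xi_i})_{\xi_{i+1}}$; $k=0$ is the empty sequence, giving the space $X$ itself. The iterated stabiliser $\mathrm{Isom}(X)_{\xi_1,\dots,\xi_k}$ is defined inductively as the stabiliser of $\xi_k$ in $\mathrm{Isom}(X)_{\xi_1,\dots,\xi_{k-1}}$ for its action on $\partial X_{\xi_1,\dots,\xi_{k-1}}$; it acts by isometries on $X_{\xi_1,\dots,\xi_k}$.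 A refined flat of $X$ is a flat $F$ (isometrically embedded Euclidean space $\mathbf{R}^n$, $n\ge 0$) in a space $X_{\xi_1,\dots,\xi_k}$, for some refining sequence. Its stabiliser is the subgroup of those elements of $\mathrm{Isom}(X)_{\xi_1,\dots,\xi_k}$ that preserve $F$. *)

(* Defs.v *)
From HB Require Import structures.
From mathcomp Require Import all_boot all_order all_algebra.
From mathcomp Require Import all_classical all_reals.
From mathcomp Require Import interval_inference topology_structure.
From mathcomp Require Import uniform_structure pseudometric_structure.
From mathcomp Require Import metric_structure initial_topology compact.
From mathcomp Require Import subspace_topology function_spaces topology.
From mathcomp Require Import normedtype complete_normed_module sequences.
From mathcomp Require Import ring lra.

Set Implicit Arguments.
Unset Strict Implicit.
Unset Printing Implicit Defensive.

Import Order.TTheory GRing.Theory Num.Theory.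
Import numFieldNormedType.Exports.

Local Open Scope classical_set_scope.
Local Open Scope ring_scope.

Section Euclidean.
Context {R : realType}.

Definition edist n (u v : 'rV[R]_n) : R :=
  Num.sqrt (\sum_i (u ord0 i - v ord0 i) ^+ 2).

Lemma edist_ge0 n (u v : 'rV[R]_n) : 0 <= edist u v.
Proof. exact: sqrtr_ge0. Qed.

Lemma edist_sqr n (u v : 'rV[R]_n) :
  edist u v ^+ 2 = \sum_i (u ord0 i - v ord0 i) ^+ 2.
Proof. by rewrite sqr_sqrtr// sumr_ge0// => i _; rewrite sqr_ge0. Qed.

Lemma edist_combination (p q r : 'rV[R]_2) (s t : R) :
  edist (p + s *: (q - p)) (p + t *: (r - p)) ^+ 2 =
  s ^+ 2 * edist p q ^+ 2 + t ^+ 2 * edist p r ^+ 2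
  - s * t * (edist p q ^+ 2 + edist p r ^+ 2 - edist q r ^+ 2).
Proof. by rewrite !edist_sqr !big_ord_recl !big_ord0 !mxE; ring. Qed.

Lemma comparison_triangle (a b c : R) : 0 <= a -> 0 <= b -> 0 <= c ->
  a <= b + c -> b <= a + c -> c <= a + b ->
  exists p q r : 'rV[R]_2, [/\ edist p q = a, edist p r = b & edist q r = c].
Proof.
move=> a0 b0 c0 abc bac cab.
have key (u v : 'rV[R]_2) (e : R) : 0 <= e ->
    (u ord0 ord0 - v ord0 ord0) ^+ 2 +
    (u ord0 (lift ord0 ord0) - v ord0 (lift ord0 ord0)) ^+ 2 = e ^+ 2 ->
    edist u v = e.
  move=> e0 h; apply/eqP; rewrite -(eqrXn2 (n := 2)) ?edist_ge0//.
  by rewrite edist_sqr !big_ord_recl big_ord0 addr0 h.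
pose V (x y : R) : 'rV[R]_2 := \row_i (if i == ord0 then x else y).
have [a_eq0|a_neq0] := eqVneq a 0.
  exists (V 0 0), (V 0 0), (V b 0).
  by split; apply: key => //; rewrite !mxE/=; nra.
have a_gt0 : 0 < a by rewrite lt_neqAle eq_sym a_neq0.
pose x := (a ^+ 2 + b ^+ 2 - c ^+ 2) / (2 * a).
have xE : 2 * a * x = a ^+ 2 + b ^+ 2 - c ^+ 2.
  by rewrite /x mulrC divfK// mulf_neq0// pnatr_eq0.
have y0 : 0 <= b ^+ 2 - x ^+ 2.
  rewrite -(pmulr_rge0 _ (exprn_gt0 2 a_gt0)).
  have -> : a ^+ 2 * (b ^+ 2 - x ^+ 2) =
      ((2 * a * b) ^+ 2 - (2 * a * x) ^+ 2) / 4 by field.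
  rewrite divr_ge0// xE subr_sqr mulr_ge0//; nra.
exists (V 0 0), (V a 0), (V x (Num.sqrt (b ^+ 2 - x ^+ 2))).
split; apply: key => //; rewrite !mxE/=.
- by rewrite !sub0r; ring.
- by rewrite !sub0r !sqrrN sqr_sqrtr//; ring.
- rewrite sub0r sqrrN sqr_sqrtr//.
  have -> : (a - x) ^+ 2 + (b ^+ 2 - x ^+ 2) = a ^+ 2 + b ^+ 2 - 2 * a * x by ring.
  by rewrite xE; ring.
Qed.

End Euclidean.

Section CAT0.
Context {R : realType}.
Implicit Type X : metricType R.

(* [c] runs affinely along a geodesic segment, with parameter in [0, 1]. *)
Definition geodesic X (x y : X) (c : R -> X) : Prop :=
  [/\ c 0 = x, c 1 = y &
      forall s t, 0 <= s <= 1 -> 0 <= t <= 1 ->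
        mdist (c s) (c t) = `|s - t| * mdist x y].

(* Any two distinct sides of a triangle share a vertex [p], so it is enough
   to compare points lying on the two sides issued from [p]. *)
Definition CAT0 X : Prop :=
  (forall x y : X, exists c, geodesic x y c) /\
  forall (p q r : X) (c c' : R -> X),
    geodesic p q c -> geodesic p r c' ->
    forall p' q' r' : 'rV[R]_2,
      edist p' q' = mdist p q -> edist p' r' = mdist p r ->
      edist q' r' = mdist q r ->
    forall s t, 0 <= s <= 1 -> 0 <= t <= 1 ->
      mdist (c s) (c' t) <= edist (p' + s *: (q' - p')) (p' + t *: (r' - p')).

Definition proper_space X : Prop :=
  forall (x : X) (e : R), compact [set y | mdist x y <= e].

Definition complete_space X : Prop :=
  forall u : nat -> X, cauchy (u @ \oo) -> exists l : X, u @ \oo --> l.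

(* Bruhat-Tits inequality; equivalent to CAT(0), see [CAT0_CN] and [CN_CAT0]. *)
Definition CN X : Prop := forall (x y : X) (l : R), 0 <= l <= 1 ->
  exists z, forall w,
    mdist w z ^+ 2 <= (1 - l) * mdist w x ^+ 2 + l * mdist w y ^+ 2
                      - l * (1 - l) * mdist x y ^+ 2.

Lemma ler_sqr_le (x y : R) : 0 <= y -> x ^+ 2 <= y ^+ 2 -> x <= y.
Proof.
move=> y0; have [x0|/ltW x0 _] := leP 0 x; last exact: le_trans x0 y0.
by rewrite ler_sqr.
Qed.

Lemma CAT0_quadratic X : CAT0 X -> forall (p q r : X) c c' s t,
  geodesic p q c -> geodesic p r c' -> 0 <= s <= 1 -> 0 <= t <= 1 ->
  mdist (c s) (c' t) ^+ 2 <= s ^+ 2 * mdist p q ^+ 2 + t ^+ 2 * mdist p r ^+ 2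
    - s * t * (mdist p q ^+ 2 + mdist p r ^+ 2 - mdist q r ^+ 2).
Proof.
move=> [_ cat0] p q r c c' s t gc gc' s01 t01.
have [||||||p' [q' [r' [e1 e2 e3]]]] :=
    @comparison_triangle R (mdist p q) (mdist p r) (mdist q r);
  rewrite ?mdist_ge0//.
- by rewrite (metric_sym q r); exact: metric_triangle.
- exact: metric_triangle.
- by rewrite (metric_sym p q); exact: metric_triangle.
have := cat0 p q r c c' gc gc' p' q' r' e1 e2 e3 s t s01 t01.
by rewrite -(ler_sqr (mdist_ge0 _ _) (edist_ge0 _ _)) edist_combination e1 e2 e3.
Qed.

Lemma geodesic_CN X (x y : X) c l w : CAT0 X -> geodesic x y c -> 0 <= l <= 1 ->
  mdist w (c l) ^+ 2 <= (1 - l) * mdist w x ^+ 2 + l * mdist w y ^+ 2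
                      - l * (1 - l) * mdist x y ^+ 2.
Proof.
move=> cat0 gc l01; have [c' gc'] := cat0.1 x w.
have := CAT0_quadratic (s := l) (t := 1) cat0 gc gc' l01.
rewrite ler01 lexx => /(_ isT); have [_ -> _] := gc'.
by rewrite (metric_sym w) (metric_sym w x) (metric_sym w y); lra.
Qed.

Lemma CAT0_CN X : CAT0 X -> CN X.
Proof.
move=> cat0 x y l l01; have [c gc] := cat0.1 x y.
by exists (c l) => w; exact: geodesic_CN.
Qed.

Lemma mdist_sqr_le0 X (x y : X) : mdist x y ^+ 2 <= 0 -> x = y.
Proof.
move=> h; apply: mdist_positivity; apply/eqP.
by rewrite -sqrf_eq0 eq_le h sqr_ge0.
Qed.

Lemma CN_geodesic X (x y : X) (z : R -> X) :
  (forall l, 0 <= l <= 1 -> forall w,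
    mdist w (z l) ^+ 2 <= (1 - l) * mdist w x ^+ 2 + l * mdist w y ^+ 2
                      - l * (1 - l) * mdist x y ^+ 2) ->
  geodesic x y z.
Proof.
move=> zP; set D := mdist x y.
have D0 : 0 <= D by exact: mdist_ge0.
have zx s : 0 <= s <= 1 -> mdist (z s) x <= s * D.
  move=> s01; have := zP s s01 x.
  rewrite -/D mdistxx metric_sym => h; apply: ler_sqr_le; last by nra.
  by case/andP: s01 => *; exact: mulr_ge0.
have zy s : 0 <= s <= 1 -> mdist (z s) y <= (1 - s) * D.
  move=> s01; have := zP s s01 y.
  rewrite mdistxx (metric_sym y x) -/D metric_sym => h.
  apply: ler_sqr_le; last by nra.
  by case/andP: s01 => *; rewrite mulr_ge0// subr_ge0.
have le_st s t : 0 <= s <= 1 -> 0 <= t <= 1 -> s <= t ->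
    mdist (z s) (z t) = (t - s) * D.
  move=> s01 t01 st; apply/eqP; rewrite eq_le; apply/andP; split.
    apply: ler_sqr_le; first by rewrite mulr_ge0// subr_ge0.
    have := zP t t01 (z s); rewrite -/D.
    have h1 := zx s s01; have h2 := zy s s01.
    have h3 : mdist (z s) x ^+ 2 <= (s * D) ^+ 2.
      by rewrite ler_sqr ?nnegrE ?mdist_ge0//; case/andP: s01 => *; exact: mulr_ge0.
    have h4 : mdist (z s) y ^+ 2 <= ((1 - s) * D) ^+ 2.
      rewrite ler_sqr ?nnegrE ?mdist_ge0//.
      by case/andP: s01 => *; rewrite mulr_ge0// subr_ge0.
    case/andP: t01 => t0 t1.
    have h5 := ler_wpM2l t0 h4.
    have h6 : (1 - t) * mdist (z s) x ^+ 2 <= (1 - t) * (s * D) ^+ 2.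
      by rewrite ler_wpM2l// subr_ge0.
    move: h5 h6; set A := mdist _ x; set B := mdist _ y; set M := mdist _ (z t).
    move=> h5 h6 h7; have -> : ((t - s) * D) ^+ 2 = (1 - t) * (s * D) ^+ 2 +
       t * ((1 - s) * D) ^+ 2 - t * (1 - t) * D ^+ 2 by ring.
    lra.
  have h1 := zx s s01; have h2 := zy t t01.
  have h3 := metric_triangle x (z s) y.
  have h4 := metric_triangle (z s) (z t) y.
  by rewrite (metric_sym x (z s)) in h3; rewrite /D in h1 h2 *; lra.
have z00 : z 0 = x.
  apply: mdist_sqr_le0; have := zx 0; rewrite lexx ler01 => /(_ isT).
  by have := mdist_ge0 (z 0) x; nra.
have z11 : z 1 = y.
  apply: mdist_sqr_le0; have := zy 1; rewrite lexx ler01 => /(_ isT).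
  by have := mdist_ge0 (z 1) y; nra.
split => // s t s01 t01; have [st|/ltW ts] := leP s t.
  by rewrite le_st// distrC ger0_norm ?subr_ge0.
by rewrite metric_sym le_st// ger0_norm ?subr_ge0.
Qed.

Lemma CN_CAT0 X : CN X -> CAT0 X.
Proof.
move=> cn.
have zE (x y : X) : exists z : R -> X, forall l, 0 <= l <= 1 -> forall w,
    mdist w (z l) ^+ 2 <= (1 - l) * mdist w x ^+ 2 + l * mdist w y ^+ 2
                      - l * (1 - l) * mdist x y ^+ 2.
  have h l : exists z, 0 <= l <= 1 -> forall w,
      mdist w z ^+ 2 <= (1 - l) * mdist w x ^+ 2 + l * mdist w y ^+ 2
                      - l * (1 - l) * mdist x y ^+ 2.
    by have [/(cn x y)[z zP]|h] := boolP (0 <= l <= 1); [exists z|exists x].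
  by have [z zP] := choice h; exists z.
have geoCN (x y : X) c l w : geodesic x y c -> 0 <= l <= 1 ->
    mdist w (c l) ^+ 2 <= (1 - l) * mdist w x ^+ 2 + l * mdist w y ^+ 2
                      - l * (1 - l) * mdist x y ^+ 2.
  move=> [c0 c1 cd] l01; have [z zP] := zE x y.
  suff -> : c l = z l by exact: zP.
  apply: mdist_sqr_le0; apply: le_trans (zP l l01 (c l)) _.
  rewrite -{1}c0 -{1}c1 !cd ?lexx ?ler01//.
  by rewrite !exprMn !real_normK ?num_real//; nra.
split=> [x y|p q r c c' gc gc' p' q' r' e1 e2 e3 s t s01 t01].
  by have [z zP] := zE x y; exists z; exact: CN_geodesic.
apply: ler_sqr_le; first exact: edist_ge0.
rewrite edist_combination e1 e2 e3.
have h1 := geoCN _ _ _ _ (c' t) gc s01.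
have h2 := geoCN _ _ _ _ q gc' t01.
have h3 : mdist (c' t) p = t * mdist p r.
  have [c0 _ cd] := gc'; rewrite -{1}c0 cd ?lexx ?ler01// subr0.
  by case/andP: t01 => t0 _; rewrite ger0_norm.
rewrite metric_sym (le_trans h1)// h3 (metric_sym _ q).
have [s0 s1] := andP s01; have h4 := ler_wpM2l s0 h2.
rewrite (metric_sym q p) in h4; nra.
Qed.

End CAT0.

Section RealArithmetic.
Context {R : realType}.

Lemma ler_addgt0_small (p q K : R) :
  (forall k, 0 < k -> k <= 1 -> p <= q + k * K) -> p <= q.
Proof.
move=> h; apply/ler_addgt0Pr => e e0.
pose k := Num.min 1 (e / (`|K| + 1)).
have K0 : 0 < `|K| + 1 by rewrite ltr_wpDl.
have k0 : 0 < k by rewrite lt_min ltr01 divr_gt0.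
have k1 : k <= 1 by rewrite ge_min lexx.
have kK : k * (`|K| + 1) <= e by rewrite -ler_pdivlMr// ge_min lexx orbT.
apply: le_trans (h k k0 k1) _; rewrite lerD2l; apply: le_trans kK.
by rewrite ler_pM2l// (le_trans (ler_norm K))// lerDl.
Qed.

Lemma ler_sqrD (p q k : R) : 0 <= p -> p <= q + k -> 0 <= k -> k <= 1 ->
  0 <= q -> p ^+ 2 <= q ^+ 2 + k * (q ^+ 2 + 2).
Proof.
move=> p0 pq k0 k1 q0.
have h1 : p ^+ 2 <= (q + k) ^+ 2 by rewrite ler_sqr// nnegrE addr_ge0.
have h2 := mulr_ge0 k0 (sqr_ge0 (q - 1)).
have h3 : k ^+ 2 <= k by rewrite expr2 -[leRHS]mul1r ler_wpM2r.
lra.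
Qed.

Lemma CN_perturbation (a b D a' b' D' l k p q : R) :
  0 <= a -> 0 <= b -> 0 <= D -> 0 < k -> k <= 1 -> 0 <= l <= 1 -> D <= a + b ->
  0 <= a' -> a' <= a + 2 * k -> 0 <= b' -> b' <= b + 2 * k ->
  0 <= D' -> D <= D' + 2 * k -> 0 <= q -> 0 <= p -> p <= q + k ->
  q ^+ 2 <= (1 - l) * a' ^+ 2 + l * b' ^+ 2 - l * (1 - l) * D' ^+ 2
            + k * (1 + a' ^+ 2 + b' ^+ 2) ->
  p ^+ 2 <= (1 - l) * a ^+ 2 + l * b ^+ 2 - l * (1 - l) * D ^+ 2
            + k * (70 * (1 + a ^+ 2 + b ^+ 2)).
Proof.
move=> a0 b0 D0 k0 k1 /andP[l0 l1] Dab a'0 a'a b'0 b'b D'0 DD' q0 p0 pq qP.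
have l1' : 0 <= 1 - l by rewrite subr_ge0.
have kk : k ^+ 2 <= k by rewrite expr2 ger_pMl.
have sq u u' : 0 <= u -> 0 <= u' -> u' <= u + 2 * k ->
    u' ^+ 2 <= u ^+ 2 + 6 * k * (1 + u ^+ 2).
  move=> u0 u'0 uu'.
  have h1 : u' ^+ 2 <= (u + 2 * k) ^+ 2.
    by rewrite ler_sqr// nnegrE addr_ge0// mulr_ge0// ltW.
  have h2 := mulr_ge0 (ltW k0) (sqr_ge0 (u - 1)).
  have h3 := mulr_ge0 (ltW k0) (sqr_ge0 u).
  lra.
have ha := sq _ _ a0 a'0 a'a; have hb := sq _ _ b0 b'0 b'b.
have hD : D ^+ 2 - 8 * k * (1 + a ^+ 2 + b ^+ 2) <= D' ^+ 2.
  have h4 : k * D <= k * (a + b) by rewrite ler_pM2l.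
  have h5 := mulr_ge0 (ltW k0) (sqr_ge0 (a - 1)).
  have h6 := mulr_ge0 (ltW k0) (sqr_ge0 (b - 1)).
  have h7 := mulr_ge0 (ltW k0) (sqr_ge0 a).
  have h8 := mulr_ge0 (ltW k0) (sqr_ge0 b).
  have h1 : D ^+ 2 - 4 * k * D <= D' ^+ 2.
    have [DD|DD] := leP D (2 * k).
      have : D * (4 * k - D) >= 0 by rewrite mulr_ge0// subr_ge0; lra.
      by have := sqr_ge0 D'; lra.
    have h2 : (D - 2 * k) ^+ 2 <= D' ^+ 2.
      by rewrite ler_sqr ?nnegrE//; lra.
    by have := sqr_ge0 k; lra.
  lra.
pose S := 1 + a ^+ 2 + b ^+ 2.
have A0 := sqr_ge0 a; have B0 := sqr_ge0 b.
have S1 : 1 <= S by rewrite /S; lra.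
have kS0 : 0 <= k * S by rewrite mulr_ge0 ?(ltW k0)//; lra.
have ll0 : 0 <= l * (1 - l) by exact: mulr_ge0.
have ll1 : l * (1 - l) <= 1 by have := sqr_ge0 l; lra.
have g1 := ler_wpM2l l1' ha; have g2 := ler_wpM2l l0 hb.
have g3 := ler_wpM2l ll0 hD.
have g4 : l * (1 - l) * (k * S) <= k * S by rewrite -[leRHS]mul1r ler_wpM2r.
have g5 : (1 - l) * (k * (1 + a ^+ 2)) <= k * (1 + a ^+ 2).
  by rewrite -[leRHS]mul1r ler_wpM2r ?mulr_ge0 ?(ltW k0)//; lra.
have g6 : l * (k * (1 + b ^+ 2)) <= k * (1 + b ^+ 2).
  by rewrite -[leRHS]mul1r ler_wpM2r ?mulr_ge0 ?(ltW k0)//; lra.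
have g7 : k * (1 + a' ^+ 2 + b' ^+ 2) <= k * (13 * S).
  rewrite ler_pM2l//.
  have r1 : k * (1 + a ^+ 2) <= 1 + a ^+ 2.
    by rewrite -[leRHS]mul1r ler_wpM2r//; lra.
  have r2 : k * (1 + b ^+ 2) <= 1 + b ^+ 2.
    by rewrite -[leRHS]mul1r ler_wpM2r//; lra.
  rewrite /S; lra.
set Q := (1 - l) * a ^+ 2 + l * b ^+ 2 - l * (1 - l) * D ^+ 2.
have qQ : q ^+ 2 <= Q + 33 * (k * S).
  have r1 := mulr_ge0 (ltW k0) A0; have r2 := mulr_ge0 (ltW k0) B0.
  move: g4; rewrite /Q /S in g7 *; lra.
have QS : Q <= S.
  have := mulr_ge0 l0 A0; have := mulr_ge0 l1' B0.
  have := mulr_ge0 ll0 (sqr_ge0 D); rewrite /Q /S; lra.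
have kSS : k * S <= S by rewrite -[leRHS]mul1r ler_wpM2r//; lra.
have hp : p ^+ 2 <= (q + k) ^+ 2.
  by rewrite ler_sqr// nnegrE addr_ge0// ltW.
have h2 := mulr_ge0 (ltW k0) (sqr_ge0 (q - 1)).
have h3 : k * q ^+ 2 <= k * (34 * S) by rewrite ler_pM2l//; lra.
have h4 : k <= k * S by rewrite -[leLHS]mulr1 ler_pM2l.
have h5 : p ^+ 2 <= Q + 70 * (k * S) by lra.
by apply: (le_trans h5); rewrite -/Q -/S; lra.
Qed.

Lemma CN_error (A B D l eta e m p x y z : R) :
  0 <= l <= 1 -> 0 < eta -> eta <= 1 -> 8 * eta <= e ->
  x ^+ 2 <= A ^+ 2 + eta ^+ 2 -> y ^+ 2 <= B ^+ 2 + 2 * eta ^+ 2 ->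
  D ^+ 2 <= z ^+ 2 ->
  m ^+ 2 <= (1 - l) * x ^+ 2 + l * y ^+ 2 - l * (1 - l) * z ^+ 2 ->
  0 <= m -> 0 <= p -> p <= m + eta ->
  p ^+ 2 <= (1 - l) * A ^+ 2 + l * B ^+ 2 - l * (1 - l) * D ^+ 2
      + e * (1 + A ^+ 2 + B ^+ 2).
Proof.
move=> /andP[l0 l1] eta0 eta1 etae hx hy hz hm m0 p0 pm.
have l1' : 0 <= 1 - l by rewrite subr_ge0.
have ll0 : 0 <= l * (1 - l) by exact: mulr_ge0.
set Q := _ - l * (1 - l) * D ^+ 2.
have A0 := sqr_ge0 A; have B0 := sqr_ge0 B; have D0 := sqr_ge0 D.
have eta20 := sqr_ge0 eta.
have mQ : m ^+ 2 <= Q + 2 * eta ^+ 2.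
  have := ler_wpM2l l1' hx; have := ler_wpM2l l0 hy.
  have := ler_wpM2l ll0 hz; have := mulr_ge0 l1' eta20.
  by rewrite /Q; lra.
have QAB : Q <= A ^+ 2 + B ^+ 2.
  have := mulr_ge0 l0 A0; have := mulr_ge0 l1' B0.
  by have := mulr_ge0 ll0 D0; rewrite /Q; lra.
have pE := ler_sqrD p0 pm (ltW eta0) eta1 m0.
have eta2 : eta ^+ 2 <= eta by rewrite expr2 ger_pMl.
have h1 : eta * m ^+ 2 <= eta * (A ^+ 2 + B ^+ 2 + 2).
  by rewrite ler_pM2l//; lra.
have AB0 : 0 <= A ^+ 2 + B ^+ 2 by rewrite addr_ge0.
have h2 := ler_wpM2r AB0 etae.
have h3 : 0 <= eta * (A ^+ 2 + B ^+ 2) by rewrite mulr_ge0// ltW.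
clearbody Q; lra.
Qed.

End RealArithmetic.

Section MetricLimits.
Context {R : realType}.
Implicit Type X : metricType R.

Lemma mcvgP X (u : nat -> X) (l : X) :
  (u @ \oo --> l) <->
  (forall e : R, 0 < e -> exists N, forall n, (N <= n)%N -> mdist (u n) l < e).
Proof.
split=> [/metricType_numDomainType.cvgrPdist_lt ul e e0|ul].
  have [N _ NP] := ul e e0; exists N => n Nn.
  by rewrite metric_sym; exact: NP.
apply/metricType_numDomainType.cvgrPdist_lt => e e0.
have [N NP] := ul e e0; exists N => // n Nn.
by rewrite metric_sym; exact: NP.
Qed.

Lemma mcauchyP X (u : nat -> X) :
  cauchy (u @ \oo) <->
  (forall e : R, 0 < e -> exists N, forall m n, (N <= m)%N -> (N <= n)%N ->
     mdist (u m) (u n) < e).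
Proof.
split=> [/cauchy_ballP uc e e0|uc].
  have /= := uc e e0 => -[[A B] /= [[N1 _ N1P] [N2 _ N2P]] AB].
  exists (maxn N1 N2) => m n; rewrite !geq_max => /andP[m1 m2] /andP[n1 n2].
  have := AB (u m, u n); rewrite /= ballEmdist /=; apply; split.
    exact: N1P.
  exact: N2P.
apply/cauchy_ballP => e e0; have [N NP] := uc e e0.
exists ([set x | exists2 n, (N <= n)%N & x = u n],
        [set x | exists2 n, (N <= n)%N & x = u n]) => /=.
  by split; exists N => // n Nn; exists n.
move=> [x y] /= [[m Nm ->] [n Nn ->]].
by rewrite ballEmdist /=; exact: NP.
Qed.

Lemma complete_spaceP X : complete_space X <->
  forall u : nat -> X,
  (forall e : R, 0 < e -> exists N, forall m n, (N <= m)%N -> (N <= n)%N ->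
     mdist (u m) (u n) < e) ->
  exists l, forall e : R, 0 < e -> exists N, forall n, (N <= n)%N -> mdist (u n) l < e.
Proof.
split=> h u; first by move=> /mcauchyP/h[l /mcvgP ul]; exists l.
by move=> /mcauchyP/h[l ul]; exists l; apply/mcvgP.
Qed.

Lemma mdist_quad X (x y x' y' : X) :
  mdist x y <= mdist x x' + mdist x' y' + mdist y' y.
Proof.
by rewrite (le_trans (metric_triangle x x' y))// -addrA lerD2l metric_triangle.
Qed.

Lemma nat_gt (x : R) : exists N : nat, forall n, (N <= n)%N -> x < n%:R.
Proof.
exists (Num.truncn x).+1 => n Nn; apply: lt_le_trans (truncnS_gt x) _.
by rewrite ler_nat.
Qed.

Lemma proper_complete X : proper_space X -> complete_space X.
Proof.
move=> pX; apply/complete_spaceP => u uc.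
have [N0 N0P] := uc 1 ltr01.
pose x0 := u N0; pose v n := u (N0 + n)%N.
have vB n : mdist x0 (v n) <= 1 by apply/ltW/N0P => //; rewrite leq_addr.
have /(_ (v @ \oo) _)[] := @pX x0 1.
  by exists 0%N => // n _; exact: vB.
move=> l [_ cl]; exists l => e e0.
have e20 : 0 < e / 2 by rewrite divr_gt0.
have [N NP] := uc _ e20; exists N => n Nn.
have [|_ [[k Nk <-]]] := cl [set x | exists2 k, (N <= k)%N & v k = x] (ball l (e / 2)) _ (nbhsx_ballx _ _ e20).
  by exists N => // k Nk; exists k.
rewrite ballEmdist /= => lk.
rewrite (le_lt_trans (metric_triangle _ (v k) _))// [ltRHS]splitr.
by rewrite ltrD// 1?metric_sym// metric_sym NP// (leq_trans Nk)// leq_addl.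
Qed.

End MetricLimits.

Section Rays.
Context {R : realType}.

(* Rays are functions on the whole line of which only the restriction to
   [0, +oo[ matters. *)
Record ray (X : metricType R) := Ray {
  ray_fun :> R -> X;
  rayP : forall s t, 0 <= s -> 0 <= t ->
    mdist (ray_fun s) (ray_fun t) = `|s - t| }.

Definition asymptotic (X : metricType R) (r s : ray X) : Prop :=
  exists C, forall t, 0 <= t -> mdist (r t) (s t) <= C.

Lemma asymptotic_refl (X : metricType R) (r : ray X) : asymptotic r r.
Proof. by exists 0 => t _; rewrite mdistxx. Qed.

Lemma asymptotic_sym (X : metricType R) (r s : ray X) :
  asymptotic r s -> asymptotic s r.
Proof. by move=> [C rs]; exists C => t t0; rewrite metric_sym rs. Qed.

Lemma asymptotic_trans (X : metricType R) (s r q : ray X) :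
  asymptotic r s -> asymptotic s q -> asymptotic r q.
Proof.
move=> [C rs] [C' sq]; exists (C + C') => t t0.
by rewrite (le_trans (metric_triangle _ (s t) _))// lerD ?rs ?sq.
Qed.

(* The pseudometric d_xi on the set of rays pointing to a common xi. *)
Definition tdist (X : metricType R) (r s : ray X) : R :=
  inf [set mdist (r t) (s t') | t in [set t | 0 <= t] & t' in [set t' | 0 <= t']].

End Rays.

Section RayGeometry.
Context {R : realType} (X : metricType R) (cat0 : CAT0 X).
Implicit Types r s q : ray X.

Lemma ray_geodesic r t0 t1 : 0 <= t0 -> 0 <= t1 ->
  geodesic (r t0) (r t1) (fun l => r ((1 - l) * t0 + l * t1)).
Proof.
move=> h0 h1; split; [by congr (r _); ring|by congr (r _); ring|].
move=> a b /andP[a0 a1] /andP[b0 b1].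
rewrite !rayP ?addr_ge0 ?mulr_ge0 ?subr_ge0//.
by rewrite -normrM -normrN; congr `|_|; ring.
Qed.

Lemma ray_CN r t0 t1 l w : 0 <= t0 -> 0 <= t1 -> 0 <= l <= 1 ->
  mdist w (r ((1 - l) * t0 + l * t1)) ^+ 2 <=
  (1 - l) * mdist w (r t0) ^+ 2 + l * mdist w (r t1) ^+ 2
  - l * (1 - l) * (t1 - t0) ^+ 2.
Proof.
move=> h0 h1 l01.
have := geodesic_CN w cat0 (ray_geodesic r h0 h1) l01.
by rewrite (rayP r h0 h1) real_normK ?num_real// -[(t0 - t1) ^+ 2]sqrrN opprB.
Qed.

Lemma geodesic_rev x y (c : R -> X) :
  geodesic x y c -> geodesic y x (fun l => c (1 - l)).
Proof.
move=> [c0 c1 cd]; split; rewrite ?subr0 ?subrr// => s t s01 t01.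
rewrite cd; [|lra|lra]; rewrite metric_sym; congr (_ * _).
by rewrite -normrN; congr `|_|; ring.
Qed.

Lemma geodesic_fan p x y (c c' : R -> X) l :
  geodesic p x c -> geodesic p y c' -> 0 <= l <= 1 ->
  mdist (c l) (c' l) <= l * mdist x y.
Proof.
move=> gc gc' l01; apply: ler_sqr_le.
  by case/andP: l01 => *; rewrite mulr_ge0// mdist_ge0.
by have := CAT0_quadratic cat0 gc gc' l01 l01; nra.
Qed.

Lemma geodesic_convex x y x' y' (c c' : R -> X) l :
  geodesic x y c -> geodesic x' y' c' -> 0 <= l <= 1 ->
  mdist (c l) (c' l) <= (1 - l) * mdist x x' + l * mdist y y'.
Proof.
move=> gc gc' l01; have [e ge] := cat0.1 x y'.
rewrite (le_trans (metric_triangle _ (e l) _))// addrC lerD//; last first.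
  exact: geodesic_fan gc ge l01.
have l01' : 0 <= 1 - l <= 1 by lra.
have := geodesic_fan (geodesic_rev ge) (geodesic_rev gc') l01'.
by rewrite opprB addrC subrK.
Qed.

Lemma asymptotic_mono r s t t' a : asymptotic r s ->
  0 <= t -> 0 <= t' -> 0 <= a ->
  mdist (r (t + a)) (s (t' + a)) <= mdist (r t) (s t').
Proof.
move=> [C rsC] t0 t'0 a0; apply/ler_addgt0Pr => e e0.
pose B := `|C| + `|t - t'|.
have B0 : 0 <= B by rewrite addr_ge0.
have fB b : 0 <= b -> mdist (r (t + b)) (s (t' + b)) <= B.
  move=> b0; rewrite (le_trans (metric_triangle _ (s (t + b)) _))// lerD//.
    by rewrite (le_trans (rsC _ _)) ?addr_ge0// ler_norm.
  by rewrite rayP ?addr_ge0// opprD addrACA subrr addr0.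
pose l := e / (B + e).
have Be0 : 0 < B + e by rewrite ltr_wpDl.
have l0 : 0 < l by rewrite divr_gt0.
have l1 : l <= 1 by rewrite ler_pdivrMr// mul1r lerDr.
have lB : l * B <= e.
  by rewrite /l mulrAC ler_pdivrMr// ler_pM2l// lerDl ltW.
have al0 : 0 <= a / l by rewrite divr_ge0// ltW.
have gr := @ray_geodesic r t (t + a / l) t0 (addr_ge0 t0 al0).
have gs := @ray_geodesic s t' (t' + a / l) t'0 (addr_ge0 t'0 al0).
have l01 : 0 <= l <= 1 by rewrite ltW.
have := geodesic_convex gr gs l01 => /=.
have E u : (1 - l) * u + l * (u + a / l) = u + a.
  by rewrite mulrDr (mulrC l (a / l)) divfK ?gt_eqF//; ring.
rewrite !E => h; apply: (le_trans h).
have h1 := ler_wpM2l (ltW l0) (fB _ al0).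
have h2 := mdist_ge0 (r t) (s t').
nra.
Qed.

Lemma quadrilateral (p1 p2 p3 p4 : X) :
  mdist p1 p3 ^+ 2 + mdist p2 p4 ^+ 2 <=
  mdist p1 p2 ^+ 2 + mdist p2 p3 ^+ 2 + mdist p3 p4 ^+ 2 + mdist p1 p4 ^+ 2.
Proof.
have [m mP] := @CAT0_CN _ _ cat0 p1 p3 (1 / 2) ltac:(lra).
have h2 := mP p2; have h4 := mP p4.
have ht := metric_triangle p2 m p4.
rewrite (metric_sym p2 p1) in h2.
rewrite (metric_sym p4 p1) (metric_sym p4 p3) (metric_sym p4 m) in h4.
have hs : mdist p2 p4 ^+ 2 <= (mdist p2 m + mdist m p4) ^+ 2.
  by rewrite ler_sqr// nnegrE ?addr_ge0 ?mdist_ge0.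
by have := sqr_ge0 (mdist p2 m - mdist m p4); lra.
Qed.

Definition phi_set r s (x : R) : set R :=
  [set e | exists a, [/\ 0 <= a, 0 <= a + x & e = mdist (r a) (s (a + x))]].

(* This infimum is a limit as [a] tends to infinity; it satisfies Pythagoras'
   identity [phi_pythagoras], the offset being a value of a Busemann function. *)
Definition phi r s (x : R) : R := inf (phi_set r s x).

Lemma phi_set_has_inf r s x : has_inf (phi_set r s x).
Proof.
split; last by exists 0 => _ [a [_ _ ->]]; exact: mdist_ge0.
exists (mdist (r `|x|) (s (`|x| + x))), `|x|; split => //.
by have := ler_norm (- x); rewrite normrN; lra.
Qed.

Lemma phi_ge0 r s x : 0 <= phi r s x.
Proof.
apply: lb_le_inf; first by have [] := phi_set_has_inf r s x.
by move=> _ [a [_ _ ->]]; exact: mdist_ge0.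
Qed.

Lemma phi_le r s x a : 0 <= a -> 0 <= a + x ->
  phi r s x <= mdist (r a) (s (a + x)).
Proof.
move=> a0 ax0; apply: ge_inf; last by exists a.
by have [] := phi_set_has_inf r s x.
Qed.

Lemma phi_near r s x e : asymptotic r s -> 0 < e ->
  exists a0, [/\ 0 <= a0, 0 <= a0 + x &
    forall a, a0 <= a -> mdist (r a) (s (a + x)) <= phi r s x + e].
Proof.
move=> rs e0; have [_ [a0 [a00 a0x ->]] /ltW h] :=
  inf_adherent e0 (phi_set_has_inf r s x).
exists a0; split => // a a0a; apply: le_trans h.
have := asymptotic_mono rs a00 a0x (_ : 0 <= a - a0).
rewrite subr_ge0 => /(_ a0a).
have -> : a0 + (a - a0) = a by ring.
have -> : a0 + x + (a - a0) = a + x by ring.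
exact.
Qed.

Lemma phi_near2 r s x e : asymptotic r s -> 0 < e ->
  exists a0, [/\ 0 <= a0, 0 <= a0 + x &
    forall a, a0 <= a -> mdist (r a) (s (a + x)) ^+ 2 <= phi r s x ^+ 2 + e].
Proof.
move=> rs e0; pose K := 2 * phi r s x + 1.
have K0 : 0 < K by rewrite ltr_wpDl// mulr_ge0// phi_ge0.
pose e' := Num.min 1 (e / K).
have e'0 : 0 < e' by rewrite lt_min ltr01 divr_gt0.
have e'1 : e' <= 1 by rewrite ge_min lexx.
have e'K : e' * K <= e.
  by rewrite -ler_pdivlMr// ge_min lexx orbT.
have [a0 [h1 h2 h3]] := phi_near x rs e'0.
exists a0; split => // a a0a; have := h3 a a0a.
have p0 := phi_ge0 r s x; have d0 := mdist_ge0 (r a) (s (a + x)).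
move: e'K; rewrite /K; nra.
Qed.

Lemma phi_convex r s x y l : asymptotic r s -> 0 <= l <= 1 ->
  phi r s ((1 - l) * x + l * y) ^+ 2 <=
  (1 - l) * phi r s x ^+ 2 + l * phi r s y ^+ 2 - l * (1 - l) * (x - y) ^+ 2.
Proof.
move=> rs l01; apply/ler_addgt0Pr => e e0.
have [a [a0 ax aP]] := phi_near2 x rs e0.
have [b [b0 by_ bP]] := phi_near2 y rs e0.
pose c := a + b.
have c0 : 0 <= c by rewrite addr_ge0.
have cx : 0 <= c + x by rewrite /c; lra.
have cy : 0 <= c + y by rewrite /c; lra.
have h1 := aP c (ltac:(by rewrite lerDl)).
have h2 := bP c (ltac:(by rewrite lerDr)).
have h3 := ray_CN s (r c) cx cy l01.
have E : (1 - l) * (c + x) + l * (c + y) = c + ((1 - l) * x + l * y) by ring.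
rewrite E in h3.
have [l0 l1] := andP l01.
have h4 : phi r s ((1 - l) * x + l * y) <=
    mdist (r c) (s (c + ((1 - l) * x + l * y))).
  by apply: phi_le => //; rewrite -E addr_ge0// mulr_ge0// subr_ge0.
have h5 := phi_ge0 r s ((1 - l) * x + l * y).
have h6 := ler_wpM2l l0 h2.
have l1' : 0 <= 1 - l by rewrite subr_ge0.
have h7 := ler_wpM2l l1' h1.
have h8 : phi r s ((1 - l) * x + l * y) ^+ 2 <=
    mdist (r c) (s (c + ((1 - l) * x + l * y))) ^+ 2.
  by rewrite ler_sqr// nnegrE mdist_ge0.
move: h3 h6 h7 h8; rewrite (_ : c + y - (c + x) = - (x - y)); last by ring.
rewrite sqrrN; lra.
Qed.

Lemma affine_of_convex (h : R -> R) (C : R) :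
  (forall x y l, 0 <= l <= 1 ->
     h ((1 - l) * x + l * y) <= (1 - l) * h x + l * h y) ->
  (forall x, h x + h (- x) <= C) ->
  forall x, h x = h 0 + x * (h 1 - h 0).
Proof.
move=> hc hC.
have sym0 x : h x + h (- x) = 2 * h 0.
  apply/eqP; rewrite eq_le; apply/andP; split; last first.
    have := hc x (- x) (1 / 2) ltac:(lra).
    by rewrite (_ : (1 - 1 / 2) * x + 1 / 2 * - x = 0); [lra|field].
  apply/ler_addgt0Pr => e e0.
  have K0 : 0 <= `|C - 2 * h 0| by [].
  pose l := e / (`|C - 2 * h 0| + e).
  have Ke0 : 0 < `|C - 2 * h 0| + e by rewrite ltr_wpDl.
  have l0 : 0 < l by rewrite divr_gt0.
  have l1 : l <= 1 by rewrite ler_pdivrMr// mul1r lerDr.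
  have lB : l * (C - 2 * h 0) <= e.
    apply: (@le_trans _ _ (l * `|C - 2 * h 0|)).
      by rewrite ler_pM2l// ler_norm.
    by rewrite /l mulrAC ler_pdivrMr// ler_pM2l// lerDl ltW.
  have l01 : 0 <= l <= 1 by rewrite ltW.
  have h1 := hc 0 (x / l) l l01; have h2 := hc 0 (- x / l) l l01.
  rewrite mulr0 add0r (mulrC l) divfK ?gt_eqF// in h1.
  rewrite mulr0 add0r (mulrC l) divfK ?gt_eqF// in h2.
  have := ler_wpM2l (ltW l0) (hC (x / l)); rewrite -mulNr.
  lra.
have hl x l : 0 <= l <= 1 -> h (l * x) - h 0 = l * (h x - h 0).
  move=> l01; have h1 := hc 0 x l l01; have h2 := hc 0 (- x) l l01.
  rewrite !mulr0 !add0r in h1 h2.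
  have h3 := sym0 x; have h4 := sym0 (l * x); rewrite -mulrN in h4.
  have h5 : h (- x) = 2 * h 0 - h x by rewrite -h3; ring.
  rewrite h5 in h2; apply/eqP; rewrite eq_le; apply/andP; split; nra.
have hpos x : 0 <= x -> h x = h 0 + x * (h 1 - h 0).
  move=> x0; have [x1|/ltW x1] := leP x 1.
    by rewrite -hl ?x0// mulr1; ring.
  have xgt0 : 0 < x by exact: lt_le_trans x1.
  have := hl x x^-1; rewrite invr_ge0 x0 invf_le1// => /(_ x1).
  rewrite mulVf ?gt_eqF// => ->.
  by rewrite mulrA divff ?gt_eqF//; ring.
move=> x; have [x0|/ltW x0] := leP 0 x; first exact: hpos.
have := sym0 x; rewrite (hpos (- x)) ?oppr_ge0// => h1.
have -> : h x = 2 * h 0 - (h 0 + - x * (h 1 - h 0)) by rewrite -h1; ring.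
ring.
Qed.

Lemma tdist_set_has_inf r s : has_inf
  [set mdist (r t) (s t') | t in [set t | 0 <= t] & t' in [set t' | 0 <= t']].
Proof.
split; last by exists 0 => _ [t _ [t' _ <-]]; exact: mdist_ge0.
by exists (mdist (r 0) (s 0)), 0 => /=; [|exists 0 => /=].
Qed.

Lemma tdist_ge0 r s : 0 <= tdist r s.
Proof.
apply: lb_le_inf; first by have [] := tdist_set_has_inf r s.
by move=> _ [t _ [t' _ <-]]; exact: mdist_ge0.
Qed.

Lemma tdist_le r s t t' : 0 <= t -> 0 <= t' -> tdist r s <= mdist (r t) (s t').
Proof.
move=> h h'; apply: ge_inf; last by exists t => //; exists t'.
by have [] := tdist_set_has_inf r s.
Qed.

Lemma tdist_near r s e : 0 < e -> exists t t',
  [/\ 0 <= t, 0 <= t' & mdist (r t) (s t') < tdist r s + e].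
Proof.
move=> e0; have [_ [t t0 [t' t'0 <-]] h] :=
  inf_adherent e0 (tdist_set_has_inf r s).
by exists t, t'.
Qed.

Lemma tdist_phi r s x : tdist r s <= phi r s x.
Proof.
apply: lb_le_inf; first by have [] := phi_set_has_inf r s x.
by move=> _ [a [a0 ax ->]]; exact: tdist_le.
Qed.

Lemma phi_pythagoras r s : asymptotic r s ->
  exists b, forall x, phi r s x ^+ 2 = (x + b) ^+ 2 + tdist r s ^+ 2.
Proof.
move=> rs; pose h x := phi r s x ^+ 2 - x ^+ 2.
have hc x y l : 0 <= l <= 1 ->
    h ((1 - l) * x + l * y) <= (1 - l) * h x + l * h y.
  by move=> l01; have := phi_convex x y rs l01; rewrite /h; lra.
have hC x : h x + h (- x) <= 2 * mdist (r 0) (s 0) ^+ 2.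
  wlog x0 : x / 0 <= x.
    move=> W; have [|/ltW x0] := leP 0 x; first exact: W.
    have := W (- x); rewrite oppr_ge0 opprK => /(_ x0).
    by rewrite addrC.
  have h1 := @phi_le r s x 0 (lexx _) (ltac:(by rewrite add0r)).
  have h2 := @phi_le r s (- x) x x0 (ltac:(by rewrite subrr)).
  rewrite add0r in h1; rewrite subrr in h2.
  have h3 := quadrilateral (r 0) (s 0) (s x) (r x).
  rewrite (rayP s (lexx 0) x0) (rayP r (lexx 0) x0) !sub0r !normrN in h3.
  have h4 := asymptotic_mono rs (lexx 0) (lexx 0) x0; rewrite !add0r in h4.
  rewrite (ger0_norm x0) (metric_sym (s x)) (metric_sym (s 0) (r x)) in h3.
  have h5 := phi_ge0 r s x; have h6 := phi_ge0 r s (- x).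
  have h7 := mdist_ge0 (r x) (s x).
  have g1 : phi r s x ^+ 2 <= mdist (r 0) (s x) ^+ 2.
    by rewrite ler_sqr// nnegrE mdist_ge0.
  have g2 : phi r s (- x) ^+ 2 <= mdist (r x) (s 0) ^+ 2.
    by rewrite ler_sqr// nnegrE mdist_ge0.
  have g3 : mdist (r x) (s x) ^+ 2 <= mdist (r 0) (s 0) ^+ 2.
    by rewrite ler_sqr// nnegrE mdist_ge0.
  by rewrite /h (sqrrN x); lra.
have hE := affine_of_convex hc hC.
pose b := (h 1 - h 0) / 2; exists b => x.
have phiE y : phi r s y ^+ 2 = (y + b) ^+ 2 + (h 0 - b ^+ 2).
  by have := hE y; rewrite {1}/h /b => /eqP; rewrite subr_eq => /eqP ->; field.
rewrite phiE; congr (_ + _); apply/eqP; rewrite eq_le; apply/andP; split.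
  have c0 : 0 <= h 0 - b ^+ 2.
    have := phiE (- b); rewrite addNr expr0n/= add0r => <-.
    by rewrite sqr_ge0.
  rewrite -(sqr_sqrtr c0) ler_sqr ?nnegrE ?sqrtr_ge0 ?tdist_ge0//.
  apply: lb_le_inf; first by have [] := tdist_set_has_inf r s.
  move=> _ [t t0 [t' t'0 <-]].
  apply: ler_sqr_le; first exact: mdist_ge0.
  have := @phi_le r s (t' - t) t t0 (ltac:(by rewrite addrC subrK)).
  rewrite (addrC t) subrK => h1; rewrite sqr_sqrtr//.
  have h2 := phiE (t' - t); have h3 := phi_ge0 r s (t' - t).
  have h4 := sqr_ge0 (t' - t + b).
  have h5 : phi r s (t' - t) ^+ 2 <= mdist (r t) (s t') ^+ 2.
    by rewrite ler_sqr// nnegrE mdist_ge0.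
  lra.
have := phiE (- b); rewrite addNr expr0n/= add0r => <-.
by rewrite ler_sqr ?nnegrE ?tdist_ge0 ?phi_ge0// tdist_phi.
Qed.

Lemma phi_triangle r s q x y : asymptotic r s -> asymptotic s q ->
  phi r q (x + y) <= phi r s x + phi s q y.
Proof.
move=> rs sq; apply/ler_addgt0Pr => e e0.
have e20 : 0 < e / 2 by rewrite divr_gt0.
have [a [a0 ax aP]] := phi_near x rs e20.
have [b [b0 by_ bP]] := phi_near y sq e20.
pose c := a + `|b| + `|x| .
have h0 : `|b| = b by rewrite ger0_norm.
have h1 := ler_norm x; have h2 := ler_norm (- x); rewrite normrN in h2.
have g1 := aP c (ltac:(rewrite /c; lra)).
have g2 := bP (c + x) (ltac:(rewrite /c; lra)).
have g3 := @phi_le r q (x + y) c (ltac:(rewrite /c; lra)) (ltac:(rewrite /c; lra)).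
have g4 := metric_triangle (r c) (s (c + x)) (q (c + x + y)).
rewrite addrA in g3; lra.
Qed.

Lemma sqrt_asymptotic (p L d : R) : 0 < L -> p ^+ 2 = L ^+ 2 + d ^+ 2 ->
  p <= L + d ^+ 2 / (2 * L).
Proof.
move=> L0 pE; apply: ler_sqr_le.
  by have L0' := ltW L0; rewrite addr_ge0// divr_ge0 ?sqr_ge0 ?mulr_ge0.
have -> : (L + d ^+ 2 / (2 * L)) ^+ 2 =
    L ^+ 2 + d ^+ 2 + (d ^+ 2 / (2 * L)) ^+ 2.
  by field; rewrite gt_eqF.
by rewrite pE lerDl sqr_ge0.
Qed.

Lemma le0_of_decay (k K : R) : 0 <= K -> (forall L, 0 < L -> k <= K / L) -> k <= 0.
Proof.
move=> K0 h; apply/ler_addgt0Pr => e e0; rewrite add0r.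
have L0 : 0 < (K + 1) / e by rewrite divr_gt0// ltr_wpDl.
apply: le_trans (h _ L0) _.
rewrite invf_div mulrCA -[leRHS]mulr1 ler_pM2l// ler_pdivrMr ?ltr_wpDl//.
by rewrite mul1r lerDl.
Qed.

Lemma phi_offset_add r s q b1 b2 b3 : asymptotic r s -> asymptotic s q ->
  (forall x, phi r s x ^+ 2 = (x + b1) ^+ 2 + tdist r s ^+ 2) ->
  (forall x, phi s q x ^+ 2 = (x + b2) ^+ 2 + tdist s q ^+ 2) ->
  (forall x, phi r q x ^+ 2 = (x + b3) ^+ 2 + tdist r q ^+ 2) ->
  b3 = b1 + b2.
Proof.
move=> rs sq e1 e2 e3.
pose K := (tdist r s ^+ 2 + tdist s q ^+ 2) / 2.
have K0 : 0 <= K by rewrite divr_ge0// addr_ge0// sqr_ge0.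
have lower x : `|x + b3| <= phi r q x.
  apply: ler_sqr_le; first exact: phi_ge0.
  by rewrite real_normK ?num_real// e3 lerDl sqr_ge0.
have KE L : 0 < L -> tdist r s ^+ 2 / (2 * L) + tdist s q ^+ 2 / (2 * L) = K / L.
  by move=> L0; rewrite /K; field; rewrite gt_eqF.
apply/eqP; rewrite -subr_eq0 eq_le; apply/andP; split.
  apply: (le0_of_decay K0) => L L0; rewrite -KE//.
  have h1 : phi r s (L - b1) ^+ 2 = L ^+ 2 + tdist r s ^+ 2 by rewrite e1 subrK.
  have h2 : phi s q (L - b2) ^+ 2 = L ^+ 2 + tdist s q ^+ 2 by rewrite e2 subrK.
  have := phi_triangle (L - b1) (L - b2) rs sq.
  have := lower (L - b1 + (L - b2)); have := ler_norm (L - b1 + (L - b2) + b3).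
  have := sqrt_asymptotic L0 h1; have := sqrt_asymptotic L0 h2.
  lra.
rewrite -oppr_le0; apply: (le0_of_decay K0) => L L0; rewrite -KE//.
have h1 : phi r s (- L - b1) ^+ 2 = L ^+ 2 + tdist r s ^+ 2.
  by rewrite e1 subrK sqrrN.
have h2 : phi s q (- L - b2) ^+ 2 = L ^+ 2 + tdist s q ^+ 2.
  by rewrite e2 subrK sqrrN.
have := phi_triangle (- L - b1) (- L - b2) rs sq.
have := lower (- L - b1 + (- L - b2)).
have := ler_norm (- (- L - b1 + (- L - b2) + b3)); rewrite normrN.
have := sqrt_asymptotic L0 h1; have := sqrt_asymptotic L0 h2.
lra.
Qed.

Lemma tdistxx r : tdist r r = 0.
Proof.
apply/eqP; rewrite eq_le tdist_ge0 andbT.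
by rewrite (le_trans (@tdist_le r r 0 0 _ _)) ?mdistxx.
Qed.

Lemma tdist_sym r s : tdist r s = tdist s r.
Proof.
congr inf; apply/seteqP; split=> _ [t t0 [t' t'0 <-]];
by exists t' => //; exists t => //; rewrite metric_sym.
Qed.

Lemma tdist_triangle s r q : asymptotic r s -> asymptotic s q ->
  tdist r q <= tdist r s + tdist s q.
Proof.
move=> rs sq; apply/ler_addgt0Pr => e e0.
have e20 : 0 < e / 2 by rewrite divr_gt0.
have [t [t' [t0 t'0 h1]]] := tdist_near r s e20.
have [u [u' [u0 u'0 h2]]] := tdist_near s q e20.
have g1 := asymptotic_mono rs t0 t'0 u0.
have g2 := asymptotic_mono sq u0 u'0 t'0.
have g3 := @tdist_le r q (t + u) (u' + t') (addr_ge0 t0 u0) (addr_ge0 u'0 t'0).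
have g4 := metric_triangle (r (t + u)) (s (t' + u)) (q (u' + t')).
rewrite (addrC t' u) in g1 g4; lra.
Qed.

Section Complete.
Hypothesis comp : complete_space X.

Lemma fan_estimate (a b c C M t : R) : 0 <= C -> 1 <= M -> M <= a -> M <= b ->
  0 <= c -> c <= `|a - b| + 2 * C ->
  t ^+ 2 * (c ^+ 2 - (a - b) ^+ 2) / (a * b) <= t ^+ 2 * (4 * C + 4 * C ^+ 2) / M.
Proof.
move=> C0 M1 Ma Mb c0 cC.
have M0 : 0 < M by exact: lt_le_trans M1.
have a0 : 0 < a by exact: lt_le_trans Ma.
have b0 : 0 < b by exact: lt_le_trans Mb.
have ab0 : 0 < a * b by exact: mulr_gt0.
rewrite -[leLHS]mulrA -[leRHS]mulrA; apply: ler_wpM2l; first exact: sqr_ge0.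
rewrite ler_pdivrMr// mulrAC ler_pdivlMr//.
have n0 := normr_ge0 (a - b).
have nE : `|a - b| ^+ 2 = (a - b) ^+ 2 by rewrite real_normK ?num_real.
have h1 : c ^+ 2 - (a - b) ^+ 2 <= 4 * C * `|a - b| + 4 * C ^+ 2.
  by rewrite -nE; nra.
have h2 : M * `|a - b| <= a * b.
  have [ab|/ltW ab] := leP a b.
    by rewrite distrC ger0_norm ?subr_ge0//; nra.
  by rewrite ger0_norm ?subr_ge0//; nra.
have h3 : M <= a * b by nra.
apply: (@le_trans _ _ ((4 * C * `|a - b| + 4 * C ^+ 2) * M)).
  by rewrite ler_pM2r.
have h4 := ler_wpM2l C0 h2; have h5 := ler_wpM2l (sqr_ge0 C) h3.
lra.
Qed.

Lemma ray_from m r : exists rho : ray X, rho 0 = m /\ asymptotic rho r.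
Proof.
pose C := mdist m (r 0); have C0 : 0 <= C := mdist_ge0 _ _.
have /choice[c cP] (n : nat) : exists c, geodesic m (r n%:R) c.
  exact: cat0.1.
pose a (n : nat) := mdist m (r n%:R).
have rn (n : nat) : mdist (r 0) (r n%:R) = n%:R by rewrite rayP// sub0r normrN normr_nat.
have a_lb n : n%:R - C <= a n.
  by have := metric_triangle (r 0) m (r n%:R); rewrite rn (metric_sym _ m) -/C /a; lra.
have a_ub n : a n <= n%:R + C.
  by have := metric_triangle m (r 0) (r n%:R); rewrite rn -/C /a; lra.
pose x n t := c n (t / a n).
have a_big (M : R) : exists N, forall n, (N <= n)%N -> M < a n.
  have [N NP] := nat_gt (M + C); exists N => n /NP.
  by have := a_lb n; lra.
have div01 t n : 0 <= t -> t < a n -> 0 <= t / a n <= 1.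
  move=> t0 tn; have an0 : 0 < a n by exact: le_lt_trans tn.
  by rewrite (divr_ge0 t0 (ltW an0))/= ler_pdivrMr// mul1r ltW.
have xc t : 0 <= t -> exists l, forall e, 0 < e -> exists N, forall n,
    (N <= n)%N -> mdist (x n t) l < e.
  move=> t0; apply: (complete_spaceP X).1 => // e e0.
  pose K := t ^+ 2 * (4 * C + 4 * C ^+ 2).
  have K0 : 0 <= K by rewrite mulr_ge0 ?sqr_ge0// addr_ge0 ?mulr_ge0// sqr_ge0.
  pose M := 1 + t + K / e ^+ 2.
  have Ke : 0 <= K / e ^+ 2 by rewrite divr_ge0// sqr_ge0.
  have M1 : 1 <= M by rewrite /M; lra.
  have M0 : 0 < M by exact: lt_le_trans M1.
  have KM : K / M < e ^+ 2.
    rewrite ltr_pdivrMr// mulrC -ltr_pdivrMr ?exprn_gt0// /M; lra.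
  have [N NP] := a_big M; exists N => n k Nn Nk.
  have an := NP _ Nn; have ak := NP _ Nk.
  have tM : t < M by rewrite /M; lra.
  have an0 := lt_trans M0 an; have ak0 := lt_trans M0 ak.
  have h := CAT0_quadratic cat0 (cP n) (cP k) (div01 _ _ t0 (lt_trans tM an))
              (div01 _ _ t0 (lt_trans tM ak)).
  rewrite -/(a n) -/(a k) -/(x n t) -/(x k t) (rayP r) ?ler0n// in h.
  have cC : `|n%:R - k%:R| <= `|a n - a k| + 2 * C.
    have := a_lb n; have := a_lb k; have := a_ub n; have := a_ub k.
    have := ler_norm (a n - a k); have := ler_norm (- (a n - a k)).
    by rewrite normrN ler_norml; lra.
  have fe := @fan_estimate (a n) (a k) `|n%:R - k%:R| C M t C0 M1 (ltW an) (ltW ak)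
      (normr_ge0 _) cC.
  have E : (t / a n) ^+ 2 * a n ^+ 2 + (t / a k) ^+ 2 * a k ^+ 2 -
      t / a n * (t / a k) * (a n ^+ 2 + a k ^+ 2 - `|n%:R - k%:R| ^+ 2) =
      t ^+ 2 * (`|n%:R - k%:R| ^+ 2 - (a n - a k) ^+ 2) / (a n * a k).
    by field; rewrite !gt_eqF.
  rewrite E in h; have h' := le_lt_trans (le_trans h fe) KM.
  by rewrite -(@ltr_pXn2r _ 2) ?nnegrE ?mdist_ge0// ltW.
have /choice[rho rhoP] (t : R) : exists l, 0 <= t -> forall e, 0 < e ->
    exists N, forall n, (N <= n)%N -> mdist (x n t) l < e.
  have [t0|t0] := leP 0 t; first by have [l lP] := xc _ t0; exists l.
  by exists m => t0'; lra.
have rho_iso (s t : R) : 0 <= s -> 0 <= t -> mdist (rho s) (rho t) = `|s - t|.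
  move=> s0 t0.
  have close e : 0 < e -> `|mdist (rho s) (rho t) - `|s - t| | <= e.
    move=> e0; have e20 : 0 < e / 2 by rewrite divr_gt0.
    have [N1 N1P] := rhoP s s0 _ e20; have [N2 N2P] := rhoP t t0 _ e20.
    have [N3 N3P] := a_big (s + t).
    pose n := maxn N1 (maxn N2 N3).
    have h1 := N1P n (leq_maxl _ _).
    have h2 := N2P n (leq_trans (leq_maxl _ _) (leq_maxr _ _)).
    have h3 := N3P n (leq_trans (leq_maxr _ _) (leq_maxr _ _)).
    have an0 : 0 < a n by lra.
    have h4 : mdist (x n s) (x n t) = `|s - t|.
      have [_ _ ->] := cP n; rewrite -/(a n) ?div01//; [|lra|lra].
      by rewrite -mulrBl normrM normfV (gtr0_norm an0) divfK// gt_eqF.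
    have h5 := mdist_quad (rho s) (rho t) (x n s) (x n t).
    have h6 := mdist_quad (x n s) (x n t) (rho s) (rho t).
    rewrite (metric_sym (rho s) (x n s)) h4 in h5.
    rewrite (metric_sym (rho t) (x n t)) h4 in h6.
    rewrite ler_norml; apply/andP; split; lra.
  apply/eqP; rewrite -subr_eq0 -normr_le0; apply/ler_addgt0Pr => e e0.
  by rewrite add0r close.
exists (Ray rho_iso); split.
  apply: mdist_positivity; apply/eqP; rewrite eq_le mdist_ge0 andbT.
  apply/ler_addgt0Pr => e e0; rewrite add0r /=.
  have [N NP] := rhoP 0 (lexx _) e e0; have := NP N (leqnn _).
  rewrite /x mul0r; have [-> _ _] := cP N.
  by rewrite metric_sym => /ltW.
exists (2 * C + 1) => t t0 /=.
have [N1 N1P] := rhoP t t0 1 ltr01; have [N2 N2P] := a_big t.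
pose n := maxn N1 N2.
have h1 := N1P n (leq_maxl _ _); have h2 := N2P n (leq_maxr _ _).
have an0 : 0 < a n by lra.
have l01 := div01 _ _ t0 h2; set l := t / a n in l01.
have h3 := geodesic_convex (cP n) (@ray_geodesic r 0 n%:R (lexx _) (ler0n _ _)) l01.
rewrite /= mulr0 add0r mdistxx mulr0 addr0 -/C in h3.
have lE : l * a n = t by rewrite /l divfK// gt_eqF.
have [l0 l1] := andP l01.
have h4 : mdist (r (l * n%:R)) (r t) <= C.
  have E2 : l * n%:R - t = l * (n%:R - a n) by rewrite mulrBr lE.
  have ln0 : 0 <= l * n%:R by exact: mulr_ge0 l0 (ler0n _ _).
  rewrite (rayP r ln0 t0) E2 normrM (ger0_norm l0).
  have : `|n%:R - a n| <= C.
    by have := a_lb n; have := a_ub n; rewrite ler_norml; lra.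
  have := normr_ge0 (n%:R - a n); nra.
have h5 := mdist_quad (rho t) (r t) (x n t) (r (l * n%:R)).
rewrite (metric_sym (rho t) (x n t)) in h5.
have lC : 0 <= l * C by exact: mulr_ge0.
have xE : x n t = c n l by [].
rewrite xE in h1 h5; lra.
Qed.

Lemma tdist_CN r r' l e : asymptotic r r' -> 0 <= l <= 1 -> 0 < e ->
  exists2 rho : ray X, asymptotic rho r & forall s, asymptotic s r ->
    tdist s rho ^+ 2 <= (1 - l) * tdist s r ^+ 2 + l * tdist s r' ^+ 2
      - l * (1 - l) * tdist r r' ^+ 2
      + e * (1 + tdist s r ^+ 2 + tdist s r' ^+ 2).
Proof.
move=> rr' l01 e0; have [l0 l1] := andP l01; set D := tdist r r'.
have D0 : 0 <= D := tdist_ge0 _ _.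
pose eta := Num.min 1 (e / 8).
have eta0 : 0 < eta by rewrite lt_min ltr01 divr_gt0.
have eta1 : eta <= 1 by rewrite ge_min lexx.
have etae : 8 * eta <= e.
  by rewrite mulrC -ler_pdivlMr// ge_min lexx orbT.
pose del := eta ^+ 2 / (2 * D + 1).
have del0 : 0 < del by rewrite divr_gt0 ?exprn_gt0// ltr_wpDl// mulr_ge0.
have delE : del * (2 * D + 1) = eta ^+ 2.
  by rewrite divfK// gt_eqF// ltr_wpDl// mulr_ge0.
have del1 : del <= 1.
  by rewrite ler_pdivrMr ?ltr_wpDl ?mulr_ge0//; nra.
have [T [T' [T0 T'0 D0P]]] := tdist_near r r' del0.
set D1 := mdist (r T) (r' T') in D0P.
have DD1 : D1 ^+ 2 - D ^+ 2 <= eta ^+ 2.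
  rewrite -/D in D0P; have := mdist_ge0 (r T) (r' T'); rewrite -/D1; nra.
have [c gc] := cat0.1 (r T) (r' T'); have [c0 c1 cd] := gc.
have [rho [rho0 rhor]] := ray_from (c l) r.
have rhor' : asymptotic rho r' := asymptotic_trans rhor rr'.
exists rho => // s sr.
have rs := asymptotic_sym sr; have sr' := asymptotic_trans sr rr'.
have r's := asymptotic_sym sr'.
have [b1 b1P] := phi_pythagoras rs; have [b2 b2P] := phi_pythagoras r's.
have [b0 b0P] := phi_pythagoras rr'.
have bE := phi_offset_add rr' r's b0P b2P b1P.
have hb : (T - T' - b0) ^+ 2 + D ^+ 2 <= D1 ^+ 2.
  have h1 := @phi_le r r' (T' - T) T T0 (ltac:(by rewrite addrC subrK)).
  rewrite (addrC T) subrK -/D1 in h1.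
  have h2 := b0P (T' - T); have h3 := phi_ge0 r r' (T' - T).
  have h4 : phi r r' (T' - T) ^+ 2 <= D1 ^+ 2.
    by rewrite ler_sqr// nnegrE mdist_ge0.
  by rewrite -/D in h2; nra.
rewrite (tdist_sym s r) (tdist_sym s r').
set A := tdist r s in b1P *; set B := tdist r' s in b2P *.
have A0 : 0 <= A := tdist_ge0 _ _; have B0 : 0 <= B := tdist_ge0 _ _.
have eta20 : 0 < eta ^+ 2 by rewrite exprn_gt0.
have [a1 [a10 a1x a1P]] := phi_near2 (- b1) rs eta20.
have [a2 [a20 a2x a2P]] := phi_near2 (T - T' - b1) r's eta20.
pose a := a1 + a2.
have a0 : 0 <= a by rewrite addr_ge0.
have k1 := a1P (T + a) (ltac:(rewrite /a; lra)).
have k2 := a2P (T' + a) (ltac:(rewrite /a; lra)).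
rewrite b1P addNr expr0n /= add0r in k1.
rewrite b2P in k2.
have yE : T' + a + (T - T' - b1) = T + a - b1 by ring.
rewrite yE in k2; set y := s (T + a - b1) in k1 k2.
have k2' : mdist (r' (T' + a)) y ^+ 2 <= B ^+ 2 + 2 * eta ^+ 2.
  have bE' : T - T' - b1 + b2 = T - T' - b0 by rewrite bE; ring.
  by rewrite bE' in k2; lra.
have Ta0 : 0 <= T + a by lra.
have T'a0 : 0 <= T' + a by lra.
have [c' gc'] := cat0.1 (r (T + a)) (r' (T' + a)).
have fD : D <= mdist (r (T + a)) (r' (T' + a)) by exact: tdist_le.
have m1 := geodesic_CN (rho a) cat0 gc' l01.
have m2 := geodesic_CN y cat0 gc' l01.
have cl1 : mdist (rho a) (r (T + a)) <= l * D1.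
  have := asymptotic_mono rhor (lexx 0) T0 a0; rewrite add0r rho0.
  by rewrite -c0 cd ?lexx ?ler01// subr0 (ger0_norm l0).
have cl2 : mdist (rho a) (r' (T' + a)) <= (1 - l) * D1.
  have := asymptotic_mono rhor' (lexx 0) T'0 a0; rewrite add0r rho0.
  by rewrite -c1 cd ?lexx ?ler01// distrC ger0_norm// subr_ge0.
have D10 : 0 <= D1 := mdist_ge0 _ _.
have fD2 : D ^+ 2 <= mdist (r (T + a)) (r' (T' + a)) ^+ 2.
  by rewrite ler_sqr// nnegrE mdist_ge0.
have l1' : 0 <= 1 - l by rewrite subr_ge0.
have ll0 : 0 <= l * (1 - l) by exact: mulr_ge0.
have ll1 : l * (1 - l) <= 1 by rewrite mulr_ile1// gerBl.
have fD3 := ler_wpM2l ll0 fD2.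
have m1' : mdist (rho a) (c' l) <= eta.
  apply: ler_sqr_le; first exact: ltW.
  have q1 : mdist (rho a) (r (T + a)) ^+ 2 <= (l * D1) ^+ 2.
    by rewrite ler_sqr// nnegrE ?mdist_ge0// mulr_ge0.
  have q2 : mdist (rho a) (r' (T' + a)) ^+ 2 <= ((1 - l) * D1) ^+ 2.
    by rewrite ler_sqr// nnegrE ?mdist_ge0// mulr_ge0.
  have q3 := ler_wpM2l l1' q1; have q4 := ler_wpM2l l0 q2.
  have q5 : (1 - l) * (l * D1) ^+ 2 + l * ((1 - l) * D1) ^+ 2
     - l * (1 - l) * D ^+ 2 = l * (1 - l) * (D1 ^+ 2 - D ^+ 2) by ring.
  have q6 : l * (1 - l) * (D1 ^+ 2 - D ^+ 2) <= eta ^+ 2.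
    have DD0 : 0 <= D1 ^+ 2 - D ^+ 2.
      by rewrite subr_ge0 (le_trans _ hb)// lerDr sqr_ge0.
    apply: le_trans DD1; rewrite -[leRHS]mul1r.
    exact: ler_wpM2r.
  lra.
rewrite (metric_sym (r (T + a))) in k1; rewrite (metric_sym (r' _)) in k2'.
have Tab0 : 0 <= T + a - b1.
  have -> : T + a - b1 = T + a2 + (a1 - b1) by rewrite /a; ring.
  by rewrite addr_ge0// addr_ge0.
have td : tdist s rho <= mdist y (c' l) + eta.
  apply: (le_trans (tdist_le s rho Tab0 a0)).
  apply: (le_trans (metric_triangle _ (c' l) _)).
  by rewrite lerD2l metric_sym.
exact: CN_error l01 eta0 eta1 etae k1 k2' fD2 m2 (mdist_ge0 _ _) (tdist_ge0 _ _) td.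
Qed.

End Complete.
End RayGeometry.

Section Completion.
Context {R : realType}.

Record pseudometric (T : Type) := Pseudometric {
  pdist :> T -> T -> R;
  pdistxx : forall x, pdist x x = 0;
  pdist_sym : forall x y, pdist x y = pdist y x;
  pdist_triangle : forall y x z, pdist x z <= pdist x y + pdist y z }.

(* The Hausdorff completion of a pseudometric space, realised as the closure,
   for the sup metric, of the image of the Kuratowski map [x |-> d x].  A point
   [f] of the completion is thus given by its distances [f z] to the points
   [z] of the original space; see [to_completion_isometry],
   [to_completion_dense] and [completion_complete]. *)
Record completion (T : Type) (d : pseudometric T) := Completion {
  completion_fun :> T -> R;
  completionP : forall e, 0 < e ->
    exists x, forall z, `|completion_fun z - d x z| <= e }.

Definition completion_dist T (d : pseudometric T) (f g : completion d) : R :=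
  sup [set `|f z - g z| | z in [set: T]].

Section Theory.
Context {T : Type} {d : pseudometric T}.
Implicit Types f g h : completion d.

Lemma pdist_ge0 x y : 0 <= d x y.
Proof.
have := pdist_triangle d y x x; rewrite pdistxx (pdist_sym d y x); lra.
Qed.

Lemma completion_inj f g : (forall z, f z = g z) -> f = g.
Proof.
case: f g => f fP [g gP] /= /funext fg; rewrite fg in fP *.
by congr Completion; exact: Prop_irrelevance.
Qed.

Lemma completion_has_sup f g : has_sup [set `|f z - g z| | z in [set: T]].
Proof.
have [x xP] := completionP f ltr01; have [y yP] := completionP g ltr01.
split; first by exists `|f x - g x|, x.
exists (d x y + 2) => _ [z _ <-].
have := xP z; have := yP z; rewrite !ler_norml => /andP[? ?] /andP[? ?].
have := pdist_triangle d y x z; have := pdist_triangle d x y z.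
rewrite (pdist_sym d y x) => ? ?; apply/andP; split; lra.
Qed.

Lemma completion_dist_le f g z : `|f z - g z| <= completion_dist f g.
Proof.
by apply: ub_le_sup; [have [] := completion_has_sup f g|exists z].
Qed.

Lemma completion_dist_lub f g e : (forall z, `|f z - g z| <= e) ->
  completion_dist f g <= e.
Proof.
move=> h; apply: ge_sup; first by have [] := completion_has_sup f g.
by move=> _ [z _ <-].
Qed.

Lemma completion_distxx f : completion_dist f f = 0.
Proof.
apply/eqP; rewrite eq_le; apply/andP; split.
  by apply: completion_dist_lub => z; rewrite subrr normr0.
have [x _] := completionP f ltr01.
by apply: le_trans (completion_dist_le f f x).
Qed.

Lemma completion_dist_eq0 f g : completion_dist f g = 0 -> f = g.
Proof.
move=> fg; apply: completion_inj => z; apply/eqP.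
by rewrite -subr_eq0 -normr_le0 -fg completion_dist_le.
Qed.

Lemma completion_dist_sym f g : completion_dist f g = completion_dist g f.
Proof.
by congr sup; apply/seteqP; split=> _ [z _ <-]; exists z => //; rewrite distrC.
Qed.

Lemma completion_dist_triangle g f h :
  completion_dist f h <= completion_dist f g + completion_dist g h.
Proof.
apply: completion_dist_lub => z.
rewrite (le_trans (ler_distD (g z) _ _))//.
by rewrite lerD ?completion_dist_le.
Qed.

End Theory.

HB.instance Definition _ T (d : pseudometric T) :=
  gen_eqMixin (completion d).
HB.instance Definition _ T (d : pseudometric T) :=
  gen_choiceMixin (completion d).
HB.instance Definition _ T (d : pseudometric T) :=
  isMetric.Build R (completion d) (@completion_distxx T d)
    (@completion_dist_eq0 T d) (@completion_dist_sym T d)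
    (@completion_dist_triangle T d).

Section Embedding.
Context {T : Type} {d : pseudometric T}.
Implicit Types f g : completion d.

Lemma completion_mdistE f g : mdist f g = completion_dist f g.
Proof. by []. Qed.

Lemma to_completion_subproof (x : T) e : 0 < e ->
  exists y, forall z, `|d x z - d y z| <= e.
Proof. by move=> e0; exists x => z; rewrite subrr normr0 ltW. Qed.

Definition to_completion (x : T) : completion d :=
  Completion (@to_completion_subproof x).

Lemma to_completion_isometry x y :
  mdist (to_completion x) (to_completion y) = d x y.
Proof.
apply/eqP; rewrite eq_le; apply/andP; split.
  apply: completion_dist_lub => z /=; rewrite ler_norml.
  have := pdist_triangle d y x z; have := pdist_triangle d x y z.
  rewrite (pdist_sym d y x) => ? ?; apply/andP; split; lra.
apply: le_trans (completion_dist_le _ _ y) => /=.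
by rewrite pdistxx subr0 ler_norm.
Qed.

Lemma to_completion_dense f e : 0 < e ->
  exists x, mdist f (to_completion x) <= e.
Proof.
move=> e0; have [x xP] := completionP f e0.
by exists x; exact: completion_dist_lub.
Qed.

Lemma completion_complete : complete_space (completion d).
Proof.
apply/complete_spaceP => u uc.
have ucz z : exists l : R, forall e, 0 < e ->
    exists N, forall n, (N <= n)%N -> `|u n z - l| < e.
  have Rc : complete_space R^o.
    move=> v vc; exists (lim (v @ \oo)).
    by have /cauchy_cvgP := vc; apply.
  have [] := (complete_spaceP R^o).1 Rc (fun n => u n z).
    move=> e e0; have [N NP] := uc e e0; exists N => m n Nm Nn.
    by apply: le_lt_trans (NP m n Nm Nn); rewrite [mdist _ _]distrC completion_dist_le.
  move=> l lP; exists l => e /lP[N NP]; exists N => n /NP.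
  by rewrite [mdist _ _]distrC.
have /choice[f fP] := ucz.
have unif e : 0 < e -> exists N, forall n, (N <= n)%N -> forall z, `|u n z - f z| <= e.
  move=> e0; have [N NP] := uc e e0; exists N => n Nn z.
  apply/ler_addgt0Pr => k k0; have [M MP] := fP z k k0.
  have h1 := MP (maxn N M) (leq_maxr _ _).
  have h2 := NP n (maxn N M) Nn (leq_maxl _ _).
  rewrite (le_trans (ler_distD (u (maxn N M) z) _ _))// lerD ?(ltW h1)//.
  by rewrite (le_trans (completion_dist_le _ _ z))// ltW.
have fC e : 0 < e -> exists x, forall z, `|f z - d x z| <= e.
  move=> e0; have e20 : 0 < e / 2 by rewrite divr_gt0.
  have [N NP] := unif _ e20; have [x xP] := completionP (u N) e20.
  exists x => z; rewrite (le_trans (ler_distD (u N z) _ _))// [leRHS]splitr.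
  by rewrite lerD// distrC NP.
exists (Completion fC) => e e0; have e20 : 0 < e / 2 by rewrite divr_gt0.
have [N NP] := unif _ e20; exists N => n Nn.
apply: (@le_lt_trans _ _ (e / 2)); last lra.
by apply: completion_dist_lub => z; exact: NP.
Qed.

End Embedding.

(* A complete space with approximate Bruhat-Tits points has exact ones. *)
Lemma approx_CN (X : metricType R) : complete_space X ->
  (forall (x y : X) l, 0 <= l <= 1 -> exists K, 0 <= K /\
    forall k, 0 < k -> k <= 1 ->
    exists z, forall w,
      mdist w z ^+ 2 <= (1 - l) * mdist w x ^+ 2 + l * mdist w y ^+ 2
        - l * (1 - l) * mdist x y ^+ 2
        + k * (K * (1 + mdist w x ^+ 2 + mdist w y ^+ 2))) ->
  CN X.
Proof.
move=> /complete_spaceP comp app x y l l01; have [K [K0 KP]] := app x y l l01.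
have [l0 l1] := andP l01; have l1' : 0 <= 1 - l by rewrite subr_ge0.
have ll0 : 0 <= l * (1 - l) by exact: mulr_ge0.
pose k (n : nat) : R := n.+1%:R^-1.
have k_gt0 n : 0 < k n by rewrite invr_gt0 ltr0n.
have k_le1 n : k n <= 1 by rewrite invf_le1 ?ltr0n// ler1n.
have /choice[z zP] (n : nat) := KP (k n) (k_gt0 n) (k_le1 n).
have k_small e : 0 < e -> exists N, forall n, (N <= n)%N -> k n < e.
  move=> e0; have [N NP] := nat_gt e^-1; exists N => n Nn.
  rewrite /k -[ltRHS]invrK ltf_pV2 ?posrE ?invr_gt0 ?ltr0n//.
  by apply: NP; exact: leq_trans Nn _.
set D := mdist x y in zP *.
have D2 := sqr_ge0 D.
pose C := K * (1 + D ^+ 2).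
have C0 : 0 <= C by rewrite mulr_ge0//; lra.
have zx n : mdist (z n) x ^+ 2 <= l ^+ 2 * D ^+ 2 + k n * C.
  have := zP n x; rewrite mdistxx -/D metric_sym expr0n /= /C; lra.
have zy n : mdist (z n) y ^+ 2 <= (1 - l) ^+ 2 * D ^+ 2 + k n * C.
  have := zP n y; rewrite mdistxx (metric_sym y x) -/D metric_sym expr0n /= /C; lra.
pose C' := C + K * (1 + D ^+ 2 + D ^+ 2 + 2 * C).
have C'0 : 0 <= C' by rewrite addr_ge0// mulr_ge0//; lra.
have lD : l ^+ 2 * D ^+ 2 <= D ^+ 2.
  by rewrite -[leRHS]mul1r ler_wpM2r// expr_le1.
have lD' : (1 - l) ^+ 2 * D ^+ 2 <= D ^+ 2.
  by rewrite -[leRHS]mul1r ler_wpM2r// expr_le1//; lra.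
have zz m n : mdist (z m) (z n) ^+ 2 <= (k m + k n) * C'.
  have h := zP n (z m).
  have kC : k m * C <= C by rewrite -[leRHS]mul1r ler_wpM2r.
  have g1 := ler_wpM2l l1' (zx m); have g2 := ler_wpM2l l0 (zy m).
  have g3 : k n * (K * (1 + mdist (z m) x ^+ 2 + mdist (z m) y ^+ 2)) <=
            k n * (K * (1 + D ^+ 2 + D ^+ 2 + 2 * C)).
    rewrite ler_pM2l// ler_wpM2l//; have := zx m; have := zy m; lra.
  have g4 : 0 <= k n * C by rewrite mulr_ge0// ltW.
  have g5 : 0 <= k m * (K * (1 + D ^+ 2 + D ^+ 2 + 2 * C)).
    by rewrite mulr_ge0 ?(ltW (k_gt0 m))// mulr_ge0//; lra.
  apply: (le_trans h); rewrite /C'; lra.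
have [v vP] : exists v, forall e, 0 < e ->
    exists N, forall n, (N <= n)%N -> mdist (z n) v < e.
  apply: comp => e e0.
  have e2 : 0 < e ^+ 2 / (2 * C' + 1).
    by rewrite divr_gt0 ?exprn_gt0//; lra.
  have [N NP] := k_small _ e2; exists N => m n Nm Nn.
  have h1 := NP m Nm; have h2 := NP n Nn.
  rewrite ltr_pdivlMr in h1; last lra.
  rewrite ltr_pdivlMr in h2; last lra.
  rewrite -(@ltr_pXn2r _ 2) ?nnegrE ?mdist_ge0 ?(ltW e0)//.
  apply: le_lt_trans (zz m n) _.
  have := k_gt0 m; have := k_gt0 n; lra.
exists v => w.
set Q := (1 - l) * mdist w x ^+ 2 + l * mdist w y ^+ 2 - l * (1 - l) * D ^+ 2.
pose S := K * (1 + mdist w x ^+ 2 + mdist w y ^+ 2).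
have S0 : 0 <= S.
  by rewrite mulr_ge0//; have := sqr_ge0 (mdist w x); have := sqr_ge0 (mdist w y); lra.
apply: (@ler_addgt0_small _ _ _ (S + (Q + S + 2))) => e e0 e1.
have [N1 N1P] := vP e e0; have [N2 N2P] := k_small e e0.
pose n := maxn N1 N2.
have h1 := N1P n (leq_maxl _ _); have h2 := N2P n (leq_maxr _ _).
have h3 := zP n w; rewrite -/Q -/S in h3.
have h4 : mdist w v <= mdist w (z n) + e.
  by rewrite (le_trans (metric_triangle w (z n) v))// lerD2l ltW.
have h5 := ler_sqrD (mdist_ge0 _ _) h4 (ltW e0) e1 (mdist_ge0 _ _).
have h6 : k n * S <= e * S by rewrite ler_wpM2r// ltW.
have h7 : e * S <= S by rewrite -[leRHS]mul1r ler_wpM2r.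
have h8 : e * mdist w (z n) ^+ 2 <= e * (Q + S) by rewrite ler_pM2l//; lra.
lra.
Qed.

Lemma completion_CN T (d : pseudometric T) :
  (forall x y l e, 0 <= l <= 1 -> 0 < e -> exists z, forall w,
    d w z ^+ 2 <= (1 - l) * d w x ^+ 2 + l * d w y ^+ 2
      - l * (1 - l) * d x y ^+ 2 + e * (1 + d w x ^+ 2 + d w y ^+ 2)) ->
  CN (completion d).
Proof.
move=> H; apply: (approx_CN completion_complete) => f g l l01.
exists 70; split=> // k k0 k1.
have [x fx] := to_completion_dense f k0; have [y gy] := to_completion_dense g k0.
have [m mP] := H x y l k l01 k0.
exists (to_completion m) => h; have [w hw] := to_completion_dense h k0.
have wm := mP w.
apply: (@CN_perturbation _ _ _ _ (d w x) (d w y) (d x y) _ _ _ (d w m)) => //;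
  rewrite ?mdist_ge0 ?pdist_ge0// -?to_completion_isometry.
- by rewrite (metric_sym h f) metric_triangle.
- have := mdist_quad (to_completion w) (to_completion x) h f.
  rewrite (metric_sym (to_completion w) h); lra.
- have := mdist_quad (to_completion w) (to_completion y) h g.
  rewrite (metric_sym (to_completion w) h); lra.
- have := mdist_quad f g (to_completion x) (to_completion y).
  rewrite (metric_sym (to_completion y) g); lra.
- by rewrite (le_trans (metric_triangle _ (to_completion w) _))// addrC lerD2l.
Qed.

End Completion.

(* No compatibility between group law and topology is required. *)
#[short(type="preTopologicalGroupType")]
HB.structure Definition PreTopologicalGroup := {G of monoid.Group G & Topological G}.

Section Isometries.
Context {R : realType}.

Record isom (X : metricType R) := Isom {
  isom_fun :> X -> X;
  isom_mdist : forall x y, mdist (isom_fun x) (isom_fun y) = mdist x y;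
  isom_surj : forall y, exists x, isom_fun x = y }.

Section Group.
Variable X : metricType R.
Implicit Types g h : isom X.

Lemma isom_ext g h : (forall x, g x = h x) -> g = h.
Proof.
case: g h => g gd gs [h hd hs] /= /funext gh; rewrite gh in gd gs *.
by congr Isom; exact: Prop_irrelevance.
Qed.

Lemma isom_inj g x y : g x = g y -> x = y.
Proof.
by move=> gxy; apply: mdist_positivity; rewrite -(isom_mdist g) gxy mdistxx.
Qed.

Definition isom_id : isom X :=
  @Isom X id (fun x y => erefl) (fun y => ex_intro _ y erefl).

Lemma isom_comp_mdist g h x y : mdist (g (h x)) (g (h y)) = mdist x y.
Proof. by rewrite !isom_mdist. Qed.

Lemma isom_comp_surj g h y : exists x, g (h x) = y.
Proof.
by have [z <-] := isom_surj g y; have [x <-] := isom_surj h z; exists x.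
Qed.

Definition isom_comp g h : isom X :=
  Isom (isom_comp_mdist g h) (isom_comp_surj g h).

Definition isom_inv_fun g (y : X) : X := projT1 (cid (isom_surj g y)).

Lemma isom_inv_funK g y : g (isom_inv_fun g y) = y.
Proof. by rewrite /isom_inv_fun; case: cid. Qed.

Lemma isom_funK g x : isom_inv_fun g (g x) = x.
Proof. by apply: (@isom_inj g); rewrite isom_inv_funK. Qed.

Lemma isom_inv_mdist g x y :
  mdist (isom_inv_fun g x) (isom_inv_fun g y) = mdist x y.
Proof. by rewrite -(isom_mdist g) !isom_inv_funK. Qed.

Lemma isom_inv_surj g y : exists x, isom_inv_fun g x = y.
Proof. by exists (g y); rewrite isom_funK. Qed.

Definition isom_inv g : isom X := Isom (isom_inv_mdist g) (isom_inv_surj g).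

Lemma isom_compA : associative isom_comp.
Proof. by move=> f g h; exact: isom_ext. Qed.

Lemma isom_comp1 : left_id isom_id isom_comp.
Proof. by move=> f; exact: isom_ext. Qed.

Lemma isom_1comp : right_id isom_id isom_comp.
Proof. by move=> f; exact: isom_ext. Qed.

Lemma isom_compV : left_inverse isom_id isom_inv isom_comp.
Proof. by move=> f; apply: isom_ext => x /=; rewrite isom_funK. Qed.

Lemma isom_Vcomp : right_inverse isom_id isom_inv isom_comp.
Proof. by move=> f; apply: isom_ext => x /=; rewrite isom_inv_funK. Qed.

HB.instance Definition _ := gen_eqMixin (isom X).
HB.instance Definition _ := gen_choiceMixin (isom X).
HB.instance Definition _ :=
  isGroup.Build (isom X) isom_compA isom_comp1 isom_1comp isom_compV isom_Vcomp.

HB.instance Definition _ := Topological.copy (isom X)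
  (initial_topology (fun g : isom X => (g : {compact-open, X -> X}))).

End Group.

Definition cocompact (X : metricType R) : Prop :=
  exists2 K : set X, compact K &
    forall x, exists (g : isom X) (k : X), K k /\ g k = x.

End Isometries.

Section Subgroups.
Context {R : realType} {G : preTopologicalGroupType}.
Implicit Types (S : set G) (f : G -> R).
Local Open Scope group_scope.

Definition is_subgroup S : Prop :=
  [/\ S 1, forall g h, S g -> S h -> S (g * h) & forall g, S g -> S g^-1].

(* Functions on the subgroup [S] are represented by functions on [G] of which
   only the restriction to [S] matters. *)
Definition bounded_continuous_on S f : Prop :=
  {within S, continuous f} /\
  exists M : R, forall g, S g -> (`|f g| <= M)%R.

Definition left_invariant_mean S (m : (G -> R) -> R) : Prop :=
  [/\ forall (a : R) f f', bounded_continuous_on S f ->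
        bounded_continuous_on S f' ->
        m (fun x => a * f x + f' x)%R = (a * m f + m f')%R,
      forall f, bounded_continuous_on S f ->
        (forall g, S g -> (0 <= f g)%R) -> (0 <= m f)%R,
      m (fun=> 1%R) = 1%R &
      forall f g, bounded_continuous_on S f -> S g ->
        m (fun x => f (g * x)) = m f].

End Subgroups.

(* Of the definitions of amenability that are equivalent for locally compact
   groups, the one by means on the bounded continuous functions. *)
Definition amenable (R : realType) (G : preTopologicalGroupType) (S : set G) : Prop :=
  exists m : (G -> R) -> R, left_invariant_mean S m.

Section Boundary.
Context {R : realType}.
Local Open Scope quotient_scope.

HB.instance Definition _ (X : metricType R) := gen_eqMixin (ray X).
HB.instance Definition _ (X : metricType R) := gen_choiceMixin (ray X).

Definition asymptoticb (X : metricType R) (r s : ray X) : bool :=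
  `[<asymptotic r s>].

Lemma asymptoticb_refl (X : metricType R) : reflexive (@asymptoticb X).
Proof. by move=> r; apply/asboolP; exact: asymptotic_refl. Qed.

Lemma asymptoticb_sym (X : metricType R) : symmetric (@asymptoticb X).
Proof. by move=> r s; apply/asboolP/asboolP; exact: asymptotic_sym. Qed.

Lemma asymptoticb_trans (X : metricType R) : transitive (@asymptoticb X).
Proof.
move=> s r q /asboolP rs /asboolP sq; apply/asboolP.
exact: asymptotic_trans rs sq.
Qed.

Canonical asymptotic_equiv (X : metricType R) := EquivRel (@asymptoticb X)
  (@asymptoticb_refl X) (@asymptoticb_sym X) (@asymptoticb_trans X).

Definition boundary (X : metricType R) := {eq_quot (asymptotic_equiv X)}.

Lemma boundaryP (X : metricType R) (r s : ray X) :
  \pi_(boundary X) r = \pi_(boundary X) s <-> asymptotic r s.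
Proof.
split=> [/eqmodP/asboolP //|rs].
by apply/eqmodP/asboolP.
Qed.

Definition ray_to (X : metricType R) (xi : boundary X) :=
  {r : ray X | \pi_(boundary X) r = xi}.

Lemma ray_to_asymptotic (X : metricType R) (xi : boundary X) (r s : ray_to xi) :
  asymptotic (sval r) (sval s).
Proof. by apply/boundaryP; rewrite (svalP r) (svalP s). Qed.

Section Action.
Variable X : metricType R.
Implicit Types (g h : isom X) (r s : ray X) (xi : boundary X).

Lemma map_ray_subproof g r (s t : R) : 0 <= s -> 0 <= t ->
  mdist (g (r s)) (g (r t)) = `|s - t|.
Proof. by move=> s0 t0; rewrite isom_mdist rayP. Qed.

Definition map_ray g r : ray X := Ray (@map_ray_subproof g r).

Lemma ray_ext r s : (forall t, r t = s t) -> r = s.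
Proof.
case: r s => r rd [s sd] /= /funext rs; rewrite rs in rd *.
by congr Ray; exact: Prop_irrelevance.
Qed.

Lemma map_rayM g h r : map_ray (g * h)%g r = map_ray g (map_ray h r).
Proof. exact: ray_ext. Qed.

Lemma map_ray1 r : map_ray 1%g r = r.
Proof. exact: ray_ext. Qed.

Lemma map_rayK g r : map_ray g^-1%g (map_ray g r) = r.
Proof. by rewrite -map_rayM mulVg map_ray1. Qed.

Lemma map_rayVK g r : map_ray g (map_ray g^-1%g r) = r.
Proof. by rewrite -map_rayM mulgV map_ray1. Qed.

Definition map_boundary g xi : boundary X :=
  \pi_(boundary X) (map_ray g (repr xi)).

Lemma map_boundary_pi g r :
  map_boundary g (\pi_(boundary X) r) = \pi_(boundary X) (map_ray g r).
Proof.
apply/boundaryP; have /boundaryP[C CP] := reprK (\pi_(boundary X) r).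
by exists C => t t0 /=; rewrite isom_mdist CP.
Qed.

Lemma map_boundaryV g xi : map_boundary g xi = xi -> map_boundary g^-1%g xi = xi.
Proof.
move=> gxi; rewrite -{1}gxi [map_boundary g xi]/map_boundary.
by rewrite map_boundary_pi map_rayK reprK.
Qed.

Lemma map_ray_to_subproof g xi (gxi : map_boundary g xi = xi) (r : ray_to xi) :
  \pi_(boundary X) (map_ray g (sval r)) = xi.
Proof. by rewrite -map_boundary_pi (svalP r). Qed.

Definition map_ray_to g xi (gxi : map_boundary g xi = xi) (r : ray_to xi) :
  ray_to xi := exist _ (map_ray g (sval r)) (map_ray_to_subproof gxi r).

End Action.
End Boundary.

Section Transverse.
Context {R : realType}.
Local Open Scope quotient_scope.

(* Completeness is what makes transverse spaces CAT(0) again. *)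
Record hadamard := Hadamard {
  hadamard_space :> metricType R;
  hadamard_CAT0 : CAT0 hadamard_space;
  hadamard_complete : complete_space hadamard_space }.

Section TransverseSpace.
Variables (X : hadamard) (xi : boundary X).
Let cat0 := hadamard_CAT0 X.

Definition ray_dist (r s : ray_to xi) : R := tdist (sval r) (sval s).

Lemma ray_dist_triangle (s r q : ray_to xi) :
  ray_dist r q <= ray_dist r s + ray_dist s q.
Proof. exact: (tdist_triangle cat0 (ray_to_asymptotic r s) (ray_to_asymptotic s q)). Qed.

Definition ray_pseudometric : pseudometric (ray_to xi) :=
  @Pseudometric R (ray_to xi) ray_dist
    (fun r => tdistxx (sval r)) (fun r s => tdist_sym (sval r) (sval s))
    ray_dist_triangle.

Lemma transverse_CAT0 : CAT0 (completion ray_pseudometric).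
Proof.
apply/CN_CAT0/completion_CN => r r' l e l01 e0.
have [rho rhor rhoP] :=
  tdist_CN cat0 (@hadamard_complete X) (ray_to_asymptotic r r') l01 e0.
have rhoxi : \pi_(boundary X) rho = xi.
  by rewrite -(svalP r); apply/boundaryP.
by exists (exist _ rho rhoxi) => s; exact: rhoP (ray_to_asymptotic s r).
Qed.

Definition transverse : hadamard :=
  Hadamard transverse_CAT0 completion_complete.

Lemma map_ray_to_dist (h : isom X) (hxi : map_boundary h xi = xi)
    (r s : ray_to xi) :
  ray_dist (map_ray_to hxi r) (map_ray_to hxi s) = ray_dist r s.
Proof.
by rewrite /ray_dist /tdist; congr inf; apply/seteqP; split=> _ [t t0 [t' t'0 <-]];
  exists t => //; exists t' => //=; rewrite isom_mdist.
Qed.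

Variables (g : isom X) (gxi : map_boundary g xi = xi).
Implicit Type f : transverse.

Lemma map_ray_toK r : map_ray_to (map_boundaryV gxi) (map_ray_to gxi r) = r.
Proof. by case: r => r rxi; apply: eq_exist; rewrite /= map_rayK. Qed.

Lemma map_ray_toVK r : map_ray_to gxi (map_ray_to (map_boundaryV gxi) r) = r.
Proof. by case: r => r rxi; apply: eq_exist; rewrite /= map_rayVK. Qed.

Lemma transverse_map_subproof f e : 0 < e -> exists r, forall s,
  `|f (map_ray_to (map_boundaryV gxi) s) - ray_pseudometric r s| <= e.
Proof.
move=> e0; have [r rP] := completionP f e0; exists (map_ray_to gxi r) => s.
have E : ray_dist (map_ray_to gxi r) s =
    ray_dist r (map_ray_to (map_boundaryV gxi) s).
  by rewrite -[LHS](map_ray_to_dist (map_boundaryV gxi)) map_ray_toK.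
by rewrite /= E; exact: rP.
Qed.

(* The distance from the image of [f] to a ray [s] is the distance from [f] to
   the ray [g^-1 s]. *)
Definition transverse_map f : transverse :=
  Completion (@transverse_map_subproof f).

Lemma transverse_map_mdist f f' :
  mdist (transverse_map f) (transverse_map f') = mdist f f'.
Proof.
rewrite !completion_mdistE; congr sup; apply/seteqP; split=> _ [s _ <-] /=.
  by exists (map_ray_to (map_boundaryV gxi) s).
by exists (map_ray_to gxi s); rewrite //= map_ray_toK.
Qed.

Lemma transverse_map_surj f : exists f', transverse_map f' = f.
Proof.
have h e : 0 < e -> exists r, forall s,
    `|f (map_ray_to gxi s) - ray_pseudometric r s| <= e.
  move=> e0; have [r rP] := completionP f e0.
  exists (map_ray_to (map_boundaryV gxi) r) => s.
  have E : ray_dist (map_ray_to (map_boundaryV gxi) r) s =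
      ray_dist r (map_ray_to gxi s).
    by rewrite -[LHS](map_ray_to_dist gxi) map_ray_toVK.
  by rewrite /= E; exact: rP.
exists (Completion h); apply: completion_inj => s /=.
by rewrite map_ray_toVK.
Qed.

Definition transverse_isom : isom transverse :=
  Isom transverse_map_mdist transverse_map_surj.

Lemma transverse_isomE (r : ray_to xi) :
  transverse_isom (to_completion r) = to_completion (map_ray_to gxi r).
Proof.
apply: completion_inj => s /=.
by rewrite -[RHS](map_ray_to_dist (map_boundaryV gxi)) map_ray_toK.
Qed.

End TransverseSpace.

(* [refining X Y] is the type of the refining sequences (xi_1, .., xi_k) of [X]
   such that Y = X_{xi_1, .., xi_k}. *)
Inductive refining (X : hadamard) : hadamard -> Type :=
| refining_nil : refining X X
| refining_rcons Y (s : refining X Y) (xi : boundary Y) :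
    refining X (transverse xi).

(* [iterated_action s g h] means that [g] belongs to the iterated stabiliser
   Isom(X)_{xi_1, .., xi_k} and acts as [h] on Y = X_{xi_1, .., xi_k}. *)
Fixpoint iterated_action (X Y : hadamard) (s : refining X Y) :
    isom X -> isom Y -> Prop :=
  match s in refining _ Y return isom X -> isom Y -> Prop with
  | refining_nil => fun g h => h = g
  | refining_rcons Y s xi => fun g h =>
      exists (h' : isom Y) (h'xi : map_boundary h' xi = xi),
        iterated_action s g h' /\ h = transverse_isom h'xi
  end.

Definition flat (X : metricType R) (F : set X) : Prop :=
  exists (n : nat) (phi : 'rV[R]_n -> X),
    (forall u v, mdist (phi u) (phi v) = edist u v) /\ F = range phi.

Definition flat_stabiliser (X Y : hadamard) (s : refining X Y) (F : set Y) :
    set (isom X) :=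
  [set g | exists2 h : isom Y, iterated_action s g h & h @` F = F].

End Transverse.

Arguments hadamard : clear implicits.

(* Main.v *)
Require Import Defs.
From HB Require Import structures.
From mathcomp Require Import all_boot all_order all_algebra.
From mathcomp Require Import all_classical all_reals.
From mathcomp Require Import topology normedtype.
From mathcomp Require Import ring lra.

(* Let S be the stabiliser of a refined flat F.  If g fixes xi and r is a ray to
   xi, then d(g r(t), r(t)) decreases with t; hence fixing xi is a closed
   condition, the action on X_xi is continuous, and S is closed.

   A closed group of isometries of a proper space has a left Haar functional.  As
   X is proper and cocompact, the number of balls of radius e needed to cover a
   ball of radius r is bounded independently of its centre; this bounds ratios of
   Haar measures, and yields an S-equivariant map from X to the probability
   measures on S which is Lipschitz for the total variation.  Integration turns
   the bounded continuous functions on S into bounded Lipschitz functions on X.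

   The Banach mean of t |-> u(r(t)) over rays r to xi turns a bounded Lipschitz
   function u on X into one on X_xi, equivariantly under the stabiliser of xi.
   After k steps, restriction to F leaves a bounded Lipschitz function on R^n.
   Since R^n is doubling, the averages over large balls of its isometry group
   converge along an ultrafilter to a mean invariant under all isometries. *)

Set Implicit Arguments.
Unset Strict Implicit.
Unset Printing Implicit Defensive.

Import Order.TTheory GRing.Theory Num.Theory.
Import numFieldNormedType.Exports.

Local Open Scope classical_set_scope.
Local Open Scope ring_scope.

(** * The topology of isometry groups of proper spaces *)

(** The stabiliser of [xi] need not act cocompactly on the transverse space, so the statement cannot
    simply be applied again to that space. Only functions go down the refining sequence:
    cocompactness of [X] enters only in building Lipschitz functions on [X], and the descent rests
    on CAT(0) geometry. The Lipschitz condition is what lets the mean along a ray pass to the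
    transverse space: rays at transverse distance [d] have means that differ by at most [L * d],
    with the same [L] at every step.

    [S] need be neither unimodular nor cocompact on [X], and the Haar measure of the set of [g] that
    move [y] by at most 1/2 may vary without bound with [y]. Hence one base point per orbit, in a
    separated family of orbits, and a density divided by this measure.

    The image of [S] in the isometry group of the flat need not be closed; averaging over the full
    isometry group of the flat avoids the question. *)

Lemma filter_seq (T : eqType) (I : Type) (F : set_system I) (P : T -> set I)
    (l : seq T) : Filter F -> (forall t, t \in l -> F (P t)) ->
  F [set i | forall t, t \in l -> P t i].
Proof.
move=> FF; elim: l => [|t l IH] h; first by apply: filterS filterT.
have h1 : F (P t) by apply: h; rewrite mem_head.
have h2 : F [set i | forall t, t \in l -> P t i].
  by apply: IH => u ul; apply: h; rewrite in_cons ul orbT.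
apply: filterS (filterI h1 h2) => i [Pi li] u.
by rewrite in_cons => /orP[/eqP ->|/li].
Qed.

(** Near-covering form of compactness, applied to the filter of finite sequences ordered by
    inclusion; centres that fall outside [K] are discarded at the end. *)
Lemma compact_finite_cover (T : topologicalType) (K : set T)
    (P : T -> T -> Prop) : compact K -> (forall x, K x -> nbhs x (P x)) ->
  exists2 l : seq T, (forall z, z \in l -> K z) &
    forall x, K x -> exists2 z, z \in l & P z x.
Proof.
move=> /compact_near_coveringP cK KP.
pose F : set_system (seq T) :=
  filter_from setT (fun l0 : seq T => [set l : seq T | {subset l0 <= l}]).
have FF : Filter F.
  apply: filter_from_filter; first by exists [::].
  move=> l l' _ _; exists (l ++ l') => // l'' sub; split=> x xl; apply: sub.
    by rewrite mem_cat xl.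
  by rewrite mem_cat xl orbT.
have [x Kx|l _ lP] := cK _ F (fun l x => exists z, [/\ z \in l, K z & P z x]) FF.
  exists (P x, [set l : seq T | {subset [:: x] <= l}]).
    by split; [exact: KP|exists [:: x]].
  by move=> [y l] /= [xy xl]; exists x; split=> //; apply: xl; rewrite mem_head.
exists [seq z <- l | `[< K z >]] => [z|x Kx].
  by rewrite mem_filter => /andP[/asboolP].
have [z [zl Kz zx]] := lP l (fun _ => id) x Kx.
by exists z => //; rewrite mem_filter zl andbT; apply/asboolP.
Qed.

Section MetricSpaces.
Context {R : realType} {X : metricType R}.
Implicit Types (x y z : X) (e : R).

Lemma nbhs_mdist x e : 0 < e -> nbhs x [set y | mdist x y < e].
Proof. by move=> e0; rewrite -ballEmdist; exact: nbhsx_ballx. Qed.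

Lemma nbhs_mdistP x (V : set X) :
  nbhs x V -> exists2 e : R, 0 < e & forall y, mdist x y < e -> V y.
Proof.
move=> /nbhs_ballP[e /= e0 eV]; exists e => // y xy; apply: eV.
by rewrite ballEmdist.
Qed.

(** Properness gives a cluster point of the image filter, and a cluster point of an ultrafilter is a
    limit. *)
Lemma ultra_proper_cvg (I : Type) (F : set_system I) (u : I -> X) y (e : R) :
  proper_space X -> UltraFilter F -> F [set i | mdist y (u i) <= e] ->
  exists l, forall e', 0 < e' -> F [set i | mdist (u i) l < e'].
Proof.
move=> Xp FU Fb; have [l [_ lc]] := Xp y e (u @ F) _ Fb.
exists l => e' e'0.
have [//|Fn] := in_ultra_setVsetC [set i | mdist (u i) l < e'] FU.
have [x [/= nx]] :=
  lc [set x | ~ mdist x l < e'] [set x | mdist l x < e'] Fn (nbhs_mdist _ e'0).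
by rewrite metric_sym.
Qed.

Lemma closed_mdistP (A : set X) : closed A ->
  forall x, (forall e, 0 < e -> exists2 y, A y & mdist x y < e) -> A x.
Proof.
move=> cA x h; apply: cA => V /nbhs_mdistP[e e0 eV].
by have [y Ay xy] := h e e0; exists y; split => //; exact: eV.
Qed.

Lemma proper_net x (r e : R) : proper_space X -> 0 < e ->
  exists l : seq X, forall y, mdist x y <= r -> exists2 z, z \in l & mdist z y <= e.
Proof.
move=> Xp e0.
have [z _|l _ lP] := compact_finite_cover (P := fun z y => mdist z y < e) (Xp x r).
  exact: nbhs_mdist.
by exists l => y /lP[z zl /ltW]; exists z.
Qed.

End MetricSpaces.

Section IsomTopology.
Context {R : realType} {X : metricType R} (x0 : X).
Implicit Types (g h k : isom X) (e : R) (S : set (isom X)).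

(* A basic entourage of the left uniformity of [isom X]. *)
Definition isom_near e g h : Prop :=
  forall x, mdist x0 x <= e^-1 -> mdist (g x) (h x) <= e.

Lemma isom_near_trans e1 e h g k : 0 < e1 -> 2 * e1 <= e ->
  isom_near e1 g h -> isom_near e1 h k -> isom_near e g k.
Proof.
move=> e10 e1e gh hk x xe.
have xe1 : mdist x0 x <= e1^-1.
  by apply: (le_trans xe); rewrite lef_pV2 ?posrE//; lra.
by have := metric_triangle (g x) (h x) (k x); have := gh x xe1; have := hk x xe1; lra.
Qed.

(** Left invariance of the entourages, from which that of the covering numbers follows in
    [cov_shift_le]. *)
Lemma isom_near_mull e k g h :
  isom_near e (k * g)%g (k * h)%g <-> isom_near e g h.
Proof. by split=> gh x xe; have := gh x xe; rewrite /= isom_mdist. Qed.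

(** The topology of [isom X] is initial, so it suffices that the filter [G] of maps, generated by
    the [isom_near e g], converge to [g] for the compact-open topology. Over a compact [K], the
    near-covering property makes one [e] serve all the points. *)
Lemma nbhs_isom_near g (V : set (isom X)) :
  nbhs g V -> exists2 e : R, 0 < e & forall h, isom_near e g h -> V h.
Proof.
pose G := [set A : set (X -> X) |
  exists2 e : R, 0 < e & forall h, isom_near e g h -> A (isom_fun h)].
have GF : Filter G.
  split; first by exists 1.
    move=> A B [e e0 eA] [e' e'0 eB]; exists (Num.min e e').
      by rewrite lt_min e0.
    have m0 : 0 < Num.min e e' by rewrite lt_min e0.
    move=> h gh; split; [apply: eA|apply: eB] => x xe.
      apply: (@le_trans _ _ (Num.min e e')); last by rewrite ge_min lexx.
      by apply/gh/(le_trans xe); rewrite lef_pV2 ?posrE// ge_min lexx.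
    apply: (@le_trans _ _ (Num.min e e')); last by rewrite ge_min lexx orbT.
    by apply/gh/(le_trans xe); rewrite lef_pV2 ?posrE// ge_min lexx orbT.
  by move=> A B AB [e e0 eA]; exists e => // h /eA/AB.
have Gg : nbhs (isom_fun g : {compact-open, X -> X}) `<=` G.
  have := (@compact_open_cvgP X X G (isom_fun g : {compact-open, X -> X}) GF).2.
  rewrite /cvg_to /=; apply => K O cK oO gKO.
  have /compact_near_coveringP/(_ R (0^'+)
    (fun e x => forall h, isom_near e g h -> O (h x))) := cK.
  case=> [x Kx|e /= e0 eP].
    have Ogx : nbhs (g x) O by apply: open_nbhs_nbhs; split=> //; apply: gKO; exists x.
    have [d d0 dO] := nbhs_mdistP Ogx.
    pose d' := Num.min 1 (d / 3).
    have d'0 : 0 < d' by rewrite lt_min ltr01 divr_gt0.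
    have d'1 : d' <= 1 by rewrite ge_min lexx.
    have d'd : d' <= d / 3 by rewrite ge_min lexx orbT.
    (* For [e < c], the ball of radius [e^-1] contains every [y] within 1 of [x], so that
       [isom_near e g h] can be applied at [y]. *)
    pose c := Num.min (d / 3) (mdist x0 x + 1)^-1.
    have x1 : 0 < mdist x0 x + 1 by rewrite ltr_wpDl ?mdist_ge0.
    have c0 : 0 < c by rewrite lt_min invr_gt0 x1 divr_gt0.
    exists ([set y | mdist x y < d'], [set e | 0 < e < c]).
      split; first exact: nbhs_mdist.
      exists c => //= t; rewrite /= sub0r normrN => tc t0.
      by rewrite t0/= -(gtr0_norm t0).
    move=> [y e] /= [xy /andP[e0 ec]] h gh; apply: dO.
    have h1 : e < d / 3 by apply: (lt_le_trans ec); rewrite ge_min lexx.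
    have h2 : mdist x0 y <= e^-1.
      have : mdist x0 x + 1 <= e^-1.
        rewrite -[leLHS]invrK lef_pV2 ?posrE ?invr_gt0//.
        by apply/ltW/(lt_le_trans ec); rewrite ge_min lexx orbT.
      have := metric_triangle x0 x y; lra.
    have := gh _ h2; have := metric_triangle (g x) (g y) (h y).
    by rewrite isom_mdist; lra.
  exists (e / 2); first by rewrite divr_gt0.
  move=> h gh _ [x Kx <-].
  apply: (eP (e / 2)) => //; rewrite ?divr_gt0//=.
  by rewrite sub0r normrN gtr0_norm ?divr_gt0//; have : 0 < e by []; lra.
move=> -[B [[A oA <-] Ag] AV].
have [e e0 eA] : G A by apply: Gg; exact: open_nbhs_nbhs.
by exists e => // h /eA Ah; exact: AV.
Qed.

Lemma nbhs_isom_eval g (x : X) e : 0 < e ->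
  nbhs g [set h : isom X | mdist (g x) (h x) < e].
Proof.
move=> e0; pose O := interior [set y | mdist (g x) y < e].
exists [set h : isom X | h @` [set x] `<=` O]; split => /=.
- exists [set u : {compact-open, X -> X} | u @` [set x] `<=` O] => //.
  by apply: compact_open_open; [exact: compact_set1|exact: open_interior].
- by move=> _ [_ -> <-]; exact: nbhs_mdist.
- by move=> h /= /(_ (h x)) /(_ (ex_intro2 _ _ x erefl erefl)) /interior_subset.
Qed.

(** Isometries are 1-Lipschitz, so closeness at the points of a finite net of a ball gives closeness
    on the ball. Pointwise convergence is then enough everywhere below. *)
Lemma isom_near_net e : proper_space X -> 0 < e ->
  exists l : seq X, exists2 d : R, 0 < d & forall g h,
    (forall x, x \in l -> mdist (g x) (h x) < d) -> isom_near e g h.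
Proof.
move=> Xp e0; have e40 : 0 < e / 4 by rewrite divr_gt0.
have [l lP] := proper_net x0 e^-1 Xp e40.
exists l, (e / 2) => [|g h gh x /lP[z /gh zl zx]]; first by rewrite divr_gt0.
have := metric_triangle (g x) (g z) (h x).
have := metric_triangle (g z) (h z) (h x).
by rewrite !isom_mdist (metric_sym x); lra.
Qed.

Lemma isom_near_nbhs g e : proper_space X -> 0 < e -> nbhs g (isom_near e g).
Proof.
move=> Xp e0; have [l [d d0 lP]] := isom_near_net Xp e0.
apply: filterS (filter_seq (P := fun x => [set h : isom X | mdist (g x) (h x) < d]) _ _).
- by move=> h; exact: lP.
- by move=> x _; exact: nbhs_isom_eval.
Qed.

Definition isom_ball S (r : R) : set (isom X) :=
  [set g | S g /\ mdist (g x0) x0 <= r].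

(** Arzela-Ascoli, with limits taken along an ultrafilter. The limits [l'] of the inverses are there
    to make the limit isometry surjective. *)
Lemma isom_ball_compact S r : proper_space X -> closed S ->
  compact (isom_ball S r).
Proof.
move=> Xp cS; rewrite compact_ultra => F FU FS.
have Fx x : exists l, forall e, 0 < e -> F [set g : isom X | mdist (g x) l < e].
  apply: (@ultra_proper_cvg _ _ _ _ _ x0 (r + mdist x x0)) => //.
  apply: filterS FS => g [_ gr] /=.
  have := metric_triangle x0 (g x0) (g x).
  by rewrite isom_mdist (metric_sym x0 (g x0)) (metric_sym x x0); lra.
have FVx x : exists l, forall e, 0 < e ->
    F [set g : isom X | mdist (isom_inv_fun g x) l < e].
  apply: (@ultra_proper_cvg _ _ _ _ _ x0 (r + mdist x x0)) => //.
  apply: filterS FS => g [_ gr] /=.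
  rewrite -(isom_mdist g) isom_inv_funK.
  have := metric_triangle (g x0) x0 x.
  by rewrite (metric_sym x0 x); lra.
have /choice[l lP] := Fx; have /choice[l' l'P] := FVx.
have l_mdist x y : mdist (l x) (l y) = mdist x y.
  apply/eqP; rewrite -subr_eq0 -normr_le0; apply/ler_addgt0Pr => e e0.
  have e20 : 0 < e / 2 by rewrite divr_gt0.
  have [g [/= gx gy]] := filter_ex (filterI (lP x _ e20) (lP y _ e20)).
  have := mdist_quad (l x) (l y) (g x) (g y).
  have := mdist_quad (g x) (g y) (l x) (l y).
  rewrite !isom_mdist add0r (metric_sym (l x) (g x)) (metric_sym (l y) (g y)) => h1 h2.
  by rewrite ler_norml; apply/andP; split; lra.
have l_surj y : exists x, l x = y.
  exists (l' y); apply: mdist_positivity; apply/eqP; rewrite eq_le mdist_ge0 andbT.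
  apply/ler_addgt0Pr => e e0; rewrite add0r.
  have e20 : 0 < e / 2 by rewrite divr_gt0.
  have [g [/= g1 g2]] := filter_ex (filterI (lP (l' y) _ e20) (l'P y _ e20)).
  have := metric_triangle (l (l' y)) (g (l' y)) y.
  rewrite -(isom_mdist g) isom_inv_funK in g2.
  by rewrite (metric_sym (l _) (g _)) (metric_sym (g _) y); lra.
pose g := Isom l_mdist l_surj.
have Fg : F --> g.
  move=> V /nbhs_isom_near[e e0 eV].
  have [s [d d0 sP]] := isom_near_net Xp e0.
  have Fs : F [set h : isom X | forall x, x \in s -> mdist (h x) (l x) < d].
    apply: (filter_seq (P := fun x => [set h : isom X | mdist (h x) (l x) < d])).
    by move=> x _; exact: lP.
  change (F V); apply: filterS Fs => h hl; apply/eV/sP => x xs.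
  by rewrite metric_sym; exact: hl.
exists g; split => //; split.
  apply: cS => V /Fg FV; have [h [[Sh _] Vh]] := filter_ex (filterI FS FV).
  by exists h.
apply/ler_addgt0Pr => e e0.
have [h [/= hx [_ hr]]] := filter_ex (filterI (lP x0 _ e0) FS).
by have := metric_triangle (l x0) (h x0) x0; rewrite (metric_sym (l x0) (h x0)); lra.
Qed.

Lemma isom_ball_net S r e : proper_space X -> closed S -> 0 < e ->
  exists2 l : seq (isom X), (forall h, h \in l -> S h) &
    forall g, isom_ball S r g -> exists2 h, h \in l & isom_near e h g.
Proof.
move=> Xp cS e0.
have [g _|l lS lP] := compact_finite_cover (P := isom_near e)
  (isom_ball_compact (r := r) Xp cS); first exact: isom_near_nbhs.
by exists l => // h /lS[].
Qed.

(** Heine-Cantor. Confining only [g] to the ball spares a separate treatment of the pairs that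
    straddle its boundary. *)
Lemma isom_ball_unif S r (f : isom X -> R) e : proper_space X -> closed S ->
  {within S, continuous f} -> 0 < e ->
  exists2 d : R, 0 < d & forall g h, isom_ball S r g -> S h -> isom_near d g h ->
    `|f g - f h| <= e.
Proof.
move=> Xp cS fc e0.
have /compact_near_coveringP/near_covering_withinP/(_ R (0^'+)
  (fun d g => forall h, S h -> isom_near d g h -> `|f g - f h| <= e)) :=
  isom_ball_compact (r := r) Xp cS.
case=> [g [Sg _]|d /= d0 dP].
  have /nbhs_isom_near[d d0 dV] : nbhs g [set h | S h -> `|f g - f h| < e / 2].
    have := (subspace_continuousP S f).1 fc g Sg => /cvgrPdist_lt/(_ (e / 2)).
    by rewrite divr_gt0// => /(_ isT).
  have d20 : 0 < d / 2 by rewrite divr_gt0.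
  exists (isom_near (d / 2) g, [set d' | 0 < d' <= d / 2]).
    split; first exact: isom_near_nbhs.
    exists (d / 2) => //= t; rewrite /= sub0r normrN => td t0.
    by rewrite t0/= -(gtr0_norm t0) ltW.
  move=> [h d'] /= [gh /andP[d'0 d'd]] [Sh _] k Sk hk.
  have hk' : isom_near (d / 2) h k.
    move=> x xd; apply: (le_trans _ d'd); apply: hk; apply: (le_trans xd).
    by rewrite lef_pV2 ?posrE.
  have h1 : `|f g - f h| < e / 2.
    apply: dV => //; apply: (isom_near_trans d20 _ gh _); first lra.
    by move=> x _; rewrite mdistxx ltW.
  have h2 : `|f g - f k| < e / 2.
    by apply: dV => //; apply: (isom_near_trans d20 _ gh hk'); lra.
  have := ler_distD (f g) (f h) (f k); rewrite (distrC (f h) (f g)); lra.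
exists (d / 2); first by rewrite divr_gt0.
move=> g h gS Sh gh; apply: (dP (d / 2)) => //; rewrite ?divr_gt0//=.
by rewrite sub0r normrN gtr0_norm ?divr_gt0//; have : 0 < d by []; lra.
Qed.

End IsomTopology.

(** * Limits along an ultrafilter on the integers *)

Lemma proper_regular {R : realType} : proper_space R^o.
Proof.
move=> x e; rewrite (_ : [set y | _] = `[x - e, x + e]%classic).
  exact: segment_compact.
by apply/seteqP; split=> y; rewrite /= in_itv /= -ler_distl.
Qed.

Section Ultralimits.
Context {R : realType}.
Implicit Types u v : nat -> R.

Lemma nat_ultrafilter_subproof :
  exists G : set_system nat, UltraFilter G /\ (\oo : set_system nat) `<=` G.
Proof. exact: ultraFilterLemma. Qed.

Definition nat_ultrafilter : set_system nat :=
  projT1 (cid nat_ultrafilter_subproof).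

Local Notation U := nat_ultrafilter.

Global Instance nat_ultrafilter_ultra : UltraFilter U.
Proof. by rewrite /nat_ultrafilter; case: cid => G []. Qed.

Lemma nat_ultrafilter_ge N (P : set nat) :
  (forall n, (N <= n)%N -> P n) -> U P.
Proof.
move=> NP; rewrite /nat_ultrafilter; case: cid => G [_ GP] /=.
by apply: GP; exists N.
Qed.

Definition bounded_seq u : Prop := exists M, forall n, `|u n| <= M.

Lemma bounded_seq_lin (a : R) u v : bounded_seq u -> bounded_seq v ->
  bounded_seq (fun n => a * u n + v n).
Proof.
move=> [M uM] [N vN]; exists (`|a| * M + N) => n.
by rewrite (le_trans (ler_normD _ _))// lerD// normrM ler_wpM2l.
Qed.

Definition ulim u : R := xget 0 [set l | forall e, 0 < e -> U [set n | `|u n - l| <= e]].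

Lemma ulimP u : bounded_seq u ->
  forall e, 0 < e -> U [set n | `|u n - ulim u| <= e].
Proof.
move=> [M uM]; rewrite /ulim; case: xgetP => [//|none].
have Rp := @proper_regular R.
have [|l lP] := @ultra_proper_cvg R R^o nat U u 0 M Rp _.
  by apply: (@nat_ultrafilter_ge 0) => n _; rewrite /mdist /= subr0.
case: (none l) => e e0; apply: filterS (lP e e0) => n /=.
by rewrite /mdist /= distrC => /ltW.
Qed.

Lemma ulim_le u v : bounded_seq u -> bounded_seq v ->
  U [set n | u n <= v n] -> ulim u <= ulim v.
Proof.
move=> bu bv uv; apply/ler_addgt0Pr => e e0.
have e20 : 0 < e / 2 by rewrite divr_gt0.
have [n [/= h1 [/= h2 h3]]] := filter_ex (filterI uv (filterI (ulimP bu e20) (ulimP bv e20))).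
by move: h2 h3; rewrite !ler_norml; lra.
Qed.

Lemma ulim_unique u l : (forall e, 0 < e -> U [set n | `|u n - l| <= e]) ->
  ulim u = l.
Proof.
move=> ul; rewrite /ulim; case: xgetP => [l' _ ul'|/(_ l)//].
apply/eqP; rewrite -subr_eq0 -normr_le0; apply/ler_addgt0Pr => e e0.
have e20 : 0 < e / 2 by rewrite divr_gt0.
have [n [/= h1 h2]] := filter_ex (filterI (ul _ e20) (ul' _ e20)).
by move: h1 h2; rewrite add0r !ler_norml; lra.
Qed.

Lemma ulim_cst (c : R) : ulim (fun=> c) = c.
Proof.
apply: ulim_unique => e e0; apply: (@nat_ultrafilter_ge 0) => n _ /=.
by rewrite subrr normr0 ltW.
Qed.

Lemma ulim_lin (a : R) u v : bounded_seq u -> bounded_seq v ->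
  ulim (fun n => a * u n + v n) = a * ulim u + ulim v.
Proof.
move=> bu bv; apply: ulim_unique => e e0.
pose d := e / (`|a| + 1).
have a0 : 0 < `|a| + 1 by rewrite ltr_wpDl.
have d0 : 0 < d by rewrite divr_gt0.
apply: filterS (filterI (ulimP bu d0) (ulimP bv d0)) => n [/= h1 h2].
have -> : a * u n + v n - (a * ulim u + ulim v) =
  a * (u n - ulim u) + (v n - ulim v) by ring.
rewrite (le_trans (ler_normD _ _))// normrM.
have -> : e = `|a| * d + d by rewrite /d; field; rewrite gt_eqF.
by rewrite lerD// ler_wpM2l.
Qed.

Lemma bounded_seq_cst (c : R) : bounded_seq (fun=> c).
Proof. by exists `|c|. Qed.

Lemma ulimD u v : bounded_seq u -> bounded_seq v ->
  ulim (fun n => u n + v n) = ulim u + ulim v.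
Proof.
move=> bu bv; rewrite -[ulim u]mul1r -ulim_lin//.
by congr ulim; apply/funext => n; rewrite mul1r.
Qed.

Lemma ulimZ (a : R) u : bounded_seq u -> ulim (fun n => a * u n) = a * ulim u.
Proof.
move=> bu; rewrite -[RHS]addr0 -[X in _ + X](ulim_cst 0) -ulim_lin//; last exact: bounded_seq_cst.
by congr ulim; apply/funext => n; rewrite addr0.
Qed.

Lemma ulim_dist_le u v (c : R) : bounded_seq u -> bounded_seq v ->
  (forall n, `|u n - v n| <= c) -> `|ulim u - ulim v| <= c.
Proof.
move=> bu bv uv; apply/ler_addgt0Pr => e e0.
have e20 : 0 < e / 2 by rewrite divr_gt0.
have [n [/= h2 h3]] := filter_ex (filterI (ulimP bu e20) (ulimP bv e20)).
by have := uv n; move: h2 h3; rewrite !ler_norml; lra.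
Qed.

Lemma natS_inv_small (e : R) : 0 < e ->
  exists N, forall n, (N <= n)%N -> n.+1%:R^-1 < e.
Proof.
move=> e0; have [N NP] := nat_gt e^-1; exists N => n Nn.
rewrite -[ltRHS]invrK ltf_pV2 ?posrE ?invr_gt0 ?ltr0n//.
by apply: NP; exact: leq_trans Nn _.
Qed.

(** Errors of order [1/n] vanish because the ultrafilter contains the tails of the integers. *)
Lemma ulim_dist_le_small u v (c d : R) : bounded_seq u -> bounded_seq v ->
  (forall n, `|u n - v n| <= c + d * n.+1%:R^-1) -> `|ulim u - ulim v| <= c.
Proof.
move=> bu bv uv; apply/ler_addgt0Pr => e e0.
have e30 : 0 < e / 3 by rewrite divr_gt0.
have d0 : 0 < `|d| + 1 by rewrite ltr_wpDl.
have [N NP] := natS_inv_small (divr_gt0 e30 d0).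
have [n [/= h1 [/= h2 h3]]] := filter_ex (filterI (nat_ultrafilter_ge NP)
  (filterI (ulimP bu e30) (ulimP bv e30))).
rewrite ltr_pdivlMr// in h1.
have n0 : (0 : R) < n.+1%:R^-1 by rewrite invr_gt0 ltr0n.
have h4 : d * n.+1%:R^-1 <= n.+1%:R^-1 * (`|d| + 1).
  by rewrite mulrC ler_pM2l// (le_trans (ler_norm d))// lerDl.
move: (uv n) h2 h3 h4 h1; set p := d * _; set q := _ * (_ + 1).
by rewrite !ler_norml /=; lra.
Qed.

Lemma ulim_eq u v (c : R) : bounded_seq u -> bounded_seq v ->
  (forall n, `|u n - v n| <= c * n.+1%:R^-1) -> ulim u = ulim v.
Proof.
move=> bu bv uv; apply: ulim_unique => e e0.
have e20 : 0 < e / 2 by rewrite divr_gt0.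
have c0 : 0 < `|c| + 1 by rewrite ltr_wpDl.
have [N NP] := natS_inv_small (divr_gt0 e20 c0).
apply: filterS (filterI (ulimP bv e20) (nat_ultrafilter_ge NP)) => n [/= h1].
rewrite ltr_pdivlMr// => h2.
have h3 := uv n; have n0 : (0 : R) < n.+1%:R^-1 by rewrite invr_gt0 ltr0n.
have h4 : c * n.+1%:R^-1 <= n.+1%:R^-1 * (`|c| + 1).
  by rewrite mulrC ler_pM2l// (le_trans (ler_norm c))// lerDl.
move: h1 h3 h2 h4; rewrite !ler_norml /=; set a := c * _; set b := _ * (_ + 1).
by lra.
Qed.

End Ultralimits.

(** * Haar functionals *)

Lemma le_sum_mem {R : realType} (T : eqType) (l : seq T) (F : T -> R) x :
  (forall y, 0 <= F y) -> x \in l -> F x <= \sum_(y <- l) F y.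
Proof.
move=> F0; elim: l => // y l IH; rewrite in_cons big_cons => /orP[/eqP ->|/IH h].
  by rewrite lerDl sumr_ge0.
by rewrite (le_trans h)// lerDr.
Qed.

Lemma sum_le_size {R : realType} (T : eqType) (l : seq T) (F : T -> R) c :
  (forall x, x \in l -> F x <= c) -> \sum_(x <- l) F x <= (size l)%:R * c.
Proof.
elim: l => [|x l IH] Fc; first by rewrite big_nil mul0r.
rewrite big_cons /= -natr1 mulrDl mul1r addrC lerD//.
  by apply: IH => y yl; apply: Fc; rewrite in_cons yl orbT.
by apply: Fc; rewrite mem_head.
Qed.

Section HaarFunctional.
Context {R : realType} {X : metricType R} (x0 : X).
Hypothesis X_proper : proper_space X.
Variable S : set (isom X).
Hypotheses (S_group : is_subgroup S) (S_closed : closed S).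
Implicit Types (f : isom X -> R) (g h : isom X) (e d r c : R).

Let S1 : S 1%g. Proof. by case: S_group. Qed.
Let SM g h : S g -> S h -> S (g * h)%g. Proof. by case: S_group => _ + _; exact. Qed.
Let SV g : S g -> S g^-1%g. Proof. by case: S_group => _ _; exact. Qed.

(** These indicators are in general discontinuous. They enter only through comparisons, for which
    monotonicity, subadditivity and left invariance of the upper integral suffice. *)
Definition hits (y x : X) r g : R := (mdist (g y) x <= r)%R%:R.

(** As [X] is proper and [S] closed, bounded subsets of [S] are relatively compact by
    [isom_ball_compact]: this is compact support. *)
Definition bounded_supp f : Prop := exists r M, forall g, S g ->
  `|f g| <= M /\ (f g != 0 -> mdist (g x0) x0 <= r).

Definition unif_cont f : Prop := forall e, 0 < e -> exists2 d, 0 < d &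
  forall g h, S g -> S h -> isom_near x0 d g h -> `|f g - f h| <= e.

Lemma bounded_supp_lin a f f' : bounded_supp f -> bounded_supp f' ->
  bounded_supp (fun g => a * f g + f' g).
Proof.
move=> [r [M fP]] [r' [M' f'P]]; exists (Num.max r r'), (`|a| * M + M') => g Sg.
have [fM fr] := fP g Sg; have [f'M f'r] := f'P g Sg; split.
  by rewrite (le_trans (ler_normD _ _))// lerD// normrM ler_wpM2l.
have [f0|/fr h _] := eqVneq (f g) 0; last by rewrite le_max h.
by rewrite f0 mulr0 add0r => /f'r h; rewrite le_max h orbT.
Qed.

Lemma bounded_suppZ a f : bounded_supp f -> bounded_supp (fun g => a * f g).
Proof.
move=> [r [M fP]]; exists r, (`|a| * M) => g /fP[fM fr]; split.
  by rewrite normrM ler_wpM2l.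
by rewrite mulf_eq0 negb_or => /andP[_ /fr].
Qed.

Lemma bounded_suppD f f' : bounded_supp f -> bounded_supp f' ->
  bounded_supp (fun g => f g + f' g).
Proof.
move=> bf bf'; have := bounded_supp_lin 1 bf bf'.
by congr bounded_supp; apply/funext => g; rewrite mul1r.
Qed.

Lemma bounded_supp_le f f' : bounded_supp f' ->
  (forall g, S g -> `|f g| <= `|f' g|) -> bounded_supp f.
Proof.
move=> [r [M fP]] ff'; exists r, M => g Sg.
have [fM fr] := fP g Sg; have h := ff' g Sg; split; first exact: le_trans fM.
move=> f0; apply: fr; rewrite -normr_gt0; apply: lt_le_trans h.
by rewrite normr_gt0.
Qed.

Lemma bounded_supp_shift f s : S s -> bounded_supp f ->
  bounded_supp (fun g => f (s * g)%g).
Proof.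
move=> Ss [r [M fP]]; exists (r + mdist (s x0) x0), M => g Sg.
have [fM fr] := fP _ (SM Ss Sg); split=> // /fr /= h.
rewrite -(isom_mdist s); have := metric_triangle (s (g x0)) x0 (s x0).
by rewrite (metric_sym x0 (s x0)); lra.
Qed.

Lemma hits_ge0 y x r g : 0 <= hits y x r g.
Proof. by rewrite /hits. Qed.

Lemma bounded_supp_hits y x r : bounded_supp (hits y x r).
Proof.
exists (mdist x0 y + r + mdist x x0), 1 => g Sg; rewrite /hits.
have [h|h] := leP (mdist (g y) x) r; rewrite ?normr1 ?normr0 ?eqxx//; split=> // _.
have := mdist_quad (g x0) x0 (g y) x; rewrite isom_mdist; lra.
Qed.

(** A combination of left translates of one indicator, that of [isom_near x0 e 1]. The indicator
    replaces the continuous test function of Weil's construction; continuity is asked of the covered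
    functions instead. *)
Definition weight e (l : seq (R * isom X)) g : R :=
  \sum_(p <- l) p.1 * (`[< isom_near x0 e p.2 g >])%:R.

Definition covers e f (l : seq (R * isom X)) : Prop :=
  (forall p, p \in l -> 0 <= p.1 /\ S p.2) /\ forall g, S g -> f g <= weight e l g.

Definition cost (l : seq (R * isom X)) : R := \sum_(p <- l) p.1.

(* Weil's covering number. *)
Definition cov e f : R := inf [set cost l | l in covers e f].

Lemma weight_le_cost e l g : (forall p, p \in l -> 0 <= p.1 /\ S p.2) ->
  weight e l g <= cost l.
Proof.
move=> lP; rewrite /weight /cost big_seq [leRHS]big_seq; apply: ler_sum => p pl.
by have [p0 _] := lP p pl; case: asboolP => _; rewrite ?mulr1 ?mulr0.
Qed.

Lemma covers_exists e f : 0 < e -> bounded_supp f -> exists l, covers e f l.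
Proof.
move=> e0 [r [M fP]].
have [l lS lP] := isom_ball_net x0 r X_proper S_closed e0.
have M0 : 0 <= M by have [h _] := fP 1%g S1; apply: le_trans h.
exists [seq (M, h) | h <- l]; split=> [p /mapP[h hl ->]|g Sg].
  by split=> //; exact: lS.
rewrite /weight big_map /=; have [fM fr] := fP g Sg.
have F0 h : 0 <= M * (`[< isom_near x0 e h g >])%:R by rewrite mulr_ge0.
have [f0|/fr gr] := eqVneq (f g) 0; first by rewrite f0 sumr_ge0.
have [h hl hg] := lP g (conj Sg gr).
apply: (le_trans (ler_norm _)); apply: (le_trans fM).
apply: (le_trans _ (le_sum_mem F0 hl)).
by case: asboolP => // _; rewrite mulr1.
Qed.

Lemma cost_ge e f l g : covers e f l -> S g -> f g <= cost l.
Proof. by move=> [l0 lP] Sg; rewrite (le_trans (lP g Sg))// weight_le_cost. Qed.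

Lemma cost_ge0 e f l : covers e f l -> 0 <= cost l.
Proof. by move=> [l0 _]; rewrite /cost big_seq sumr_ge0// => p /l0[]. Qed.

Lemma cov_has_inf e f : 0 < e -> bounded_supp f ->
  has_inf [set cost l | l in covers e f].
Proof.
move=> e0 bf; split; first by have [l lP] := covers_exists e0 bf; exists (cost l), l.
by exists 0 => _ [l lP <-]; exact: cost_ge0 lP.
Qed.

Lemma cov_ge e f g : 0 < e -> bounded_supp f -> S g -> f g <= cov e f.
Proof.
move=> e0 bf Sg; apply: lb_le_inf; first by have [] := cov_has_inf e0 bf.
by move=> _ [l lP <-]; exact: cost_ge lP Sg.
Qed.

Lemma cov_ge0 e f : 0 < e -> bounded_supp f -> 0 <= cov e f.
Proof.
move=> e0 bf; apply: lb_le_inf; first by have [] := cov_has_inf e0 bf.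
by move=> _ [l lP <-]; exact: cost_ge0 lP.
Qed.

Lemma cov_le e f l : covers e f l -> cov e f <= cost l.
Proof.
move=> lP; apply: ge_inf; last by exists l.
by exists 0 => _ [l' l'P <-]; exact: cost_ge0 l'P.
Qed.

Lemma cov_near e f d : 0 < e -> bounded_supp f -> 0 < d ->
  exists2 l, covers e f l & cost l < cov e f + d.
Proof.
move=> e0 bf d0; have [_ [l lP <-] h] := inf_adherent d0 (cov_has_inf e0 bf).
by exists l.
Qed.

Lemma cov_mono e f f' : 0 < e -> bounded_supp f' ->
  (forall g, S g -> f g <= f' g) -> cov e f <= cov e f'.
Proof.
move=> e0 bf' ff'; apply/ler_addgt0Pr => d d0.
have [l [l0 lP] ld] := cov_near e0 bf' d0; apply/(le_trans _ (ltW ld))/cov_le.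
by split=> // g Sg; exact: le_trans (ff' g Sg) (lP g Sg).
Qed.

Lemma cov_addl e f f' : 0 < e -> bounded_supp f -> bounded_supp f' ->
  cov e (fun g => f g + f' g) <= cov e f + cov e f'.
Proof.
move=> e0 bf bf'; apply/ler_addgt0Pr => d d0; have d20 : 0 < d / 2 by rewrite divr_gt0.
have [l [l0 lP] ld] := cov_near e0 bf d20.
have [l' [l'0 l'P] l'd] := cov_near e0 bf' d20.
apply: (@le_trans _ _ (cost (l ++ l'))).
  apply: cov_le; split=> [p|g Sg]; first by rewrite mem_cat => /orP[/l0|/l'0].
  by rewrite /weight big_cat lerD//=; [exact: lP|exact: l'P].
by rewrite /cost big_cat /=; rewrite /cost in ld l'd; lra.
Qed.

Lemma cov_scale_le e c f : 0 < e -> 0 < c -> bounded_supp f ->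
  cov e (fun g => c * f g) <= c * cov e f.
Proof.
move=> e0 c0 bf; apply/ler_addgt0Pr => d d0.
have [l [l0 lP] ld] := cov_near e0 bf (divr_gt0 d0 c0).
apply: (@le_trans _ _ (cost [seq (c * p.1, p.2) | p <- l])).
  apply: cov_le; split=> [_ /mapP[p /l0[p0 Sp] ->]/=|g Sg].
    by split=> //; rewrite mulr_ge0// ltW.
  rewrite /weight big_map /=.
  under eq_bigr do rewrite -mulrA.
  by rewrite -mulr_sumr ler_pM2l//; exact: lP.
rewrite /cost big_map /= -mulr_sumr -[d](@divfK _ c) ?gt_eqF// mulrC [_ / _ * _]mulrC.
by rewrite -mulrDr [_ * c]mulrC ler_pM2l// ltW.
Qed.

Lemma cov_scale e c f : 0 < e -> 0 < c -> bounded_supp f ->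
  cov e (fun g => c * f g) = c * cov e f.
Proof.
move=> e0 c0 bf; apply/eqP; rewrite eq_le cov_scale_le//=.
have ci0 : 0 < c^-1 by rewrite invr_gt0.
have := cov_scale_le e0 ci0 (bounded_suppZ c bf).
under eq_fun do rewrite mulKf ?gt_eqF//.
by rewrite mulrC ler_pdivlMr// mulrC.
Qed.

Lemma cov_shift_le e f s : 0 < e -> bounded_supp f -> S s ->
  cov e (fun g => f (s * g)%g) <= cov e f.
Proof.
move=> e0 bf Ss; apply/ler_addgt0Pr => d d0.
have [l [l0 lP] ld] := cov_near e0 bf d0.
apply: (@le_trans _ _ (cost [seq (p.1, s^-1 * p.2)%g | p <- l])).
  apply: cov_le; split=> [_ /mapP[p /l0[p0 Sp] ->]/=|g Sg].
    by split=> //; apply: SM => //; exact: SV.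
  suff <- : weight e l (s * g)%g = weight e [seq (p.1, s^-1 * p.2)%g | p <- l] g.
    exact: lP (SM Ss Sg).
  rewrite /weight big_map /=; apply: eq_bigr => p _; congr (_ * (nat_of_bool _)%:R).
  apply: asbool_equiv_eq; rewrite -(isom_near_mull x0 e s (s^-1 * p.2)%g).
  by rewrite mulVKg.
by rewrite /cost big_map ltW.
Qed.

Lemma cov_shift e f s : 0 < e -> bounded_supp f -> S s ->
  cov e (fun g => f (s * g)%g) = cov e f.
Proof.
move=> e0 bf Ss; apply/eqP; rewrite eq_le cov_shift_le//=.
have := cov_shift_le e0 (bounded_supp_shift Ss bf) (SV Ss).
by under eq_fun do rewrite mulVKg.
Qed.

Lemma cov0 e : 0 < e -> cov e (fun=> 0) = 0.
Proof.
move=> e0; apply/eqP; rewrite eq_le cov_ge0//; last first.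
  by exists 0, 0 => g _; rewrite normr0 eqxx.
rewrite andbT (le_trans (@cov_le e _ [::] _))//; last by rewrite /cost big_nil.
by split=> // g _; rewrite /weight big_nil.
Qed.

(* Weil's argument: [f_i = h_i F] with [F = f1 + f2 + k] and [h1 + h2 <= 1], and
   the [h_i] are almost constant on the sets of a fine cover of [F]. *)
Lemma cov_superadd f1 f2 r k : (forall g, S g -> 0 <= f1 g) ->
  (forall g, S g -> 0 <= f2 g) ->
  (forall g, S g -> f1 g + f2 g != 0 -> mdist (g x0) x0 <= r) ->
  bounded_supp (fun g => f1 g + f2 g) ->
  unif_cont f1 -> unif_cont f2 -> 0 < k ->
  exists2 d, 0 < d & forall e, 0 < e -> e <= d ->
  cov e f1 + cov e f2 <= (1 + 2 * k) * (cov e (fun g => f1 g + f2 g) +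
    k * cov e (hits x0 x0 r)).
Proof.
move=> f10 f20 fr bf u1 u2 k0.
pose q := hits x0 x0 r; have bq : bounded_supp q := bounded_supp_hits x0 x0 r.
(* Since [F >= k], a variation of [k * k / 3] in [f] and of twice as much in [F] raises [f / F] by
   at most [k]. *)
have m0 : 0 < k * k / 3 by rewrite divr_gt0// mulr_gt0.
have [d1 d10 d1P] := u1 _ m0; have [d2 d20 d2P] := u2 _ m0.
pose F g := f1 g + f2 g + k.
have F0 g : S g -> 0 < F g.
  by move=> Sg; rewrite /F ltr_wpDl// addr_ge0//; [exact: f10|exact: f20].
exists (Num.min d1 d2) => [|e e0]; first by rewrite lt_min d10.
rewrite le_min => /andP[ed1 ed2].
have close d g h : 0 < d -> e <= d -> isom_near x0 e g h -> isom_near x0 d g h.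
  move=> d0 ed gh x xd; apply: (le_trans _ ed); apply: gh.
  by apply: (le_trans xd); rewrite lef_pV2 ?posrE.
have hP (f : isom X -> R) g p : S g -> S p -> 0 <= f p -> 0 <= f g -> f p <= F p ->
    `|f p - f g| <= k * k / 3 -> isom_near x0 e p g -> f g / F g <= f p / F p + k.
  move=> Sg Sp fp0 fg0 fF fpg pg.
  have Fp0 := F0 p Sp; have Fg0 := F0 g Sg.
  have FF : F p - F g <= 2 * (k * k / 3).
    have := d1P p g Sp Sg (close _ _ _ d10 ed1 pg).
    have := d2P p g Sp Sg (close _ _ _ d20 ed2 pg).
    by rewrite !ler_norml /F; lra.
  have kF : k <= F g by rewrite /F lerDr addr_ge0//; [exact: f10|exact: f20].
  rewrite ler_pdivrMr// mulrDl.
  have h1 : f g <= f p + k * k / 3 by move: fpg; rewrite ler_norml; lra.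
  have c0 : 0 <= f p / F p by rewrite divr_ge0// ltW.
  have c1 : f p / F p <= 1 by rewrite ler_pdivrMr// mul1r.
  have h2 : f p = f p / F p * F p by rewrite divfK// gt_eqF.
  have h3 : f p / F p * (F p - F g) <= 2 * (k * k / 3).
    apply: (le_trans (ler_wpM2l c0 FF)); rewrite -[leRHS]mul1r.
    by apply: ler_wpM2r => //; rewrite mulr_ge0// ltW.
  have h4 : k * k <= k * F g by rewrite ler_pM2l.
  by move: h2 h3; set t := f p / F p => h2; rewrite mulrBr -h2; lra.
(* Adding [k * q] to the function to be covered makes the cover dominate [F] on the supports of [f1]
   and [f2], where [q] is 1. *)
have bqk := bounded_suppZ k bq.
have cF : cov e (fun g => f1 g + f2 g + k * q g) <=
    cov e (fun g => f1 g + f2 g) + k * cov e q.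
  by rewrite -cov_scale//; exact: cov_addl.
apply: (@le_trans _ _ ((1 + 2 * k) * cov e (fun g => f1 g + f2 g + k * q g))); last first.
  by rewrite ler_pM2l// ltr_wpDl// mulr_gt0.
have k20 : 0 < 1 + 2 * k by rewrite ltr_wpDl// mulr_gt0.
apply/ler_addgt0Pr => d d0.
have [l [l0 lP] ld] := cov_near e0 (bounded_suppD bf bqk) (divr_gt0 d0 k20).
(* Scale each coefficient of the cover by the value of [f / F] at its centre, plus the error [k].
   For [f1] and [f2] together the two factors add up to at most [1 + 2 * k]. *)
have step f : unif_cont f -> (forall g, S g -> 0 <= f g) ->
    (forall g, S g -> f g <= f1 g + f2 g) ->
    (forall p g, S p -> S g -> isom_near x0 e p g -> `|f p - f g| <= k * k / 3) ->
    cov e f <= \sum_(p <- l) p.1 * (f p.2 / F p.2 + k).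
  move=> uf f0 ff fe.
  apply: (@le_trans _ _ (cost [seq (p.1 * (f p.2 / F p.2 + k), p.2) | p <- l])); last first.
    by rewrite /cost big_map.
  have c0 p : S p -> 0 <= f p / F p.
    by move=> Sp; rewrite divr_ge0 ?f0// ltW// F0.
  apply: cov_le; split=> [_ /mapP[p /l0[p0 Sp] ->]/=|g Sg].
    by split=> //; rewrite mulr_ge0// addr_ge0 ?c0// ltW.
  rewrite /weight big_map /=.
  have T0 p : p \in l -> 0 <= p.1 * (f p.2 / F p.2 + k) *
      (`[< isom_near x0 e p.2 g >])%:R.
    by move=> /l0[p0 Sp]; rewrite !mulr_ge0// addr_ge0 ?c0// ltW.
  have [fg0|fg0] := eqVneq (f g) 0; first by rewrite fg0 big_seq sumr_ge0.
  have gr : mdist (g x0) x0 <= r.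
    apply: fr => //; rewrite gt_eqF//; apply: lt_le_trans (ff g Sg).
    by rewrite lt_neqAle eq_sym fg0 f0.
  have -> : f g = f g / F g * F g by rewrite divfK// gt_eqF// F0.
  apply: (@le_trans _ _ (f g / F g * weight e l g)).
    apply: ler_wpM2l; first exact: c0.
    by apply: le_trans (lP g Sg); rewrite /q /hits gr mulr1.
  rewrite /weight mulr_sumr big_seq [leRHS]big_seq; apply: ler_sum => p pl.
  have [p0 Sp] := l0 p pl; case: asboolP => pg; last by rewrite !mulr0.
  rewrite !mulr1 mulrC ler_wpM2l//; apply: hP => //; try exact: f0.
    by apply: (le_trans (ff _ Sp)); rewrite /F lerDl ltW.
  exact: fe.
have s1 : cov e f1 <= \sum_(p <- l) p.1 * (f1 p.2 / F p.2 + k).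
  apply: step => // [g Sg|p g Sp Sg /(close _ _ _ d10 ed1)/d1P]; last exact.
  by rewrite lerDl f20.
have s2 : cov e f2 <= \sum_(p <- l) p.1 * (f2 p.2 / F p.2 + k).
  apply: step => // [g Sg|p g Sp Sg /(close _ _ _ d20 ed2)/d2P]; last exact.
  by rewrite lerDr f10.
apply: (le_trans (lerD s1 s2)).
apply: (@le_trans _ _ ((1 + 2 * k) * cost l)); last first.
  rewrite -[d](@divfK _ (1 + 2 * k)) ?gt_eqF// [_ / _ * _]mulrC -mulrDr.
  by rewrite ler_pM2l// ltW.
rewrite -big_split /cost mulr_sumr big_seq [leRHS]big_seq /=; apply: ler_sum => p pl.
have [p0 Sp] := l0 p pl; rewrite -mulrDr mulrC ler_wpM2r//.
have : f1 p.2 / F p.2 + f2 p.2 / F p.2 <= 1.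
  by rewrite -mulrDl ler_pdivrMr ?F0// mul1r /F lerDl ltW.
lra.
Qed.

(** * Normalised covering numbers and their limit *)

Local Notation ref := (hits x0 x0 1).

Lemma cov_ref_ge1 e : 0 < e -> 1 <= cov e ref.
Proof.
move=> e0; have := cov_ge e0 (bounded_supp_hits x0 x0 1) S1.
by rewrite {1}/hits /= mdistxx ler01.
Qed.

Lemma bounded_supp_sum (T : eqType) (l : seq T) (F : T -> isom X -> R) :
  (forall z, bounded_supp (F z)) -> bounded_supp (fun g => \sum_(z <- l) F z g).
Proof.
move=> bF; elim: l => [|z l IH].
  by exists 0, 0 => g _; rewrite big_nil normr0 eqxx.
by under eq_fun do rewrite big_cons; exact: bounded_suppD.
Qed.

Lemma cov_sum e (T : eqType) (l : seq T) (F : T -> isom X -> R) : 0 < e ->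
  (forall z, bounded_supp (F z)) ->
  cov e (fun g => \sum_(z <- l) F z g) <= \sum_(z <- l) cov e (F z).
Proof.
move=> e0 bF; elim: l => [|z l IH].
  by under eq_fun do rewrite big_nil; rewrite cov0// big_nil.
under eq_fun do rewrite big_cons; rewrite big_cons.
apply: (le_trans (cov_addl e0 (bF z) (bounded_supp_sum l bF))).
by rewrite lerD2l.
Qed.

(** A multiple of a sum of finitely many translates of [ref] dominates [f], and the number of
    translates does not depend on [e]. This is what keeps [cov_ratio] bounded. *)
Lemma cov_le_ref f : bounded_supp f -> exists c, forall e, 0 < e ->
  cov e f <= c * cov e ref.
Proof.
move=> [r [M fP]]; have M0 : 0 <= M by have [h _] := fP 1%g S1; apply: le_trans h.
have M10 : 0 < M + 1 by rewrite ltr_wpDl.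
have [l lS lP] := isom_ball_net x0 r X_proper S_closed ltr01.
exists ((M + 1) * (size l)%:R) => e e0.
(* The value 0 for [h] outside [S] gives [F h] bounded support for every [h], as [bounded_supp_sum]
   requires. *)
pose F (h : isom X) g := if `[< S h >] then ref (h^-1 * g)%g else 0.
have bF h : bounded_supp (F h).
  rewrite /F; case: asboolP => [Sh|_]; last by exists 0, 0 => g _; rewrite normr0 eqxx.
  by apply: bounded_supp_shift; [exact: SV|exact: bounded_supp_hits].
have F0 g h : 0 <= F h g by rewrite /F; case: asboolP => // _; exact: hits_ge0.
have bs := bounded_supp_sum l bF.
apply: (@le_trans _ _ (cov e (fun g => (M + 1) * \sum_(h <- l) F h g))).
  apply: cov_mono => // [|g Sg]; first exact: bounded_suppZ.
  have [fM fr] := fP g Sg; have [f0|/fr gr] := eqVneq (f g) 0.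
    by rewrite f0 mulr_ge0 ?(ltW M10)// sumr_ge0.
  have [h hl hg] := lP g (conj Sg gr).
  apply: (le_trans (ler_norm _)); apply: (le_trans fM).
  have h1 : F h g = 1.
    rewrite /F asboolT; last exact: lS.
    rewrite /hits -(isom_mdist h) /= isom_inv_funK metric_sym hg//.
    by rewrite mdistxx invr1.
  have := le_sum_mem (F0 g) hl; rewrite h1 => h2.
  apply: (@le_trans _ _ ((M + 1) * 1)); first by rewrite mulr1 lerDl.
  by rewrite ler_pM2l.
rewrite cov_scale// -mulrA ler_pM2l//; apply: (le_trans (cov_sum l e0 bF)).
apply: sum_le_size => h hl; rewrite /F asboolT; last exact: lS.
rewrite cov_shift//; [exact: bounded_supp_hits|exact/SV/lS].
Qed.

Let ep (n : nat) : R := n.+1%:R^-1.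

Let ep_gt0 n : 0 < ep n. Proof. by rewrite invr_gt0 ltr0n. Qed.

Definition cov_ratio f (n : nat) : R := cov (ep n) f / cov (ep n) ref.

Let ref_gt0 n : 0 < cov (ep n) ref.
Proof. exact: lt_le_trans ltr01 (cov_ref_ge1 (ep_gt0 n)). Qed.

Lemma cov_ratio_bounded f : bounded_supp f -> bounded_seq (cov_ratio f).
Proof.
move=> bf; have [c cP] := cov_le_ref bf; exists c => n.
rewrite ger0_norm ?divr_ge0 ?(ltW (ref_gt0 n)) ?cov_ge0//.
by rewrite ler_pdivrMr// cP.
Qed.

(* An upper Haar integral: additive on uniformly continuous functions only. *)
Definition upper_haar f : R := ulim (cov_ratio f).

Local Notation J := upper_haar.

Let ultraT : nat_ultrafilter [set: nat]. Proof. exact: filterT. Qed.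

Lemma upper_haar_mono f f' : bounded_supp f -> bounded_supp f' ->
  (forall g, S g -> f g <= f' g) -> J f <= J f'.
Proof.
move=> bf bf' ff'; apply: ulim_le; [exact: cov_ratio_bounded..|].
apply: filterS ultraT => n _ /=.
by rewrite ler_pM2r ?invr_gt0//; exact: cov_mono.
Qed.

Lemma upper_haar_ext f f' : bounded_supp f ->
  (forall g, S g -> f g = f' g) -> J f = J f'.
Proof.
move=> bf ff'; have bf' : bounded_supp f'.
  by apply: (bounded_supp_le bf) => g Sg; rewrite ff'.
by apply/eqP; rewrite eq_le !upper_haar_mono// => g Sg; rewrite ff'.
Qed.

Lemma upper_haar_ge0 f : bounded_supp f -> 0 <= J f.
Proof.
move=> bf; rewrite -(@ulim_cst R 0); apply: ulim_le.
- exact: bounded_seq_cst.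
- exact: cov_ratio_bounded.
- by apply: filterS ultraT => n _ /=; rewrite divr_ge0 ?(ltW (ref_gt0 n)) ?cov_ge0//.
Qed.

Lemma upper_haarD_le f f' : bounded_supp f -> bounded_supp f' ->
  J (fun g => f g + f' g) <= J f + J f'.
Proof.
move=> bf bf'; rewrite -ulimD; [|exact: cov_ratio_bounded..].
have bff' := bounded_suppD bf bf'.
have b1 := cov_ratio_bounded bf; have b2 := cov_ratio_bounded bf'.
have b3 := cov_ratio_bounded bff'.
apply: ulim_le => //.
  have := bounded_seq_lin 1 b1 b2; congr bounded_seq.
  by apply/funext => n; rewrite mul1r.
apply: filterS ultraT => n _ /=.
by rewrite /cov_ratio -mulrDl ler_pM2r ?invr_gt0//; exact: cov_addl.
Qed.

Lemma upper_haar0 : J (fun=> 0) = 0.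
Proof.
rewrite -[RHS](@ulim_cst R 0); congr ulim; apply/funext => n.
by rewrite /cov_ratio cov0// mul0r.
Qed.

Lemma upper_haarZ c f : 0 <= c -> bounded_supp f ->
  J (fun g => c * f g) = c * J f.
Proof.
rewrite le_eqVlt => /orP[/eqP <- _|c0 bf].
  by rewrite mul0r -[RHS]upper_haar0; congr upper_haar; apply/funext => g; rewrite mul0r.
rewrite -ulimZ; last exact: cov_ratio_bounded.
by congr ulim; apply/funext => n; rewrite /cov_ratio cov_scale// mulrA.
Qed.

Lemma upper_haar_shift f s : bounded_supp f -> S s ->
  J (fun g => f (s * g)%g) = J f.
Proof.
by move=> bf Ss; congr ulim; apply/funext => n; rewrite /cov_ratio cov_shift.
Qed.

Lemma upper_haar_sum (T : eqType) (l : seq T) (F : T -> isom X -> R) :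
  (forall z, bounded_supp (F z)) ->
  J (fun g => \sum_(z <- l) F z g) <= \sum_(z <- l) J (F z).
Proof.
move=> bF; elim: l => [|z l IH].
  by under eq_fun do rewrite big_nil; rewrite upper_haar0 big_nil.
under eq_fun do rewrite big_cons; rewrite big_cons.
apply: (le_trans (upper_haarD_le (bF z) (bounded_supp_sum l bF))).
by rewrite lerD2l.
Qed.

Lemma upper_haar_ref : J ref = 1.
Proof.
rewrite -[RHS](@ulim_cst R 1); congr ulim; apply/funext => n.
by rewrite /cov_ratio divff// gt_eqF.
Qed.

(** Once [n.+1%:R^-1] is at most the [d] of [cov_superadd], the ratios are superadditive up to [k].
    The limit is taken in [n] first, then [k] tends to 0. *)
Lemma upper_haarD f1 f2 : (forall g, S g -> 0 <= f1 g) ->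
  (forall g, S g -> 0 <= f2 g) -> bounded_supp f1 -> bounded_supp f2 ->
  unif_cont f1 -> unif_cont f2 -> J (fun g => f1 g + f2 g) = J f1 + J f2.
Proof.
move=> f10 f20 b1 b2 u1 u2; apply/eqP; rewrite eq_le upper_haarD_le//=.
have b12 := bounded_suppD b1 b2; have [r [M fP]] := b12.
set q := hits x0 x0 r; have bq : bounded_supp q := bounded_supp_hits x0 x0 r.
set A := J (fun g => f1 g + f2 g).
have A0 : 0 <= A := upper_haar_ge0 b12; have Q0 : 0 <= J q := upper_haar_ge0 bq.
(* For [k <= 1], [(1 + 2 * k) * (A + k * J q) <= A + k * (2 * A + 3 * J q)]. *)
apply: (@ler_addgt0_small _ _ _ (2 * A + 3 * J q)) => k k0 k1.
have [|||||||d d0 dP] := @cov_superadd f1 f2 r k => //.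
  by move=> g Sg; have [_] := fP g Sg.
have c1 := cov_ratio_bounded b1; have c2 := cov_ratio_bounded b2.
have c12 := cov_ratio_bounded b12; have cq := cov_ratio_bounded bq.
have [N NP] := natS_inv_small d0.
have cs := bounded_seq_lin k cq c12.
have cs' := bounded_seq_lin (1 + 2 * k) cs (bounded_seq_cst 0).
have cc : bounded_seq (fun n => cov_ratio f1 n + cov_ratio f2 n).
  have := bounded_seq_lin 1 c1 c2; congr bounded_seq.
  by apply/funext => n; rewrite mul1r.
have : ulim (fun n => cov_ratio f1 n + cov_ratio f2 n) <=
    ulim (fun n => (1 + 2 * k) * (k * cov_ratio q n +
      cov_ratio (fun g => f1 g + f2 g) n) + 0).
  apply: ulim_le => //; apply: (@nat_ultrafilter_ge N) => n /NP/ltW nd /=.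
  rewrite /cov_ratio -mulrDl addr0 [k * _]mulrA -mulrDl mulrA.
  by rewrite ler_pM2r ?invr_gt0// [k * _ + _]addrC; exact: dP.
rewrite ulimD// ulim_lin//; last exact: bounded_seq_cst.
rewrite ulim_cst addr0 ulim_lin// -!/(J _) -/A => h; apply: (le_trans h).
have h1 : k * J q <= J q by rewrite ler_piMl.
have h2 : k * (k * J q) <= k * J q by rewrite ler_pM2l.
lra.
Qed.

(** If [s y] and [g y] are both within [r' / 2] of [z], then [s^-1 g] moves [y] by at most [r']. So
    each nonempty piece of the cover lies in a left translate of one fixed set, and covering numbers
    of balls of [X] bound ratios of Haar measures. *)
Lemma upper_haar_hits_net x y r r' (l : seq X) :
  (forall z, mdist x z <= r -> exists2 z', z' \in l & mdist z' z <= r' / 2) ->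
  J (hits y x r) <= (size l)%:R * J (hits y y r').
Proof.
move=> lP; have bh z : bounded_supp (hits y z (r' / 2)) by exact: bounded_supp_hits.
apply: (@le_trans _ _ (J (fun g => \sum_(z <- l) hits y z (r' / 2) g))).
  apply: upper_haar_mono => [||g Sg]; [exact: bounded_supp_hits|exact: bounded_supp_sum|].
  rewrite {1}/hits; have [h|_] := leP (mdist (g y) x) r; last first.
    by rewrite sumr_ge0// => z _; exact: hits_ge0.
  rewrite metric_sym in h; have [z zl zg] := lP _ h.
  apply: le_trans (le_sum_mem (F := fun z => hits y z (r' / 2) g) _ zl).
    by rewrite /hits metric_sym zg.
  by move=> z'; exact: hits_ge0.
apply: (le_trans (upper_haar_sum l bh)); apply: sum_le_size => z _.
have [[s Ss sz]|none] := pselect (exists2 s, S s & mdist (s y) z <= r' / 2).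
  rewrite -(upper_haar_shift (bounded_supp_hits y y r') (SV Ss)).
  apply: upper_haar_mono => [||g Sg]; [exact: bounded_supp_hits| |].
    exact: bounded_supp_shift (SV Ss) (bounded_supp_hits y y r').
  rewrite /hits; have [h|_] := leP (mdist (g y) z) (r' / 2) => //.
  rewrite -(isom_mdist s) /= isom_inv_funK.
  have := metric_triangle (g y) z (s y); rewrite (metric_sym z (s y)) => h'.
  by rewrite (le_trans h')//; lra.
rewrite (@upper_haar_ext _ (fun=> 0)) ?upper_haar0 ?upper_haar_ge0//;
  try exact: bounded_supp_hits.
move=> g Sg; rewrite /hits; case: leP => // h; case: none.
by exists g.
Qed.

(** The unit mass of [ref] sits in the set of [g] that send [y] within [1 + mdist x0 y] of [x0], and
    finitely many translates of the set measured here cover that one. *)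
Lemma upper_haar_hits_gt0 y r : 0 < r -> 0 < J (hits y y r).
Proof.
move=> r0; have [l lP] := proper_net x0 (1 + mdist x0 y) X_proper (divr_gt0 r0 (ltr0n _ 2)).
have h1 : J (hits x0 x0 1) <= J (hits y x0 (1 + mdist x0 y)).
  apply: upper_haar_mono => [||g Sg]; [exact: bounded_supp_hits..|].
  rewrite /hits; have [h|_] := leP (mdist (g x0) x0) 1 => //.
  have := metric_triangle (g y) (g x0) x0; rewrite isom_mdist (metric_sym y x0) => h'.
  by rewrite (le_trans h')//; lra.
rewrite upper_haar_ref in h1.
have h2 := le_trans h1 (upper_haar_hits_net y lP).
have : 0 <= J (hits y y r) by apply/upper_haar_ge0/bounded_supp_hits.
rewrite le_eqVlt => /orP[/eqP h3|//].
by move: h2; rewrite -h3 mulr0 ler10.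
Qed.

(** * The Haar functional on signed functions *)

Definition Cc f : Prop := bounded_supp f /\ unif_cont f.

Lemma unif_cont_lin a f f' : unif_cont f -> unif_cont f' ->
  unif_cont (fun g => a * f g + f' g).
Proof.
move=> uf uf' e e0; have a0 : 0 < `|a| + 1 by rewrite ltr_wpDl.
have m0 : 0 < e / (`|a| + 1) by rewrite divr_gt0.
have [d d0 dP] := uf _ m0; have [d' d'0 d'P] := uf' _ m0.
exists (Num.min d d') => [|g h Sg Sh gh]; first by rewrite lt_min d0.
have gd (b : R) : 0 < b -> Num.min d d' <= b -> isom_near x0 b g h.
  move=> b0 mb x xb; apply: (le_trans _ mb); apply: gh; apply: (le_trans xb).
  by rewrite lef_pV2 ?posrE// lt_min d0.
have h1 := dP g h Sg Sh (gd d d0 (ltac:(by rewrite ge_min lexx))).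
have h2 := d'P g h Sg Sh (gd d' d'0 (ltac:(by rewrite ge_min lexx orbT))).
have -> : a * f g + f' g - (a * f h + f' h) = a * (f g - f h) + (f' g - f' h) by ring.
rewrite (le_trans (ler_normD _ _))// normrM.
have -> : e = `|a| * (e / (`|a| + 1)) + e / (`|a| + 1) by field; rewrite gt_eqF.
by rewrite lerD// ler_wpM2l.
Qed.

Lemma unif_cont_cst c : unif_cont (fun=> c).
Proof. by move=> e e0; exists 1 => // g h _ _ _; rewrite subrr normr0 ltW. Qed.

Lemma unif_contZ a f : unif_cont f -> unif_cont (fun g => a * f g).
Proof.
move=> uf; have := unif_cont_lin a uf (unif_cont_cst 0).
by congr unif_cont; apply/funext => g; rewrite addr0.
Qed.

Lemma max_lipschitz (a b a' b' c : R) : `|a - a'| <= c -> `|b - b'| <= c ->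
  `|Num.max a b - Num.max a' b'| <= c.
Proof.
by rewrite !ler_norml; have [h|h] := leP a b; have [h'|h'] := leP a' b'; lra.
Qed.

Lemma unif_cont_max f f' : unif_cont f -> unif_cont f' ->
  unif_cont (fun g => Num.max (f g) (f' g)).
Proof.
move=> uf uf' e e0.
have [d d0 dP] := uf _ e0; have [d' d'0 d'P] := uf' _ e0.
exists (Num.min d d') => [|g h Sg Sh gh]; first by rewrite lt_min d0.
have gd (b : R) : 0 < b -> Num.min d d' <= b -> isom_near x0 b g h.
  move=> b0 mb x xb; apply: (le_trans _ mb); apply: gh; apply: (le_trans xb).
  by rewrite lef_pV2 ?posrE// lt_min d0.
apply: max_lipschitz.
  by apply: dP => //; apply: gd; rewrite // ge_min lexx.
by apply: d'P => //; apply: gd; rewrite // ge_min lexx orbT.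
Qed.

Lemma unif_cont_mdist y x : unif_cont (fun g => mdist (g y) x).
Proof.
move=> e e0; have y0 : 0 < 1 + mdist x0 y by rewrite ltr_wpDr ?mdist_ge0.
exists (Num.min e (1 + mdist x0 y)^-1) => [|g h Sg Sh gh].
  by rewrite lt_min e0 invr_gt0.
have m0 : 0 < Num.min e (1 + mdist x0 y)^-1 by rewrite lt_min e0 invr_gt0.
have : mdist (g y) (h y) <= Num.min e (1 + mdist x0 y)^-1.
  apply: gh; apply: (@le_trans _ _ (1 + mdist x0 y)); first by rewrite lerDr.
  by rewrite -[leLHS]invrK lef_pV2 ?posrE ?invr_gt0// ge_min lexx orbT.
rewrite le_min => /andP[gy _]; have := metric_triangle (g y) (h y) x.
have := metric_triangle (h y) (g y) x; rewrite (metric_sym (h y) (g y)) ler_norml.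
by move=> h1 h2; apply/andP; split; lra.
Qed.

Lemma Cc_lin a f f' : Cc f -> Cc f' -> Cc (fun g => a * f g + f' g).
Proof.
by move=> [bf uf] [bf' uf']; split; [exact: bounded_supp_lin|exact: unif_cont_lin].
Qed.

(** [f] is merely continuous, but uniformly so on the ball of radius [r + 1]. If [g] lies outside
    it, then [g] and every [h] with [h x0] within 1 of [g x0] are outside the support of [psi]. *)
Lemma CcM f psi M : {within S, continuous f} -> (forall g, S g -> `|f g| <= M) ->
  Cc psi -> Cc (fun g => f g * psi g).
Proof.
move=> cf fM [bpsi upsi].
have M0 : 0 <= M by apply: le_trans (fM _ S1).
split.
  apply: (bounded_supp_le (bounded_suppZ M bpsi)) => g Sg.
  by rewrite !normrM ler_wpM2r// (ger0_norm M0) fM.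
have [r [N psiP]] := bpsi; have N0 : 0 <= N by have [h _] := psiP _ S1; apply: le_trans h.
move=> e e0; pose k := e / (M + N + 1).
have MN0 : 0 < M + N + 1 by rewrite ltr_wpDl// addr_ge0.
have k0 : 0 < k by rewrite divr_gt0.
have [d d0 dP] := isom_ball_unif x0 (r + 1) X_proper S_closed cf k0.
have [d' d'0 d'P] := upsi _ k0.
pose m := Num.min 1 (Num.min d d').
have m0 : 0 < m by rewrite !lt_min ltr01 d0.
exists m => // g h Sg Sh gh.
have gd (b : R) : 0 < b -> m <= b -> isom_near x0 b g h.
  move=> b0 mb x xb; apply: (le_trans _ mb); apply: gh; apply: (le_trans xb).
  by rewrite lef_pV2 ?posrE.
have gh0 : mdist (g x0) (h x0) <= 1.
  by apply: gd; rewrite // ?ge_min ?lexx// mdistxx invr1.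
have [gr|gr] := leP (mdist (g x0) x0) (r + 1).
  have h1 := dP g h (conj Sg gr) Sh (gd d d0 (ltac:(by rewrite !ge_min lexx orbT))).
  have h2 := d'P g h Sg Sh (gd d' d'0 (ltac:(by rewrite !ge_min lexx !orbT))).
  have -> : f g * psi g - f h * psi h =
    f g * (psi g - psi h) + psi h * (f g - f h) by ring.
  rewrite (le_trans (ler_normD _ _))// !normrM.
  have h3 : `|f g| * `|psi g - psi h| <= M * k by apply: ler_pM => //; exact: fM.
  have h4 : `|psi h| * `|f g - f h| <= N * k.
    by apply: ler_pM => //; have [] := psiP h Sh.
  have -> : e = (M + N + 1) * k by rewrite mulrC divfK// gt_eqF.
  by rewrite !mulrDl mul1r; have := ltW k0; lra.
have [_ gr0] := psiP g Sg; have [_ hr0] := psiP h Sh.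
have -> : psi g = 0.
  by apply/eqP/negPn/negP => /gr0 gr'; lra.
have -> : psi h = 0.
  apply/eqP/negPn/negP => /hr0 hr'.
  by have := metric_triangle (g x0) (h x0) x0; lra.
by rewrite !mulr0 subrr normr0 ltW.
Qed.

Definition fpos f g : R := Num.max (f g) 0.

Lemma fpos_ge0 f g : 0 <= fpos f g. Proof. by rewrite /fpos le_max lexx orbT. Qed.

Lemma fpos_sub f g : f g = fpos f g - fpos (fun h => - f h) g.
Proof.
by rewrite /fpos; have [h|h] := leP (f g) 0; have [h'|h'] := leP (- f g) 0; lra.
Qed.

Lemma CcN f : Cc f -> Cc (fun g => - f g).
Proof.
move=> [bf uf]; split; first by apply: (bounded_supp_le bf) => g _; rewrite normrN.
have := unif_contZ (-1) uf; congr unif_cont.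
by apply/funext => g; rewrite mulN1r.
Qed.

Lemma Cc_fpos f : Cc f -> Cc (fpos f).
Proof.
move=> [bf uf]; split; last exact: unif_cont_max uf (unif_cont_cst 0).
apply: (bounded_supp_le bf) => g _; rewrite ger0_norm ?fpos_ge0// /fpos ge_max.
by rewrite ler_norm normr_ge0.
Qed.

Definition haar f : R := J (fpos f) - J (fpos (fun g => - f g)).

(** On [S], [fpos f + b = a + fpos (- f)], and [upper_haarD] applies to both sides. Freedom in the
    choice of [a] and [b] is what makes [haar] linear. *)
Lemma haar_sub f a b : Cc f -> Cc a -> Cc b -> (forall g, S g -> 0 <= a g) ->
  (forall g, S g -> 0 <= b g) -> (forall g, S g -> f g = a g - b g) ->
  haar f = J a - J b.
Proof.
move=> cf [ba ua] [bb ub] a0 b0 fE.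
have [bp up] := Cc_fpos cf; have [bn un] := Cc_fpos (CcN cf).
apply/eqP; rewrite subr_eq addrAC eq_sym subr_eq; apply/eqP.
rewrite -!upper_haarD//; try by move=> g _; exact: fpos_ge0.
apply: upper_haar_ext => [|g Sg]; first exact: bounded_suppD.
by have := fE g Sg; rewrite [LHS]fpos_sub; lra.
Qed.

Lemma haar_pos f : Cc f -> (forall g, S g -> 0 <= f g) -> haar f = J f.
Proof.
move=> cf f0; have c0 : Cc (fun=> 0).
  by split; [exists 0, 0 => g _; rewrite normr0 eqxx|exact: unif_cont_cst].
by rewrite (haar_sub cf cf c0)//= ?upper_haar0 ?subr0// => g _; rewrite subr0.
Qed.

Lemma CcZ a f : Cc f -> Cc (fun g => a * f g).
Proof. by move=> [bf uf]; split; [exact: bounded_suppZ|exact: unif_contZ]. Qed.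

Lemma haar_lin a f f' : Cc f -> Cc f' ->
  haar (fun g => a * f g + f' g) = a * haar f + haar f'.
Proof.
move=> cf cf'; have cl := Cc_lin a cf cf'.
have [cp cn] := (Cc_fpos cf, Cc_fpos (CcN cf)).
have [cp' cn'] := (Cc_fpos cf', Cc_fpos (CcN cf')).
have P0 := fpos_ge0; have Z0 (c : R) (h : isom X -> R) g : 0 <= c -> 0 <= fpos h g :> R ->
  0 <= c * fpos h g by exact: mulr_ge0.
have JD (c : R) u v : 0 <= c -> Cc (fpos u) -> Cc (fpos v) ->
    J (fun g => c * fpos u g + fpos v g) = c * J (fpos u) + J (fpos v).
  move=> c0 cu cv; have [bu uu] := CcZ c cu; have [bv uv] := cv.
  by rewrite upper_haarD// ?upper_haarZ//; [have [] := cu|move=> g _; exact: Z0].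
have [a0|/ltW a0] := leP 0 a.
  rewrite (haar_sub cl (Cc_lin a cp cp') (Cc_lin a cn cn')).
  - by rewrite !JD// /haar; ring.
  - by move=> g _; rewrite addr_ge0// Z0.
  - by move=> g _; rewrite addr_ge0// Z0.
  - by move=> g _; rewrite {1}(fpos_sub f) {1}(fpos_sub f'); ring.
have a0' : 0 <= - a by rewrite oppr_ge0.
rewrite (haar_sub cl (Cc_lin (- a) cn cp') (Cc_lin (- a) cp cn')).
- by rewrite !JD// /haar; ring.
- by move=> g _; rewrite addr_ge0// Z0.
- by move=> g _; rewrite addr_ge0// Z0.
- by move=> g _; rewrite {1}(fpos_sub f) {1}(fpos_sub f'); ring.
Qed.

Lemma haar_shift f s : Cc f -> S s -> haar (fun g => f (s * g)%g) = haar f.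
Proof.
move=> cf Ss; have [bp _] := Cc_fpos cf; have [bn _] := Cc_fpos (CcN cf).
by rewrite /haar -(upper_haar_shift bp Ss) -(upper_haar_shift bn Ss).
Qed.

(** The two parts of [f] have integrals between 0 and [J phi], hence no factor 2. The majorant [phi]
    may be discontinuous, as combinations of [hits] are. *)
Lemma haar_norm_le f phi : Cc f -> bounded_supp phi ->
  (forall g, S g -> `|f g| <= phi g) -> `|haar f| <= J phi.
Proof.
move=> cf bphi fphi; have [bp _] := Cc_fpos cf; have [bn _] := Cc_fpos (CcN cf).
have h1 : J (fpos f) <= J phi.
  apply: upper_haar_mono => // g Sg; have := fphi g Sg; rewrite ler_norml /fpos ge_max.
  by move=> /andP[h1 h2]; rewrite h2/=; lra.
have h2 : J (fpos (fun g => - f g)) <= J phi.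
  apply: upper_haar_mono => // g Sg; have := fphi g Sg; rewrite ler_norml /fpos ge_max.
  by move=> /andP[h2 h3]; apply/andP; split; lra.
have h3 := upper_haar_ge0 bp; have h4 := upper_haar_ge0 bn.
by rewrite /haar ler_norml; apply/andP; split; lra.
Qed.

End HaarFunctional.

(** * Equivariant means on closed groups of isometries *)

Lemma quotient_sub {R : realType} (a a' b b' : R) : 0 < b -> 0 < b' ->
  a / b - a' / b' = ((a - a') + a' / b' * (b' - b)) / b.
Proof. by move=> b0 b'0; field; rewrite !gt_eqF. Qed.

Section EquivariantMeans.
Context {R : realType} {X : metricType R} (x0 : X).
Hypotheses (X_proper : proper_space X) (X_cocompact : cocompact X).
Variable S : set (isom X).
Hypotheses (S_group : is_subgroup S) (S_closed : closed S).
Implicit Types (f : isom X -> R) (g h s : isom X) (x y z : X).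

Let S1 : S 1%g. Proof. by case: S_group. Qed.
Let SM g h : S g -> S h -> S (g * h)%g. Proof. by case: S_group => _ + _; exact. Qed.
Let SV g : S g -> S g^-1%g. Proof. by case: S_group => _ _; exact. Qed.

Local Notation J := (upper_haar x0 S).
Local Notation I := (haar x0 S).

(** An isometry brings [x] from a point of [K], so one net of a large ball about [x0] serves every
    centre after transport. *)
Lemma uniform_net (r e : R) : 0 < e -> exists N : nat, forall x,
  exists2 l : seq X, size l = N &
    forall y, mdist x y <= r -> exists2 z, z \in l & mdist z y <= e.
Proof.
move=> e0; have [K cK KP] := X_cocompact.
have [z _|k kK kP] := compact_finite_cover (P := fun z y => mdist z y < 1) cK.
  exact: nbhs_mdist.
pose D := 1 + \sum_(z <- k) mdist x0 z.
have KD y : K y -> mdist x0 y <= D.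
  move=> /kP[z zk zy].
  have := le_sum_mem (F := fun z => mdist x0 z) (fun z => mdist_ge0 _ _) zk.
  by have := metric_triangle x0 z y; rewrite /D; lra.
have [l lP] := proper_net x0 (D + r) X_proper e0.
exists (size l) => x; have [g [y [/KD Ky <-]]] := KP x.
exists (map g l) => [|z gyz]; first by rewrite size_map.
have [|w wl wz] := lP (isom_inv_fun g z).
  rewrite -(isom_inv_funK g z) isom_mdist in gyz.
  by have := metric_triangle x0 y (isom_inv_fun g z); lra.
exists (g w); first exact: map_f.
by rewrite -(isom_inv_funK g z) isom_mdist.
Qed.

(** Distinct orbits are kept apart and nothing is asked within one orbit, which may accumulate. Such
    a set contains at most one point of each orbit. *)
Definition separated_orbits (A : set X) : Prop := forall y y' g, A y -> A y' ->
  S g -> y != y' -> 1 <= mdist (g y) y'.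

Lemma maximal_separated_orbits : exists Y, separated_orbits Y /\
  forall x, exists y g, [/\ Y y, S g & mdist (g y) x < 1].
Proof.
have [|Y [Ysep Ymax]] := @Zorn_bigcup X separated_orbits.
  move=> F FP Ftot y y' g [A FA Ay] [A' FA' Ay'] Sg yy'.
  have [AA'|A'A] := Ftot _ _ FA FA'.
    by apply: (FP _ FA') => //; exact: AA'.
  by apply: (FP _ FA) => //; exact: A'A.
exists Y; split=> // x; apply: contrapT => none.
have far y g : Y y -> S g -> 1 <= mdist (g y) x.
  by move=> Yy Sg; rewrite leNgt; apply/negP => h; apply: none; exists y, g.
have xY : ~ Y x by move=> /far/(_ S1); rewrite mdistxx ler10.
apply: (Ymax (Y `|` [set x])).
  split=> [|/(_ x)]; first exact: subsetUl.
  by move=> h; apply: xY; apply: h; right.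
move=> y y' g [Yy|->] [Yy'|->] Sg yy'; [exact: Ysep|exact: far| |by rewrite eqxx in yy'].
have := far y' _ Yy' (SV Sg).
by rewrite -(isom_mdist g (isom_inv_fun g y') x) isom_inv_funK metric_sym.
Qed.

Definition orbit_net : set X := projT1 (cid maximal_separated_orbits).

Local Notation Y := orbit_net.

Lemma orbit_net_separated : separated_orbits Y.
Proof. by have [] := projT2 (cid maximal_separated_orbits). Qed.

Lemma orbit_netP x : exists y g, [/\ Y y, S g & mdist (g y) x < 1].
Proof. by have [_] := projT2 (cid maximal_separated_orbits); exact. Qed.

(** Each orbit of a point of [Y] that meets the ball of radius 3 meets one of [N] balls of radius
    1/3, and by separation no two meet the same one. The radius 3 is the width 2 of [bump] plus a
    displacement of 1. *)
Lemma orbit_net_finite : exists N : nat, forall x, exists l : seq X,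
  [/\ (size l <= N)%N, forall y, y \in l -> Y y &
      forall y g, Y y -> S g -> mdist (g y) x <= 3 -> y \in l].
Proof.
have e0 : 0 < 3^-1 :> R by rewrite invr_gt0.
have [N NP] := uniform_net 3 e0; exists N => x; have [l <- lP] := NP x.
pose hit y z := Y y /\ exists2 g, S g & mdist (g y) z <= 3^-1.
pose pick z : option X := match pselect (exists y, hit y z) with
  | left h => Some (projT1 (cid h)) | right _ => None end.
have pickP z y : pick z = Some y -> hit y z.
  by rewrite /pick; case: pselect => // h [<-]; case: cid.
exists (pmap pick l); split=> [|y|y g Yy Sg gyx].
- by rewrite size_pmap count_size.
- by rewrite mem_pmap => /mapP[z _ /esym/pickP[]].
rewrite metric_sym in gyx; have [z zl zg] := lP _ gyx.
rewrite mem_pmap; apply/mapP; exists z => //.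
case Ez : (pick z) => [y'|]; last first.
  move: Ez; rewrite /pick; case: pselect => // none _; case: none.
  by exists y; split=> //; exists g => //; rewrite metric_sym.
have [Yy' [g' Sg' g'y']] := pickP _ _ Ez; congr Some.
apply/eqP/negPn/negP => yy'.
have := orbit_net_separated Yy Yy' (SM (SV Sg') Sg) yy'.
rewrite -(isom_mdist g') /= isom_inv_funK.
have := metric_triangle (g y) z (g' y').
by rewrite (metric_sym (g y) z) (metric_sym z (g' y')); lra.
Qed.

(* The weights make up for the lack of unimodularity of [S]. *)
Let W y : R := J (hits y y 2^-1).

Let W_gt0 y : 0 < W y.
Proof. by apply: upper_haar_hits_gt0 => //; rewrite invr_gt0. Qed.

(** The width 2 leaves room around the orbit point that [orbit_netP] provides within 1 of [x];
    [kernel_mass] depends on this margin. *)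
Definition bump y x g : R := Num.max (2 - mdist (g y) x) 0 / W y.

Lemma bump_ge0 y x g : 0 <= bump y x g.
Proof. by rewrite /bump divr_ge0 ?(ltW (W_gt0 _))// le_max lexx orbT. Qed.

Lemma bump_eq0 y x g : 2 <= mdist (g y) x -> bump y x g = 0.
Proof. by move=> h; rewrite /bump max_r ?mul0r// subr_le0. Qed.

Lemma bump_lipschitz y x x' g : `|bump y x g - bump y x' g| <= mdist x x' / W y.
Proof.
rewrite /bump -mulrBl normrM normfV (gtr0_norm (W_gt0 y)) ler_pM2r ?invr_gt0//.
apply: max_lipschitz; last by rewrite subrr normr0 mdist_ge0.
have := metric_triangle (g y) x x'; have := metric_triangle (g y) x' x.
by rewrite (metric_sym x' x) ler_norml => h1 h2; apply/andP; split; lra.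
Qed.

(* A function of [g^-1 x] only, hence the equivariance [kernel_equiv]. *)
Definition kernel x g : R := sup [set bump y x g | y in Y].

Lemma kernel_has_sup x g : S g -> has_sup [set bump y x g | y in Y].
Proof.
move=> Sg; split; first by have [y [_ [Yy _ _]]] := orbit_netP x0; exists (bump y x g), y.
have [N NP] := orbit_net_finite; have [l [_ lY lP]] := NP x.
exists (\sum_(y <- l) bump y x g) => _ [y Yy <-].
have [h|h] := leP 2 (mdist (g y) x).
  by rewrite bump_eq0// sumr_ge0// => z _; exact: bump_ge0.
apply: (le_sum_mem (F := fun y => bump y x g)) => [z|]; first exact: bump_ge0.
by apply: (lP y g) => //; lra.
Qed.

Lemma kernel_ge y x g : S g -> Y y -> bump y x g <= kernel x g.
Proof.
by move=> Sg Yy; apply: ub_le_sup; [have [] := kernel_has_sup x Sg|exists y].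
Qed.

Lemma kernel_ge0 x g : S g -> 0 <= kernel x g.
Proof.
move=> Sg; have [y [_ [Yy _ _]]] := orbit_netP x0.
exact: le_trans (bump_ge0 y x g) (kernel_ge x Sg Yy).
Qed.

Lemma kernel_lub x g (c : R) : S g -> (forall y, Y y -> bump y x g <= c) ->
  kernel x g <= c.
Proof.
move=> Sg h; apply: ge_sup; first by have [] := kernel_has_sup x Sg.
by move=> _ [y Yy <-]; exact: h.
Qed.

Lemma kernel_dist_le x x' g g' (c : R) : S g -> S g' ->
  (forall y, Y y -> `|bump y x g - bump y x' g'| <= c) ->
  `|kernel x g - kernel x' g'| <= c.
Proof.
move=> Sg Sg' h.
have h1 : kernel x g <= kernel x' g' + c.
  apply: kernel_lub => // y Yy; have := h y Yy; have := kernel_ge x' Sg' Yy.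
  by rewrite ler_norml; lra.
have h2 : kernel x' g' <= kernel x g + c.
  apply: kernel_lub => // y Yy; have := h y Yy; have := kernel_ge x Sg Yy.
  by rewrite ler_norml; lra.
by rewrite ler_norml; apply/andP; split; lra.
Qed.

Lemma kernel_equiv s x g : kernel (s x) (s * g)%g = kernel x g.
Proof.
congr sup; apply/seteqP; split=> _ [y Yy <-]; exists y => //;
by rewrite /bump /= isom_mdist.
Qed.

Lemma unif_cont_bump y x : unif_cont x0 S (bump y x).
Proof.
have u := unif_contZ (W y)^-1 (unif_cont_max (unif_cont_lin (-1)
  (unif_cont_mdist x0 S y x) (unif_cont_cst x0 S 2)) (unif_cont_cst x0 S 0)).
move: u; congr unif_cont; apply/funext => g.
by rewrite /bump mulrC mulN1r [- _ + _]addrC.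
Qed.

Lemma unif_cont_seq (T : eqType) (l : seq T) (F : T -> isom X -> R) (e : R) :
  (forall t, unif_cont x0 S (F t)) -> 0 < e -> exists2 d : R, 0 < d &
  forall t g h, t \in l -> S g -> S h -> isom_near x0 d g h -> `|F t g - F t h| <= e.
Proof.
move=> uF e0; elim: l => [|t l [d d0 dP]]; first by exists 1.
have [d' d'0 d'P] := uF t e e0.
exists (Num.min d d') => [|t' g h]; first by rewrite lt_min d0.
rewrite in_cons => tl Sg Sh gh.
have gd (b : R) : 0 < b -> Num.min d d' <= b -> isom_near x0 b g h.
  move=> b0 mb x xb; apply: (le_trans _ mb); apply: gh; apply: (le_trans xb).
  by rewrite lef_pV2 ?posrE// lt_min d0.
case/orP: tl => [/eqP ->|tl].
  by apply: d'P => //; apply: gd; rewrite // ge_min lexx orbT.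
by apply: dP => //; apply: gd; rewrite // ge_min lexx.
Qed.

(** Every [y] outside the finite list [l] has a bump at [x] that vanishes on [S], so the supremum is
    in effect one of finitely many functions. *)
Lemma Cc_kernel x : Cc x0 S (kernel x).
Proof.
have [N NP] := orbit_net_finite; have [l [_ lY lP]] := NP x; split.
  apply: (bounded_supp_le (f' := fun g => \sum_(y <- l) 2 / W y * hits y x 2 g)).
    by apply: bounded_supp_sum => z; exact/bounded_suppZ/bounded_supp_hits.
  have t0 g y : 0 <= 2 / W y * hits y x 2 g.
    by rewrite mulr_ge0 ?hits_ge0// divr_ge0// ltW.
  move=> g Sg; rewrite !ger0_norm ?kernel_ge0 ?sumr_ge0//.
  apply: kernel_lub => // y Yy; have [h|h] := leP 2 (mdist (g y) x).
    by rewrite bump_eq0// sumr_ge0.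
  apply: (@le_trans _ _ (2 / W y * hits y x 2 g)).
    rewrite /hits (ltW h) mulr1 ler_pM2r ?invr_gt0// ge_max ler0n andbT.
    by rewrite gerBl mdist_ge0.
  apply: (le_sum_mem (F := fun y => 2 / W y * hits y x 2 g)) => //.
  by apply: (lP y g) => //; lra.
move=> e e0; have [d d0 dP] := unif_cont_seq l (fun y => unif_cont_bump y x) e0.
exists d => // g h Sg Sh gh; apply: kernel_dist_le => // y Yy.
have [yl|yl] := boolP (y \in l); first exact: dP.
have far k : S k -> 2 <= mdist (k y) x.
  by move=> Sk; rewrite leNgt; apply/negP => hk; move: yl; rewrite (lP y k)//; lra.
by rewrite !bump_eq0 ?far// subrr normr0 ltW.
Qed.

(** Some [s] in [S] brings some [y] within 1 of [x]. For [g] in the translate by [s] of the set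
    measured by [W y], the point [g y] is within 3/2 of [x], so the bump is at least [2^-1 / W y]
    there. *)
Lemma kernel_mass x : 2^-1 <= I (kernel x).
Proof.
rewrite haar_pos//; [|exact: Cc_kernel|by move=> g; exact: kernel_ge0].
have [y [s [Yy Ss sy]]] := orbit_netP x.
have bh := bounded_supp_hits x0 S y y 2^-1.
have bs := bounded_supp_shift S_group (SV Ss) bh.
have W0 : 0 <= 2^-1 / W y by rewrite divr_ge0 ?invr_ge0// ltW.
have <- : J (fun g => 2^-1 / W y * hits y y 2^-1 (s^-1 * g)%g) = 2^-1.
  rewrite (upper_haarZ X_proper S_group S_closed W0 bs).
  rewrite (upper_haar_shift X_proper S_group S_closed bh (SV Ss)) -/(W y).
  by rewrite divfK// gt_eqF.
apply: upper_haar_mono => //; [exact: bounded_suppZ|by case: (Cc_kernel x)|].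
move=> g Sg; apply: le_trans (kernel_ge x Sg Yy); rewrite /hits.
have [h|_] := leP (mdist ((s^-1 * g)%g y) y) 2^-1; last by rewrite mulr0 bump_ge0.
rewrite mulr1 /bump ler_pM2r ?invr_gt0// le_max; apply/orP; left.
rewrite -(isom_mdist s) /= isom_inv_funK in h.
by have := metric_triangle (g y) (s y) x; lra.
Qed.

(** Only pairs with [g y] within 3 of [x] contribute, hence at most [N] points [y]. For each of them
    the set of such [g] has measure at most [N' * W y] by [upper_haar_hits_net], which cancels the
    factor [1 / W y]. *)
Lemma kernel_dist : exists2 C : R, 0 <= C & forall x x', mdist x x' <= 1 ->
  exists2 phi, bounded_supp x0 S phi /\ J phi <= C * mdist x x' &
    forall g, S g -> `|kernel x g - kernel x' g| <= phi g.
Proof.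
have [N NP] := orbit_net_finite.
have [|N' N'P] := @uniform_net 3 (2^-1 / 2); first by rewrite divr_gt0 ?invr_gt0.
exists (N%:R * N'%:R); first by rewrite mulr_ge0.
move=> x x' xx'; have [l [lN lY lP]] := NP x; have [l' l'N l'P] := N'P x.
set d := mdist x x' in xx' *; have d0 : 0 <= d := mdist_ge0 _ _.
have dW y : 0 <= d / W y by rewrite divr_ge0 ?mdist_ge0// ltW.
have bz z := bounded_suppZ (d / W z) (bounded_supp_hits x0 S z x 3).
exists (fun g => \sum_(y <- l) d / W y * hits y x 3 g).
  split; first exact: bounded_supp_sum.
  apply: (le_trans (upper_haar_sum X_proper S_group S_closed l bz)).
  apply: (@le_trans _ _ ((size l)%:R * (N'%:R * d))); last first.
    by rewrite -mulrA ler_wpM2r ?mulr_ge0// ler_nat.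
  apply: sum_le_size => y _.
  rewrite upper_haarZ//; last exact: bounded_supp_hits.
  have := upper_haar_hits_net x0 X_proper S_group S_closed y l'P.
  rewrite -/(W y) l'N => h.
  apply: (le_trans (ler_wpM2l (dW y) h)).
  by rewrite mulrCA divfK// gt_eqF.
move=> g Sg; apply: kernel_dist_le => // y Yy.
have T0 z : 0 <= d / W z * hits z x 3 g by rewrite mulr_ge0// hits_ge0.
have [h|h] := leP (mdist (g y) x) 3.
  apply: (le_trans (bump_lipschitz y x x' g)).
  apply: le_trans (le_sum_mem T0 (lP y g Yy Sg h)).
  by rewrite /hits h mulr1.
rewrite !bump_eq0 ?subrr ?normr0 ?sumr_ge0//; last lra.
by have := metric_triangle (g y) x' x; rewrite (metric_sym x' x) -/d; lra.
Qed.

(** The integral of [f] against the probability measure attached to [x]; [kernel_mass] keeps the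
    denominator away from 0. *)
Definition push f x : R := I (fun g => f g * kernel x g) / I (kernel x).

Let I_gt0 x : 0 < I (kernel x).
Proof. by apply: lt_le_trans (kernel_mass x); rewrite invr_gt0. Qed.

Lemma Cc_push f x : bounded_continuous_on S f -> Cc x0 S (fun g => f g * kernel x g).
Proof.
move=> [fc [M fM]].
exact: (CcM X_proper S_group S_closed fc fM (Cc_kernel x)).
Qed.

Lemma push_lin (a : R) f f' x : bounded_continuous_on S f ->
  bounded_continuous_on S f' ->
  push (fun g => a * f g + f' g) x = a * push f x + push f' x.
Proof.
move=> bf bf'; rewrite /push mulrA -mulrDl; congr (_ / _).
rewrite -(haar_lin X_proper S_group S_closed a (Cc_push x bf) (Cc_push x bf')).
by congr haar; apply/funext => g; ring.
Qed.

Lemma push_ge0 f x : bounded_continuous_on S f -> (forall g, S g -> 0 <= f g) ->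
  0 <= push f x.
Proof.
move=> bf f0; rewrite /push divr_ge0 ?(ltW (I_gt0 x))//.
have p0 g : S g -> 0 <= f g * kernel x g.
  by move=> Sg; rewrite mulr_ge0 ?f0 ?kernel_ge0.
rewrite haar_pos//; last exact: Cc_push.
by apply: upper_haar_ge0 => //; case: (Cc_push x bf).
Qed.

Lemma push1 x : push (fun=> 1) x = 1.
Proof.
rewrite /push (_ : (fun g => _) = kernel x) ?divff ?gt_eqF//.
by apply/funext => g; rewrite mul1r.
Qed.

Lemma push_norm_le f x (M : R) : bounded_continuous_on S f ->
  (forall g, S g -> `|f g| <= M) -> `|push f x| <= M.
Proof.
move=> bf fM; rewrite /push normrM normfV (gtr0_norm (I_gt0 x)) ler_pdivrMr//.
have M0 : 0 <= M by apply: le_trans (fM _ S1).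
have [bk uk] := Cc_kernel x.
rewrite (haar_pos X_proper S_group S_closed (Cc_kernel x) (kernel_ge0 x)).
rewrite -(upper_haarZ X_proper S_group S_closed M0 bk).
apply: haar_norm_le => //; [exact: Cc_push|exact: bounded_suppZ|].
move=> g Sg; rewrite normrM (ger0_norm (kernel_ge0 x Sg)).
by rewrite ler_wpM2r ?kernel_ge0// fM.
Qed.

Lemma push_lipschitz f : bounded_continuous_on S f -> exists2 L : R, 0 <= L &
  forall x x', `|push f x - push f x'| <= L * mdist x x'.
Proof.
move=> bf; have [_ [M fM]] := bf.
have M0 : 0 <= M by apply: le_trans (fM _ S1).
have [C C0 CP] := kernel_dist.
(* Beyond distance 1 the trivial bound [2 * M] is enough. Otherwise numerator and denominator vary
   by at most [M * e] and [e], and the denominators are at least 1/2. *)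
exists (4 * M * C + 2 * M) => [|x x']; first by rewrite addr_ge0 ?mulr_ge0.
have d0 := mdist_ge0 x x'; have pM z := push_norm_le z bf fM.
have [d1|d1] := leP (mdist x x') 1; last first.
  have h1 : M * 1 <= M * mdist x x' by rewrite ler_wpM2l// ltW.
  have h2 : 0 <= 4 * M * C * mdist x x' by rewrite !mulr_ge0.
  apply: (le_trans (ler_normB _ _)); apply: (le_trans (lerD (pM x) (pM x'))).
  rewrite mulrDl; move: h1 h2; rewrite -[2 * M * _]mulrA.
  by set t := M * mdist x x'; set t' := 4 * M * C * _; lra.
have [phi [bphi Jphi] phiP] := CP x x' d1.
have [cx cx'] := (Cc_push x bf, Cc_push x' bf).
have [kx kx'] := (Cc_kernel x, Cc_kernel x').
set A := I (fun g => f g * kernel x g); set A' := I (fun g => f g * kernel x' g).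
set p := I (kernel x); set p' := I (kernel x').
set e := C * mdist x x' in Jphi.
have e0 : 0 <= e by rewrite mulr_ge0.
have haarB u v : Cc x0 S u -> Cc x0 S v -> I (fun g => v g - u g) = I v - I u.
  move=> cu cv; rewrite -mulN1r addrC -(haar_lin X_proper S_group S_closed _ cu cv).
  by congr haar; apply/funext => g; rewrite mulN1r addrC.
have CcB u v : Cc x0 S u -> Cc x0 S v -> Cc x0 S (fun g => v g - u g).
  move=> cu cv; have := Cc_lin (-1) cu cv; congr Cc.
  by apply/funext => g; rewrite mulN1r addrC.
have pp : `|p - p'| <= e.
  rewrite -haarB//; apply: le_trans Jphi.
  by apply: haar_norm_le => //; exact: CcB.
have AA : `|A - A'| <= M * e.
  rewrite -haarB//; apply: (@le_trans _ _ (M * J phi)); last by rewrite ler_wpM2l.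
  rewrite -(upper_haarZ X_proper S_group S_closed M0 bphi).
  apply: haar_norm_le => //; [exact: CcB|exact: bounded_suppZ|].
  by move=> g Sg; rewrite -mulrBr normrM ler_pM ?fM ?phiP.
have p2 : 2^-1 <= p := kernel_mass x.
have [p0 p'0] : 0 < p /\ 0 < p' by split; exact: I_gt0.
have A'M : `|A' / p'| <= M := pM x'.
rewrite /push -/A -/A' -/p -/p'; clearbody A A' p p'.
rewrite quotient_sub//.
rewrite normrM normfV (gtr0_norm p0) ler_pdivrMr//.
apply: (le_trans (ler_normD _ _)); rewrite normrM (distrC p').
have h1 : `|A' / p'| * `|p - p'| <= M * e by exact: ler_pM.
have h2 : 4 * (M * e) * 2^-1 <= 4 * (M * e) * p by rewrite ler_wpM2l// !mulr_ge0.
have h3 : 0 <= 2 * M * mdist x x' * p by rewrite !mulr_ge0// ltW.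
rewrite mulrDl mulrDl (_ : 4 * M * C * mdist x x' * p = 4 * (M * e) * p); last first.
  by rewrite /e; ring.
move: AA h1 h2 h3; move: (M * e) => t; move: (4 * t * p) => t'.
by move: `|A - A'| (_ * `|p - p'|) (2 * M * _ * p) => a b c; lra.
Qed.

Lemma push_shift f s x : bounded_continuous_on S f -> S s ->
  push (fun g => f (s * g)%g) x = push f (s x).
Proof.
move=> bf Ss; rewrite /push.
have kE : (fun g => kernel (s x) (s * g)%g) = kernel x.
  by apply/funext => g; rewrite kernel_equiv.
have fE : (fun g => f (s * g)%g * kernel (s x) (s * g)%g) =
    (fun g => f (s * g)%g * kernel x g).
  by apply/funext => g; rewrite kernel_equiv.
rewrite -fE -kE (haar_shift X_proper S_group S_closed (Cc_push (s x) bf) Ss).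
by rewrite (haar_shift X_proper S_group S_closed (Cc_kernel (s x)) Ss).
Qed.

End EquivariantMeans.

(** * Transfer to transverse spaces *)

Section BanachMean.
Context {R : realType}.
Implicit Types (v w : R -> R).

(** Riemann sum of mesh [1/(n+1)] for the mean of [v] over the interval from 0 to [n+1]. The
    sampling error is harmless for Lipschitz [v]. *)
Definition riemann_average v (n : nat) : R :=
  (n.+1 * n.+1)%:R^-1 * \sum_(i < n.+1 * n.+1) v (i%:R / n.+1%:R).

Definition banach_mean v : R := ulim (riemann_average v).

Definition bounded_pos v : Prop := exists M, forall t, 0 <= t -> `|v t| <= M.

Let pt_ge0 (i n : nat) : (0 : R) <= i%:R / n.+1%:R.
Proof. by rewrite divr_ge0. Qed.

Lemma riemann_average_le v w (n : nat) (c : R) :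
  (forall t, 0 <= t -> `|v t - w t| <= c) ->
  `|riemann_average v n - riemann_average w n| <= c.
Proof.
move=> vw; rewrite /riemann_average -mulrBr -sumrB normrM.
rewrite normfV (ger0_norm (ler0n _ _)) ler_pdivrMl ?ltr0n//.
apply: (le_trans (ler_norm_sum _ _ _)).
apply: (@le_trans _ _ (\sum_(i < n.+1 * n.+1) c)); last first.
  by rewrite sumr_const card_ord mulr_natl.
by apply: ler_sum => i _; exact: vw.
Qed.

Lemma riemann_average_bounded v : bounded_pos v -> bounded_seq (riemann_average v).
Proof.
move=> [M vM]; exists M => n.
have := @riemann_average_le v (fun=> 0) n M.
rewrite {2}/riemann_average big1// mulr0 subr0; apply=> t t0.
by rewrite subr0 vM.
Qed.

Lemma banach_mean_lin a v w : bounded_pos v -> bounded_pos w ->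
  banach_mean (fun t => a * v t + w t) = a * banach_mean v + banach_mean w.
Proof.
move=> bv bw; rewrite -ulim_lin; try exact: riemann_average_bounded.
congr ulim; apply/funext => n; rewrite /riemann_average.
by rewrite big_split /= -mulr_sumr mulrDr mulrCA.
Qed.

Lemma banach_mean_cst (c : R) : banach_mean (fun=> c) = c.
Proof.
rewrite -[RHS]ulim_cst; congr ulim; apply/funext => n.
by rewrite /riemann_average sumr_const card_ord -(mulr_natl c) mulKf// pnatr_eq0.
Qed.

Lemma banach_mean_ge0 v : bounded_pos v -> (forall t, 0 <= t -> 0 <= v t) ->
  0 <= banach_mean v.
Proof.
move=> bv v0; rewrite -(@ulim_cst R 0); apply: ulim_le.
- exact: bounded_seq_cst.
- exact: riemann_average_bounded.
- apply: (@nat_ultrafilter_ge 0) => n _.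
  by rewrite /= /riemann_average mulr_ge0 ?invr_ge0// sumr_ge0// => i _; exact: v0.
Qed.

Lemma banach_mean_dist_le v w (c : R) : bounded_pos v -> bounded_pos w ->
  (forall t, 0 <= t -> `|v t - w t| <= c) -> `|banach_mean v - banach_mean w| <= c.
Proof.
move=> bv bw vw; apply: ulim_dist_le; try exact: riemann_average_bounded.
by move=> n; exact: riemann_average_le.
Qed.

Lemma sum_shift_le (F : nat -> R) (M : R) (n k : nat) :
  (forall i, `|F i| <= M) ->
  `|\sum_(i < n) F (i + k)%N - \sum_(i < n) F i| <= k%:R * (2 * M).
Proof.
move=> FM; elim: k => [|k IH].
  under eq_bigr do rewrite addn0.
  by rewrite subrr normr0 mul0r.
have E : \sum_(i < n) F (i + k.+1)%N - \sum_(i < n) F (i + k)%N = F (n + k)%N - F k.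
  elim: {IH} n => [|n IHn]; first by rewrite !big_ord0 !subrr.
  by rewrite !big_ord_recr /= addnS addSn; move: IHn; lra.
rewrite -(subrK (\sum_(i < n) F (i + k)%N) (\sum_(i < n) F (i + k.+1)%N)) -addrA E.
have h : `|F (n + k)%N - F k| <= 2 * M.
  by apply: (le_trans (ler_normB _ _)); have := FM k; have := FM (n + k)%N; lra.
apply: (le_trans (ler_normD _ _)); apply: (le_trans (lerD h IH)).
by rewrite -[k.+1%:R]natr1; lra.
Qed.

Lemma banach_mean_shift v (L a : R) : bounded_pos v -> 0 <= a ->
  (forall s t, 0 <= s -> 0 <= t -> `|v s - v t| <= L * `|s - t|) ->
  banach_mean (fun t => v (t + a)) = banach_mean v.
Proof.
move=> bv a0 vL; have [M vM] := bv.
have M0 : 0 <= M by apply: le_trans (vM 0 (lexx _)).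
have bva : bounded_pos (fun t => v (t + a)).
  by exists M => t t0; apply: vM; rewrite addr_ge0.
(* [L] pays for rounding [a] down to [k / (n+1)], and [a * (2 * M)] for shifting by [k <= a * (n+1)]
   a sum of [(n+1)^2] terms. *)
apply: (@ulim_eq _ _ _ (L + a * (2 * M))); try exact: riemann_average_bounded.
move=> n; have n0 : (0 : R) < n.+1%:R by rewrite ltr0n.
pose k := Num.truncn (a * n.+1%:R).
have /andP[ka ak] : k%:R <= a * n.+1%:R < k.+1%:R.
  by apply: truncn_itv; rewrite mulr_ge0.
have L0 : 0 <= L.
  by have := le_trans (normr_ge0 _) (vL 1 0 ler01 (lexx _)); rewrite subr0 normr1 mulr1.
pose F i := v (i%:R / n.+1%:R).
have FM i : `|F i| <= M by exact: vM.
have h1 (i : nat) : `|v (i%:R / n.+1%:R + a) - F (i + k)%N| <= L * n.+1%:R^-1.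
  apply: (le_trans (vL _ _ _ _)) => //; first by rewrite addr_ge0.
  rewrite ler_wpM2l// natrD mulrDl opprD addrACA subrr add0r ger0_norm.
    by rewrite lerBlDr -[X in X + _]mul1r -mulrDl [1 + _]addrC natr1 ler_pdivlMr// ltW.
  by rewrite subr_ge0 ler_pdivrMr.
set m := (n.+1 * n.+1)%N.
have m0 : (0 : R) < m%:R by rewrite ltr0n.
rewrite /riemann_average -/m -mulrBr normrM.
rewrite normfV (ger0_norm (ler0n _ _)) ler_pdivrMl//.
have -> : \sum_(i < m) v (i%:R / n.+1%:R + a) - \sum_(i < m) v (i%:R / n.+1%:R) =
  \sum_(i < m) (v (i%:R / n.+1%:R + a) - F (i + k)%N) +
  (\sum_(i < m) F (i + k)%N - \sum_(i < m) F i).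
  by rewrite sumrB addrA subrK.
apply: (le_trans (ler_normD _ _)).
have h2 := sum_shift_le m k FM.
have h3 : `|\sum_(i < m) (v (i%:R / n.+1%:R + a) - F (i + k)%N)| <= m%:R * (L * n.+1%:R^-1).
  apply: (le_trans (ler_norm_sum _ _ _)).
  apply: (@le_trans _ _ (\sum_(i < m) (L * n.+1%:R^-1))); first exact: ler_sum.
  by rewrite sumr_const card_ord mulr_natl.
apply: (le_trans (lerD h3 h2)).
have -> : m%:R * ((L + a * (2 * M)) * n.+1%:R^-1) =
    m%:R * (L * n.+1%:R^-1) + (a * n.+1%:R) * (2 * M).
  by rewrite /m natrM; field; rewrite addrC natr1 gt_eqF.
by rewrite lerD2l ler_wpM2r// mulr_ge0.
Qed.

End BanachMean.

Section Transfer.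
Context {R : realType}.

Definition lipschitz_bounded (X : metricType R) (L M : R) (u : X -> R) : Prop :=
  [/\ 0 <= L, forall x, `|u x| <= M & forall x y, `|u x - u y| <= L * mdist x y].

Lemma lipschitz_bounded_isom (X : metricType R) (L M : R) u (g : isom X) :
  lipschitz_bounded L M u -> lipschitz_bounded L M (u \o g).
Proof.
move=> [L0 uM uL]; split=> [//|x|x y]; first exact: uM.
by rewrite -(isom_mdist g); exact: uL.
Qed.

Lemma add3_le (a b c p : R) : a <= p -> b <= p -> a + c + b <= c + 2 * p.
Proof. lra. Qed.

Section OneStep.
Variables (X : hadamard R) (xi : boundary X).
Implicit Types (u : X -> R) (r : ray_to xi) (f : transverse xi).

Definition ray_mean u r : R := banach_mean (fun t => u (sval r t)).

Lemma ray_mean_bounded L M u r : lipschitz_bounded L M u ->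
  bounded_pos (fun t => u (sval r t)).
Proof. by move=> [_ uM _]; exists M => t _. Qed.

Lemma ray_mean_norm L M u r : lipschitz_bounded L M u -> `|ray_mean u r| <= M.
Proof.
move=> uLM; have [_ uM _] := uLM.
rewrite -[ray_mean u r]subr0 -(banach_mean_cst 0).
apply: banach_mean_dist_le; first exact: ray_mean_bounded uLM.
  by exists 0 => t _; rewrite normr0.
by move=> t _; rewrite subr0.
Qed.

(** Shifting [r] by [t] and [r'] by [t'] changes neither mean and brings the origins nearly to
    distance [ray_dist r r']. By [asymptotic_mono] the shifted rays are never further apart than
    their origins. *)
Lemma ray_mean_dist L M u r r' : lipschitz_bounded L M u ->
  `|ray_mean u r - ray_mean u r'| <= L * ray_dist r r'.
Proof.
move=> uLM; have [L0 uM uL] := uLM.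
have shift (q : ray_to xi) a : 0 <= a ->
    banach_mean (fun t => u (sval q (t + a))) = ray_mean u q.
  move=> a0; apply: (@banach_mean_shift _ (fun t => u (sval q t)) L) => //.
    exact: ray_mean_bounded uLM.
  by move=> s t s0 t0; rewrite -(rayP (sval q))//; exact: uL.
apply/ler_addgt0Pr => e e0.
have L10 : 0 < L + 1 by rewrite ltr_wpDl.
have [t [t' [t0 t'0 tt']]] := tdist_near (sval r) (sval r') (divr_gt0 e0 L10).
rewrite -(shift r t)// -(shift r' t')//.
apply: (@le_trans _ _ (L * (ray_dist r r' + e / (L + 1)))); last first.
  rewrite mulrDr lerD2l mulrCA ger_pMr// ler_pdivrMr// mul1r.
  by rewrite lerDl.
apply: banach_mean_dist_le; try by exists M.
move=> a a0; apply: (le_trans (uL _ _)); apply: ler_wpM2l => //.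
rewrite ![a + _]addrC; apply/(le_trans _ (ltW tt')).
exact: (asymptotic_mono (hadamard_CAT0 X) (ray_to_asymptotic r r')).
Qed.

Lemma ray_approx f (n : nat) :
  exists r : ray_to xi, mdist f (to_completion r) <= n.+1%:R^-1.
Proof. by apply: to_completion_dense; rewrite invr_gt0 ltr0n. Qed.

Definition approx f (n : nat) : ray_to xi := projT1 (cid (ray_approx f n)).

Lemma approxP f n : mdist f (to_completion (approx f n)) <= n.+1%:R^-1.
Proof. exact: projT2 (cid (ray_approx f n)). Qed.

(** Extension from rays to their completion. An ultralimit along chosen approximations is linear at
    once; the Lipschitz bound on [ray_mean] makes the choice immaterial. *)
Definition transfer1 u f : R := ulim (fun n => ray_mean u (approx f n)).

Lemma transfer1_bounded L M u f : lipschitz_bounded L M u ->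
  bounded_seq (fun n => ray_mean u (approx f n)).
Proof. by move=> uLM; exists M => n; exact: ray_mean_norm uLM. Qed.

Lemma ray_distE r r' :
  ray_dist r r' = mdist (to_completion r : transverse xi) (to_completion r').
Proof. exact/esym/to_completion_isometry. Qed.

Lemma transfer1_lin L M L' M' u u' a : lipschitz_bounded L M u ->
  lipschitz_bounded L' M' u' ->
  transfer1 (fun x => a * u x + u' x) = (fun f => a * transfer1 u f + transfer1 u' f).
Proof.
move=> uLM uLM'; apply/funext => f.
rewrite -(ulim_lin _ (transfer1_bounded f uLM) (transfer1_bounded f uLM')).
congr ulim; apply/funext => n.
exact: banach_mean_lin (ray_mean_bounded _ uLM) (ray_mean_bounded _ uLM').
Qed.

Lemma transfer1_ge0 L M u f : lipschitz_bounded L M u -> (forall x, 0 <= u x) ->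
  0 <= transfer1 u f.
Proof.
move=> uLM u0; rewrite -(@ulim_cst R 0); apply: ulim_le.
- exact: bounded_seq_cst.
- exact: transfer1_bounded uLM.
- apply: (@nat_ultrafilter_ge 0) => n _; apply: banach_mean_ge0 => //.
  exact: ray_mean_bounded uLM.
Qed.

Lemma transfer1_cst c : transfer1 (fun=> c) = fun=> c.
Proof.
apply/funext => f; rewrite -[RHS](@ulim_cst R); congr ulim.
by apply/funext => n; rewrite /ray_mean banach_mean_cst.
Qed.

Lemma transfer1_lipschitz L M u : lipschitz_bounded L M u ->
  lipschitz_bounded L M (transfer1 u).
Proof.
move=> uLM; have [L0 uM _] := uLM; split=> // [f|f f'].
  rewrite -[transfer1 u f]subr0 -(@ulim_cst R 0); apply: ulim_dist_le.
  - exact: transfer1_bounded uLM.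
  - exact: bounded_seq_cst.
  - by move=> n; rewrite subr0; exact: ray_mean_norm uLM.
apply: (@ulim_dist_le_small _ _ _ _ (L * 2)); try exact: transfer1_bounded uLM.
move=> n; apply: (le_trans (ray_mean_dist _ _ uLM)); rewrite -mulrA -mulrDr.
apply: ler_wpM2l => //; rewrite ray_distE; apply: (le_trans (mdist_quad _ _ f f')).
rewrite (metric_sym _ f); apply: add3_le; exact: approxP.
Qed.

(** The image of the approximation of [f] and the approximation of the image of [f] are both within
    [1/(n+1)] of the image of [f]. *)
Lemma transfer1_equiv L M u (g : isom X) (gxi : map_boundary g xi = xi) :
  lipschitz_bounded L M u ->
  transfer1 (u \o g) = transfer1 u \o transverse_isom gxi.
Proof.
move=> uLM; have [L0 _ _] := uLM; apply/funext => f /=.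
apply: (@ulim_eq _ _ _ (L * 2)).
- exact: transfer1_bounded (lipschitz_bounded_isom g uLM).
- exact: transfer1_bounded uLM.
move=> n; have -> : ray_mean (u \o g) (approx f n) =
  ray_mean u (map_ray_to gxi (approx f n)) by [].
apply: (le_trans (ray_mean_dist _ _ uLM)); rewrite -mulrA ler_wpM2l//.
rewrite ray_distE -transverse_isomE.
have := metric_triangle (transverse_isom gxi (to_completion (approx f n)))
  (transverse_isom gxi f) (to_completion (approx (transverse_isom gxi f) n)).
rewrite isom_mdist (metric_sym (to_completion _) f).
have := approxP f n; have := approxP (transverse_isom gxi f) n.
by move=> h1 h2 h3; apply: (le_trans h3); rewrite mulrDl mul1r lerD.
Qed.

End OneStep.

Fixpoint transfer (X Y : hadamard R) (s : refining X Y) : (X -> R) -> Y -> R :=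
  match s in refining _ Y return (X -> R) -> Y -> R with
  | refining_nil => id
  | refining_rcons Y s xi => fun u => transfer1 (xi := xi) (transfer s u)
  end.

Section Refining.
Variables (X : hadamard R).
Implicit Types (u : X -> R).

Lemma transfer_lipschitz Y (s : refining X Y) L M u :
  lipschitz_bounded L M u -> lipschitz_bounded L M (transfer s u).
Proof. by elim: s => //= Z s IH xi uLM; exact/transfer1_lipschitz/IH. Qed.

Lemma transfer_lin Y (s : refining X Y) L M L' M' u u' a :
  lipschitz_bounded L M u -> lipschitz_bounded L' M' u' ->
  transfer s (fun x => a * u x + u' x) =
  (fun y => a * transfer s u y + transfer s u' y).
Proof.
move=> uLM uLM'; elim: s => //= Z s IH xi; rewrite IH.
exact: transfer1_lin (transfer_lipschitz s uLM) (transfer_lipschitz s uLM').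
Qed.

Lemma transfer_ge0 Y (s : refining X Y) L M u : lipschitz_bounded L M u ->
  (forall x, 0 <= u x) -> forall y, 0 <= transfer s u y.
Proof.
move=> uLM u0; elim: s => //= Z s IH xi y.
exact: transfer1_ge0 (transfer_lipschitz s uLM) IH.
Qed.

Lemma transfer_cst Y (s : refining X Y) c : transfer s (fun=> c) = fun=> c.
Proof. by elim: s => //= Z s -> xi; rewrite transfer1_cst. Qed.

Lemma transfer_equiv Y (s : refining X Y) L M u (g : isom X) (h : isom Y) :
  lipschitz_bounded L M u -> iterated_action s g h ->
  transfer s (u \o g) = transfer s u \o h.
Proof.
move=> uLM; elim: s h => [h -> //|Z s IH xi h /= [h' [h'xi [gh' ->]]]].
by rewrite (IH _ gh') (transfer1_equiv _ (transfer_lipschitz s uLM)).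
Qed.

End Refining.
End Transfer.

(** * Invariant means on Euclidean spaces *)

Section SubsetSpace.
Context {R : realType} {X : metricType R}.

(** The flat as a metric space of its own, to which the isometries of the ambient space that
    preserve it restrict directly. *)
Definition subset_space (F : set X) : Type := {x : X | F x}.

Variable F : set X.

HB.instance Definition _ := gen_eqMixin (subset_space F).
HB.instance Definition _ := gen_choiceMixin (subset_space F).

Definition subset_dist (x y : subset_space F) : R := mdist (sval x) (sval y).

Lemma subset_distxx x : subset_dist x x = 0. Proof. exact: mdistxx. Qed.

Lemma subset_dist_eq0 x y : subset_dist x y = 0 -> x = y.
Proof. by case: x y => [x Fx] [y Fy] /mdist_positivity/= xy; exact: eq_exist. Qed.

Lemma subset_dist_sym x y : subset_dist x y = subset_dist y x.
Proof. exact: metric_sym. Qed.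

Lemma subset_dist_triangle y x z :
  subset_dist x z <= subset_dist x y + subset_dist y z.
Proof. exact: metric_triangle. Qed.

HB.instance Definition _ := isMetric.Build R (subset_space F) subset_distxx
  subset_dist_eq0 subset_dist_sym subset_dist_triangle.

Lemma subset_mdistE (x y : subset_space F) : mdist x y = mdist (sval x) (sval y).
Proof. by []. Qed.

Lemma proper_subset_closed : proper_space (subset_space F) -> closed F.
Proof.
move=> /proper_complete/complete_spaceP comp x clx.
have /choice[y yP] (n : nat) : exists y : subset_space F,
    mdist x (sval y) < n.+1%:R^-1.
  have n0 : (0 : R) < n.+1%:R^-1 by rewrite invr_gt0 ltr0n.
  by have [y [Fy xy]] := clx _ (nbhs_mdist x n0); exists (exist _ y Fy).
have [|l lP] := comp y.
  move=> e e0; have e20 : 0 < e / 2 by rewrite divr_gt0.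
  have [N NP] := natS_inv_small e20.
  exists N => m n /NP Nm /NP Nn; rewrite subset_mdistE.
  have := metric_triangle (sval (y m)) x (sval (y n)).
  rewrite (metric_sym _ x) => h; apply: (le_lt_trans h).
  by rewrite [ltRHS]splitr ltrD// (lt_trans (yP _)).
suff -> : x = sval l by exact: svalP.
apply: mdist_positivity; apply/eqP; rewrite eq_le mdist_ge0 andbT.
apply/ler_addgt0Pr => e e0; rewrite add0r.
have e20 : 0 < e / 2 by rewrite divr_gt0.
have [N NP] := natS_inv_small e20; have [N' N'P] := lP _ e20.
have h1 := NP (maxn N N') (leq_maxl _ _).
have := N'P (maxn N N') (leq_maxr _ _); rewrite subset_mdistE => h2.
apply: (le_trans (metric_triangle x (sval (y (maxn N N'))) (sval l))).
by rewrite ltW// [ltRHS]splitr ltrD// (lt_trans (yP _)).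
Qed.

End SubsetSpace.

Section EuclideanSpaces.
Context {R : realType} {X : metricType R}.
Variables (n : nat) (phi : 'rV[R]_n -> X).
Hypothesis phi_mdist : forall u v, mdist (phi u) (phi v) = Defs.edist u v.
Hypothesis phi_surj : forall x, exists v, phi v = x.

Let psi x : 'rV[R]_n := projT1 (cid (phi_surj x)).

Let psiK x : phi (psi x) = x. Proof. exact: projT2 (cid (phi_surj x)). Qed.

Let phiK_mdist x y : mdist x y = Defs.edist (psi x) (psi y).
Proof. by rewrite -phi_mdist !psiK. Qed.

Lemma coord_le_edist (u v : 'rV[R]_n) i : `|u ord0 i - v ord0 i| <= Defs.edist u v.
Proof.
apply: ler_sqr_le; first exact: Defs.edist_ge0.
rewrite Defs.edist_sqr real_normK ?num_real// (bigD1 i)//= lerDl.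
by rewrite sumr_ge0// => j _; exact: sqr_ge0.
Qed.

Lemma edist_coord_lt (u v : 'rV[R]_n) e : 0 < e ->
  (forall i, `|u ord0 i - v ord0 i| < e / n.+1%:R) -> Defs.edist u v < e.
Proof.
move=> e0 uv; rewrite -(@ltr_pXn2r _ 2) ?nnegrE ?Defs.edist_ge0 ?(ltW e0)//.
rewrite Defs.edist_sqr; pose d := e / n.+1%:R.
have n0 : (0 : R) < n.+1%:R by rewrite ltr0n.
have d0 : 0 < d by rewrite divr_gt0.
apply: (@le_lt_trans _ _ (\sum_(i < n) d ^+ 2)).
  apply: ler_sum => i _; rewrite -[leLHS]real_normK ?num_real//.
  by rewrite ler_sqr ?nnegrE ?(ltW d0)// ltW.
rewrite sumr_const card_ord -(mulr_natl (d ^+ 2)).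
have -> : e ^+ 2 = n.+1%:R ^+ 2 * d ^+ 2.
  by rewrite -exprMn /d mulrC divfK// gt_eqF.
rewrite ltr_pM2r ?exprn_gt0// -natrX ltr_nat.
by rewrite (leq_trans (ltnSn n))// expnS expn1 leq_pmulr.
Qed.

Lemma euclidean_proper : proper_space X.
Proof.
move=> x e; rewrite compact_ultra => F FU Fe.
have Fi i : exists l : R^o, forall d : R, 0 < d ->
    F [set y | mdist (psi y ord0 i : R^o) l < d].
  apply: (@ultra_proper_cvg R R^o _ F (fun y => psi y ord0 i : R^o) (psi x ord0 i) e).
    exact: proper_regular.
  apply: filterS Fe => y /=; apply: le_trans; rewrite phiK_mdist /mdist /= distrC.
  exact: coord_le_edist.
have /choice[l lP] := Fi; pose w : 'rV[R]_n := \row_i l i.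
have Fw d : 0 < d -> F [set y | mdist y (phi w) < d].
  move=> d0; have n0 : (0 : R) < n.+1%:R by rewrite ltr0n.
  have Fs : F [set y | forall i, i \in enum 'I_n ->
      mdist (psi y ord0 i : R^o) (l i) < d / n.+1%:R].
    apply: (filter_seq (P := fun i => [set y |
      mdist (psi y ord0 i : R^o) (l i) < d / n.+1%:R])) => i _.
    by apply: lP; rewrite divr_gt0.
  apply: filterS Fs => y yl /=; rewrite -{1}(psiK y) phi_mdist.
  apply: edist_coord_lt => // i; have := yl i; rewrite mem_enum => /(_ isT).
  by rewrite /mdist /= distrC mxE.
exists (phi w); split=> /=.
  apply/ler_addgt0Pr => d d0.
  have [y [/= xy yw]] := filter_ex (filterI Fe (Fw d d0)).
  by have := metric_triangle x y (phi w); lra.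
move=> V /nbhs_mdistP[d d0 dV]; change (F V); apply: filterS (Fw d d0) => y /= yw.
by apply: dV; rewrite metric_sym.
Qed.

Lemma edistZ (a : R) (u v : 'rV[R]_n) : Defs.edist (a *: u) (a *: v) = `|a| * Defs.edist u v.
Proof.
apply/eqP; rewrite -(eqrXn2 (n := 2)) ?mulr_ge0 ?Defs.edist_ge0//.
rewrite exprMn !Defs.edist_sqr real_normK ?num_real// mulr_sumr; apply/eqP.
by apply: eq_bigr => i _; rewrite !mxE; ring.
Qed.

(** A homothety of ratio [T] carries a net of the ball of radius [r] to one of the ball of radius
    [T * r], so the number of points does not depend on [T]. *)
Lemma euclidean_net (r e : R) : 0 < e -> exists N : nat, forall T : R, 0 < T ->
  exists2 l : seq X, size l = N & forall x, mdist (phi 0) x <= T * r ->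
    exists2 y, y \in l & mdist y x <= T * e.
Proof.
move=> e0; have [l lP] := proper_net (phi 0) r euclidean_proper e0.
exists (size l) => T T0; exists [seq phi (T *: psi y) | y <- l].
  by rewrite size_map.
have TE (u v : 'rV[R]_n) : Defs.edist (T *: u) v = T * Defs.edist u (T^-1 *: v).
  have := edistZ T u (T^-1 *: v).
  by rewrite (gtr0_norm T0) scalerA divff ?gt_eqF// scale1r.
move=> x; rewrite phiK_mdist => h.
have [|y yl yx] := lP (phi (T^-1 *: psi x)).
  rewrite phi_mdist -(ler_pM2l T0) -TE scaler0.
  by move: h; rewrite -phiK_mdist -{1}(psiK x) phi_mdist.
exists (phi (T *: psi y)); first by apply/mapP; exists y.
by rewrite -{1}(psiK x) phi_mdist TE ler_pM2l// -phi_mdist psiK.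
Qed.

End EuclideanSpaces.

(** * Averages over large balls of the isometry group of a doubling space *)

Section InvariantMean.
Context {R : realType} {X : metricType R} (x0 : X).
Hypothesis X_proper : proper_space X.
Hypothesis X_doubling : exists N : nat, forall T : R, 0 < T ->
  exists2 l : seq X, size l = N & forall x, mdist x0 x <= T * 2 ->
    exists2 y, y \in l & mdist y x <= T * (2^-1 / 2).
Implicit Types (u : X -> R) (g k : isom X) (T L M : R).

Let G : set (isom X) := setT.
Let G_group : is_subgroup G. Proof. by []. Qed.
Let G_closed : closed G. Proof. exact: closedT. Qed.

Local Notation J := (upper_haar x0 G).
Local Notation I := (haar x0 G).

(** With indicators of balls the Folner property would require control of thin annuli. A tent varies
    by a bounded amount under translation while its height grows with [T], so doubling suffices. *)
Definition tent T g : R := Num.max (T - mdist (g x0) x0) 0.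

Let tent_ge0 T g : 0 <= tent T g. Proof. by rewrite /tent le_max lexx orbT. Qed.

Lemma Cc_tent T : Cc x0 G (tent T).
Proof.
split.
  exists T, `|T| => g _; rewrite ger0_norm//; split.
    rewrite /tent ge_max normr_ge0 andbT; have := mdist_ge0 (g x0) x0.
    by have := ler_norm T; lra.
  move=> h; rewrite leNgt; apply/negP => h'; move: h.
  by rewrite /tent max_r ?eqxx// subr_le0 ltW.
have := unif_cont_max (unif_cont_lin (-1) (unif_cont_mdist x0 G x0 x0)
  (unif_cont_cst x0 G T)) (unif_cont_cst x0 G 0).
by congr unif_cont; apply/funext => g; rewrite mulN1r addrC.
Qed.

Lemma tent_mass T : 0 < T -> T / 2 * J (hits x0 x0 (T * 2^-1)) <= I (tent T).
Proof.
move=> T0; have [bt ut] := Cc_tent T; have T20 : 0 <= T / 2 by rewrite divr_ge0// ltW.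
rewrite (haar_pos X_proper G_group G_closed (Cc_tent T) (fun g _ => tent_ge0 T g)).
rewrite -(upper_haarZ X_proper G_group G_closed T20 (bounded_supp_hits _ _ _ _ _)).
apply: upper_haar_mono => // [|g _]; first exact/bounded_suppZ/bounded_supp_hits.
rewrite /hits; have [h|_] := leP (mdist (g x0) x0) (T * 2^-1); last by rewrite mulr0.
by rewrite mulr1 /tent le_max; apply/orP; left; lra.
Qed.

Let hits_gt0 T : 0 < T -> 0 < J (hits x0 x0 T).
Proof. exact: upper_haar_hits_gt0. Qed.

Let tent_gt0 T : 0 < T -> 0 < I (tent T).
Proof.
move=> T0; have T20 : 0 < T / 2 by rewrite divr_gt0.
by apply: lt_le_trans (tent_mass T0); rewrite mulr_gt0// hits_gt0.
Qed.

Lemma orbit_fun_continuous L M u : lipschitz_bounded L M u ->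
  {within G, continuous (fun g => u (g x0))}.
Proof.
move=> [L0 _ uL]; apply/subspace_continuousP => g _.
apply/cvgrPdist_lt => e e0; have L10 : 0 < L + 1 by rewrite ltr_wpDl.
change (nbhs g [set h : isom X | G h -> `|u (g x0) - u (h x0)| < e]).
apply: filterS (nbhs_isom_eval g x0 (divr_gt0 e0 L10)) => h hg _.
move: hg; rewrite /= ltr_pdivlMr// => h1; apply: le_lt_trans (uL _ _) _; apply: le_lt_trans h1.
by rewrite mulrC ler_wpM2l ?mdist_ge0// lerDl.
Qed.

Lemma Cc_orbit_fun L M u psi : lipschitz_bounded L M u -> Cc x0 G psi ->
  Cc x0 G (fun g => u (g x0) * psi g).
Proof.
move=> uLM cpsi; have [_ uM _] := uLM.
exact: (CcM X_proper G_group G_closed (orbit_fun_continuous uLM) (fun g _ => uM (g x0)) cpsi).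
Qed.

Definition ball_average u T : R := I (fun g => u (g x0) * tent T g) / I (tent T).

Lemma ball_average_le L M u T : 0 < T -> lipschitz_bounded L M u ->
  `|ball_average u T| <= M.
Proof.
move=> T0 uLM; have [_ uM _] := uLM; have M0 : 0 <= M by apply: le_trans (uM x0).
rewrite normrM normfV (gtr0_norm (tent_gt0 T0)) ler_pdivrMr ?tent_gt0//.
rewrite (haar_pos X_proper G_group G_closed (Cc_tent T) (fun g _ => tent_ge0 T g)).
have [bt ut] := Cc_tent T; rewrite -(upper_haarZ X_proper G_group G_closed M0 bt).
apply: haar_norm_le => //.
- exact: Cc_orbit_fun uLM (Cc_tent T).
- exact: bounded_suppZ.
- by move=> g _; rewrite normrM (ger0_norm (tent_ge0 T g)) ler_wpM2r.
Qed.

Let haarB f f' : Cc x0 G f -> Cc x0 G f' -> I (fun g => f g - f' g) = I f - I f'.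
Proof.
move=> cf cf'; rewrite -mulN1r addrC -(haar_lin X_proper G_group G_closed _ cf' cf).
by congr haar; apply/funext => g; rewrite mulN1r addrC.
Qed.

Let CcB f f' : Cc x0 G f -> Cc x0 G f' -> Cc x0 G (fun g => f g - f' g).
Proof.
move=> cf cf'; have := Cc_lin (-1) cf' cf; congr Cc.
by apply/funext => g; rewrite mulN1r addrC.
Qed.

(** Left invariance moves [k] from [u] to the tent. The two tents differ by at most [D] and, for
    [D < T], only where [g] moves [x0] by at most [2 * T]. Doubling compares the measure of that set
    with the one for [T / 2], where the tent is at least [T / 2]. *)
Lemma ball_average_shift L M u k : lipschitz_bounded L M u ->
  exists c, forall T, 0 < T -> `|ball_average (u \o k) T - ball_average u T| <= c * T^-1.
Proof.
move=> uLM; have [_ uM _] := uLM; have M0 : 0 <= M by apply: le_trans (uM x0).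
have [N NP] := X_doubling; pose D := mdist (k x0) x0.
have D0 : 0 <= D := mdist_ge0 _ _.
have ukLM := lipschitz_bounded_isom k uLM.
(* The first term serves for [T <= D], where [2 * M] bounds the difference, and the second for
   [T > D]. *)
exists (2 * M * D + 2 * M * D * N%:R) => T T0.
have Ti0 : 0 < T^-1 by rewrite invr_gt0.
have [TD|DT] := leP T D.
  apply: (le_trans (ler_normB _ _)).
  apply: (le_trans (lerD (ball_average_le T0 ukLM) (ball_average_le T0 uLM))).
  rewrite mulrDl; apply: (@le_trans _ _ (2 * M * D * T^-1)); last first.
    by rewrite lerDl !mulr_ge0// ltW.
  have -> : M + M = 2 * M * 1 by ring.
  rewrite -[leRHS]mulrA ler_wpM2l ?mulr_ge0//.
  by rewrite ler_pdivlMr// mul1r.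
have [l lN lP] := NP T T0.
have V2 : J (hits x0 x0 (T * 2)) <= N%:R * J (hits x0 x0 (T * 2^-1)).
  rewrite -lN; apply: upper_haar_hits_net => // x /lP[y yl yx].
  by exists y => //; rewrite -mulrA.
have ct := Cc_tent T.
have cku := Cc_orbit_fun ukLM ct; have cu := Cc_orbit_fun uLM ct.
pose tent' g := tent T (k^-1 * g)%g.
have ct' : Cc x0 G (fun g => u (g x0) * tent' g).
  have [bt ut] := ct; apply: (Cc_orbit_fun uLM); split.
    exact: (bounded_supp_shift G_group (s := k^-1%g)).
  move=> e e0; have [d d0 dP] := ut e e0; exists d => // g h _ _ gh.
  by apply: dP => //; apply/isom_near_mull.
have h1 : I (fun g => (u \o k) (g x0) * tent T g) = I (fun g => u (g x0) * tent' g).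
  rewrite -(haar_shift X_proper G_group G_closed (s := k) ct')//; congr haar; apply/funext => g.
  by rewrite /tent' mulKg.
rewrite /ball_average h1 -mulrBl -haarB// normrM normfV (gtr0_norm (tent_gt0 T0)).
rewrite ler_pdivrMr ?tent_gt0//.
have MD0 : 0 <= M * D by exact: mulr_ge0.
apply: (@le_trans _ _ (M * D * J (hits x0 x0 (T * 2)))).
  rewrite -(upper_haarZ X_proper G_group G_closed MD0 (bounded_supp_hits _ _ _ _ _)).
  apply: haar_norm_le => //; first exact: CcB.
    exact/bounded_suppZ/bounded_supp_hits.
  move=> g _; rewrite -mulrBr normrM -mulrA ler_pM//.
  have gk : `|mdist ((k^-1 * g)%g x0) x0 - mdist (g x0) x0| <= D.
    rewrite -(isom_mdist k) /= isom_inv_funK.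
    have := metric_triangle (g x0) (k x0) x0; have := metric_triangle (g x0) x0 (k x0).
    rewrite (metric_sym x0 (k x0)) -/D => h2 h3.
    by rewrite ler_norml; apply/andP; split; lra.
  rewrite /hits; have [h|h] := leP (mdist (g x0) x0) (T * 2).
    rewrite mulr1; apply: max_lipschitz; last by rewrite subrr normr0.
    by move: gk; rewrite !ler_norml; lra.
  rewrite /tent' /tent !max_r ?subrr ?normr0 ?mulr0//; first by lra.
  by move: gk; rewrite ler_norml; lra.
apply: (le_trans (ler_wpM2l MD0 V2)).
have h2 := tent_mass T0; set V := J (hits x0 x0 _) in h2 *.
have V0 : 0 <= V by rewrite ltW// hits_gt0// mulr_gt0// invr_gt0.
have c0 : 0 <= (2 * M * D + 2 * M * D * N%:R) * T^-1.
  by rewrite mulr_ge0 ?(ltW Ti0)// addr_ge0// !mulr_ge0.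
apply: le_trans (ler_wpM2l c0 h2).
have -> : (2 * M * D + 2 * M * D * N%:R) * T^-1 * (T / 2 * V) =
    M * D * V + M * D * (N%:R * V) by field; rewrite gt_eqF.
by rewrite lerDr mulr_ge0.
Qed.

Definition isom_mean u : R := ulim (fun n => ball_average u n.+1%:R).

Let T0 (n : nat) : (0 : R) < n.+1%:R. Proof. by rewrite ltr0n. Qed.

Lemma ball_average_bounded L M u : lipschitz_bounded L M u ->
  bounded_seq (fun n => ball_average u n.+1%:R).
Proof. by move=> uLM; exists M => n; exact: ball_average_le (T0 n) uLM. Qed.

Lemma isom_mean_lin L M L' M' u u' a : lipschitz_bounded L M u ->
  lipschitz_bounded L' M' u' ->
  isom_mean (fun x => a * u x + u' x) = a * isom_mean u + isom_mean u'.
Proof.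
move=> uLM uLM'.
rewrite -(ulim_lin _ (ball_average_bounded uLM) (ball_average_bounded uLM')).
congr ulim; apply/funext => n; rewrite /ball_average mulrA -mulrDl; congr (_ / _).
rewrite -(haar_lin X_proper G_group G_closed a (Cc_orbit_fun uLM (Cc_tent _))
  (Cc_orbit_fun uLM' (Cc_tent _))).
by congr haar; apply/funext => g; ring.
Qed.

Lemma isom_mean_ge0 L M u : lipschitz_bounded L M u -> (forall x, 0 <= u x) ->
  0 <= isom_mean u.
Proof.
move=> uLM u0; rewrite -(@ulim_cst R 0); apply: ulim_le.
- exact: bounded_seq_cst.
- exact: ball_average_bounded uLM.
- apply: (@nat_ultrafilter_ge 0) => n _ /=.
  rewrite /ball_average divr_ge0 ?(ltW (tent_gt0 (T0 n)))//.
  have co := Cc_orbit_fun uLM (Cc_tent n.+1%:R).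
  rewrite haar_pos//; first by apply: upper_haar_ge0 => //; case: co.
  by move=> g _; rewrite mulr_ge0.
Qed.

Lemma isom_mean1 : isom_mean (fun=> 1) = 1.
Proof.
rewrite -[RHS](@ulim_cst R); congr ulim; apply/funext => n.
rewrite /ball_average (_ : (fun g => _) = tent n.+1%:R) ?divff ?gt_eqF ?tent_gt0//.
by apply/funext => g; rewrite mul1r.
Qed.

Lemma isom_mean_invariant L M u k : lipschitz_bounded L M u ->
  isom_mean (u \o k) = isom_mean u.
Proof.
move=> uLM; have [c cP] := ball_average_shift k uLM.
apply: (@ulim_eq _ _ _ c) => [||n]; last exact: cP.
- exact: ball_average_bounded (lipschitz_bounded_isom k uLM).
- exact: ball_average_bounded uLM.
Qed.

End InvariantMean.

(** * Stabilisers of refined flats *)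

Section IteratedAction.
Context {R : realType}.

Lemma map_boundary1 (X : metricType R) (xi : boundary X) : map_boundary 1%g xi = xi.
Proof. by rewrite /map_boundary map_ray1 reprK. Qed.

Lemma map_boundaryM (X : metricType R) (g h : isom X) (xi : boundary X) :
  map_boundary g xi = xi -> map_boundary h xi = xi -> map_boundary (g * h)%g xi = xi.
Proof.
move=> gxi hxi.
by rewrite {1}/map_boundary map_rayM -map_boundary_pi -/(map_boundary h xi) hxi.
Qed.

(** Rays are dense in the transverse space. The group laws for iterated actions can thus be checked
    on rays. *)
Lemma transverse_isom_unique (X : hadamard R) (xi : boundary X) (g : isom X)
    (gxi : map_boundary g xi = xi) (k : isom (transverse xi)) :
  (forall r, k (to_completion r) = to_completion (map_ray_to gxi r)) ->
  k = transverse_isom gxi.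
Proof.
move=> kr; apply: isom_ext => f; apply: mdist_positivity; apply/eqP.
rewrite eq_le mdist_ge0 andbT; apply/ler_addgt0Pr => e e0; rewrite add0r.
have e20 : 0 < e / 2 by rewrite divr_gt0.
have [r fr] := to_completion_dense f e20.
apply: (le_trans (metric_triangle _ (k (to_completion r)) _)).
rewrite {2}kr -transverse_isomE !isom_mdist [leRHS]splitr lerD//.
by rewrite metric_sym.
Qed.

Section Sequence.
Variable X : hadamard R.

Lemma iterated_action1 Y (s : refining X Y) : iterated_action s 1%g 1%g.
Proof.
elim: s => [//|Z s IH xi /=]; exists 1%g, (map_boundary1 xi); split=> //.
apply: transverse_isom_unique => r /=; congr to_completion.
by case: r => r rxi; apply: eq_exist; rewrite /= map_ray1.
Qed.

Lemma iterated_actionM Y (s : refining X Y) g g' h h' :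
  iterated_action s g h -> iterated_action s g' h' ->
  iterated_action s (g * g')%g (h * h')%g.
Proof.
elim: s h h' => [h h' -> ->//|Z s IH xi h h' /=].
move=> [k [kxi [gk ->]]] [k' [k'xi [gk' ->]]].
exists (k * k')%g, (map_boundaryM kxi k'xi); split; first exact: IH.
apply: transverse_isom_unique => r.
transitivity (transverse_isom kxi (transverse_isom k'xi (to_completion r))) => //.
rewrite !transverse_isomE; congr to_completion.
by apply: eq_exist; rewrite /= map_rayM.
Qed.

Lemma iterated_actionV Y (s : refining X Y) g h :
  iterated_action s g h -> iterated_action s g^-1%g h^-1%g.
Proof.
elim: s h => [h ->//|Z s IH xi h /= [k [kxi [gk ->]]]].
exists k^-1%g, (map_boundaryV kxi); split; first exact: IH.
apply: transverse_isom_unique => r.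
apply: (@isom_inj _ _ (transverse_isom kxi)).
by rewrite transverse_isomE map_ray_toVK [LHS]isom_inv_funK.
Qed.

(** Continuity at the identity. The transverse distance from a ray to its image is at most the
    displacement of the origin, so controlling one point of [Z] is enough for each ray. *)
Lemma iterated_action_continuous Y (s : refining X Y) (y : Y) (e : R) : 0 < e ->
  exists l : seq X, exists2 d : R, 0 < d & forall g h, iterated_action s g h ->
    (forall x, x \in l -> mdist (g x) x < d) -> mdist (h y) y < e.
Proof.
elim: s y e => [y e e0|Z s IH xi f e e0].
  by exists [:: y], e => // g _ -> gy; apply: gy; rewrite mem_head.
have e40 : 0 < e / 4 by rewrite divr_gt0.
have [r fr] := to_completion_dense f e40.
have e20 : 0 < e / 2 by rewrite divr_gt0.
have [l [d d0 lP]] := IH (sval r 0) _ e20.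
exists l, d => // g _ [h' [h'xi [gh' ->]]] gl; have h1 := lP _ _ gh' gl.
apply: (le_lt_trans (mdist_quad _ _ (transverse_isom h'xi (to_completion r))
  (to_completion r))).
rewrite isom_mdist transverse_isomE to_completion_isometry.
have h2 : ray_pseudometric xi (map_ray_to h'xi r) r < e / 2.
  by apply: le_lt_trans h1; exact: (tdist_le (map_ray h' (sval r))).
rewrite [ltRHS](_ : e = e / 4 + e / 2 + e / 4); last by field.
by apply: ltr_leD; [exact: ler_ltD|rewrite metric_sym].
Qed.

(** Continuity at the identity, applied to [g'^-1 * g]. *)
Lemma iterated_action_near Y (s : refining X Y) (y : Y) (e : R) : 0 < e ->
  exists l : seq X, exists2 d : R, 0 < d & forall (g g' : isom X) (h h' : isom Y),
    iterated_action s g h -> iterated_action s g' h' ->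
    (forall x, x \in l -> mdist (g x) (g' x) < d) -> mdist (h y) (h' y) < e.
Proof.
move=> e0; have [l [d d0 lP]] := iterated_action_continuous s y e0.
exists l, d => // g g' h h' gh gh' gg'.
rewrite -(isom_inv_mdist h') isom_funK.
apply: (lP _ _ (iterated_actionM (iterated_actionV gh') gh)) => x xl.
by rewrite -(isom_mdist g') /= isom_inv_funK; exact: gg'.
Qed.

Lemma iterated_action_closed Y (s : refining X Y) (g : isom X) :
  (forall (l : seq X) d, 0 < d -> exists (g' : isom X) h', iterated_action s g' h' /\
    forall x, x \in l -> mdist (g' x) (g x) < d) ->
  exists h, iterated_action s g h.
Proof.
elim: s => [_|Z s IH xi gP]; first by exists g.
have [|h gh] := IH.
  move=> l d d0; have [g' [_ [[k [kxi [gk _]]] g'g]]] := gP l d d0.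
  by exists g', k.
suff hxi : map_boundary h xi = xi by exists (transverse_isom hxi), h, hxi.
set r := repr xi; rewrite -[RHS]reprK; apply/boundaryP.
(* The approximant [k] is chosen after [t], but this bound does not depend on [t]: one unit pays for
   replacing [h] by [k] at [r 0], the other at [r t]. *)
exists (2 + mdist (h (r 0)) (r 0)) => t t0 /=.
have [l [d d0 lP]] := iterated_action_near s (r 0) ltr01.
have [l' [d' d'0 l'P]] := iterated_action_near s (r t) ltr01.
have m0 : 0 < Num.min d d' by rewrite lt_min d0.
have [g' [_ [[k [kxi [gk _]]] g'g]]] := gP (l ++ l') _ m0.
have k0 : mdist (k (r 0)) (h (r 0)) < 1.
  apply: (lP g' g) => // x xl; have := g'g x; rewrite mem_cat xl lt_min.
  by move=> /(_ isT)/andP[].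
have kt : mdist (k (r t)) (h (r t)) < 1.
  apply: (l'P g' g) => // x xl; have := g'g x; rewrite mem_cat xl orbT lt_min.
  by move=> /(_ isT)/andP[].
have kr : asymptotic (map_ray k r) r.
  by apply/boundaryP; rewrite -map_boundary_pi reprK kxi.
have h1 := asymptotic_mono (hadamard_CAT0 Z) kr (lexx 0) (lexx 0) t0.
rewrite /= !add0r in h1.
have h2 := metric_triangle (h (r t)) (k (r t)) (r t).
have h3 := metric_triangle (k (r 0)) (h (r 0)) (r 0).
rewrite (metric_sym (h (r t)) (k (r t))) in h2.
move: k0 kt h1 h2 h3; move: (mdist _ _) (mdist _ _) => a b.
move: (mdist _ _) (mdist _ _) => c p; move: (mdist _ _) (mdist _ _) => q v; lra.
Qed.

(** A point of a transverse space is approximated by rays, whose origins lie one step up the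
    sequence. This supplies the base point of [X]. *)
Lemma refining_inhabited Y (s : refining X Y) : Y -> inhabited X.
Proof.
elim: s => [x|Z s IH xi f]; first exact: inhabits.
exact: IH (sval (approx f 0) 0).
Qed.

End Sequence.
End IteratedAction.

Section Stabiliser.
Context {R : realType} (X Y : hadamard R) (s : refining X Y) (F : set Y).

Local Notation S := (flat_stabiliser s F).

Lemma flat_stabiliser_group : is_subgroup S.
Proof.
have imV (h : isom Y) : h @` F = F -> h^-1%g @` F = F.
  move=> hF; rewrite -{1}hF; apply/seteqP; split=> [_ [_ [x Fx <-] <-]|x Fx].
    by rewrite /= isom_funK.
  by exists (h x); [exists x|exact: isom_funK].
split=> [|g g' [h gh hF] [h' gh' h'F]|g [h gh hF]].
- exists 1%g; first exact: iterated_action1.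
  by apply/seteqP; split=> [_ [x Fx <-]//|x Fx]; exists x.
- exists (h * h')%g; first exact: iterated_actionM.
  rewrite -[RHS]hF -{2}h'F; apply/seteqP; split=> [_ [x Fx <-]|_ [_ [x Fx <-] <-]].
    by exists (h' x) => //; exists x.
  by exists x.
- by exists h^-1%g; [exact: iterated_actionV|exact: imV].
Qed.

(** The limit [h] maps [F] into [F] because [F] is closed. For the converse, an approximant [h']
    close to [h] at [h^-1 y] has [y = h' y'] with [y'] in [F], and [y'] is close to [h^-1 y]. *)
Lemma flat_stabiliser_closed : closed F -> closed S.
Proof.
move=> cF g clg.
have near (l : seq X) d : 0 < d -> exists2 g', S g' &
    forall x, x \in l -> mdist (g' x) (g x) < d.
  move=> d0; have gl : nbhs g [set g' : isom X | forall x, x \in l ->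
      mdist (g x) (g' x) < d].
    apply: (filter_seq (P := fun x => [set g' : isom X | mdist (g x) (g' x) < d])).
    by move=> x _; exact: nbhs_isom_eval.
  have [g' [Sg' g'g]] := clg _ gl; exists g' => // x xl.
  by rewrite metric_sym; exact: g'g.
have [|h gh] := @iterated_action_closed _ _ _ s g.
  move=> l d d0; have [g' [h' g'h' _] g'g] := near l d d0.
  by exists g', h'.
have hnear y e : 0 < e -> exists h' : isom Y, h' @` F = F /\ mdist (h y) (h' y) < e.
  move=> e0; have [l [d d0 lP]] := iterated_action_near s y e0.
  have [g' [h' g'h' h'F] g'g] := near l d d0; exists h'; split=> //.
  by apply: (lP g g') => // x xl; rewrite metric_sym; exact: g'g.
exists h => //; apply/seteqP; split=> [_ [y Fy <-]|y Fy].
  apply: (closed_mdistP cF) => e e0; have [h' [h'F hh']] := hnear y e e0.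
  by exists (h' y) => //; rewrite -h'F; exists y.
exists (isom_inv_fun h y); last exact: isom_inv_funK.
apply: (closed_mdistP cF) => e e0.
have [h' [h'F hh']] := hnear (isom_inv_fun h y) e e0.
rewrite isom_inv_funK in hh'.
move: Fy; rewrite -{1}h'F => -[y' Fy' h'y']; exists y' => //.
by rewrite -(isom_mdist h') h'y' metric_sym.
Qed.

Lemma isom_restriction (h : isom Y) : h @` F = F ->
  exists k : isom (subset_space F), forall z, sval (k z) = h (sval z).
Proof.
move=> hF.
have Fh (z : subset_space F) : F (h (sval z)).
  suff : (h @` F) (h (sval z)) by rewrite hF.
  by exists (sval z) => //; exact: svalP.
pose k (z : subset_space F) : subset_space F := exist _ (h (sval z)) (Fh z).
have k_mdist (x y : subset_space F) : mdist (k x) (k y) = mdist x y by rewrite !subset_mdistE isom_mdist.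
have k_surj (y : subset_space F) : exists x : subset_space F, k x = y.
  case: y => y Fy; have := Fy; rewrite -{1}hF => -[x Fx hx].
  by exists (exist _ x Fx); exact: eq_exist.
by exists (Isom k_mdist k_surj).
Qed.

Hypotheses (X_proper : proper_space X) (X_cocompact : cocompact X).

Lemma flat_stabiliser_amenable (n : nat) (phi : 'rV[R]_n -> Y) :
  (forall u v, mdist (phi u) (phi v) = Defs.edist u v) -> F = range phi ->
  closed S /\ amenable R S.
Proof.
move=> phi_mdist FE; have Fphi v : F (phi v) by rewrite FE; exists v.
pose phi' v : subset_space F := exist _ (phi v) (Fphi v).
have phi'_mdist u v : mdist (phi' u) (phi' v) = Defs.edist u v.
  by rewrite subset_mdistE phi_mdist.
have phi'_surj (z : subset_space F) : exists v, phi' v = z.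
  case: z => y Fy; have := Fy; rewrite {1}FE => -[v _ vy].
  by exists v; exact: eq_exist.
(* Properness of the flat for its own distance makes it complete, hence closed in [Y]. *)
have Z_proper := euclidean_proper phi'_mdist phi'_surj.
have S_closed : closed S.
  exact: flat_stabiliser_closed (proper_subset_closed Z_proper).
split=> //; have S_group := flat_stabiliser_group.
have [x0] := refining_inhabited s (phi 0).
have e0 : (0 : R) < 2^-1 / 2 by rewrite divr_gt0 ?invr_gt0.
have Z_net := euclidean_net phi'_mdist phi'_surj 2 e0.
pose v f (z : subset_space F) := transfer s (push x0 S_group f) (sval z).
have push_lip f : bounded_continuous_on S f ->
    exists L M, lipschitz_bounded L M (push x0 S_group f).
  move=> bf; have [L L0 uL] := push_lipschitz x0 X_proper X_cocompact S_group S_closed bf.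
  have [_ [M fM]] := bf; exists L, M; split=> // x.
  exact: (push_norm_le x0 X_proper X_cocompact S_group S_closed x bf fM).
have v_lip f L M : lipschitz_bounded L M (push x0 S_group f) -> lipschitz_bounded L M (v f).
  move=> /(transfer_lipschitz s)[L0 uM uL]; split=> // [z|z z']; first exact: uM.
  exact: uL.
exists (fun f => isom_mean (phi' 0) (v f)); split.
- move=> a f f' bf bf'.
  have [L [M uLM]] := push_lip f bf; have [L' [M' uLM']] := push_lip f' bf'.
  rewrite -(isom_mean_lin (phi' 0) Z_proper a (v_lip _ _ _ uLM) (v_lip _ _ _ uLM')).
  congr isom_mean; apply/funext => z; rewrite /v.
  rewrite (_ : push x0 S_group _ = fun x => a * push x0 S_group f x + push x0 S_group f' x).
    by rewrite (transfer_lin s a uLM uLM').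
  by apply/funext => x; exact: push_lin.
- move=> f bf f0; have [L [M uLM]] := push_lip f bf.
  apply: (isom_mean_ge0 _ Z_proper (v_lip _ _ _ uLM)) => z.
  by apply: (transfer_ge0 s uLM) => x; exact: push_ge0.
- rewrite -[RHS](isom_mean1 (phi' 0) Z_proper); congr isom_mean; apply/funext => z.
  rewrite /v (_ : push x0 S_group _ = fun=> 1) ?transfer_cst//.
  by apply/funext => x; exact: push1.
(* Left translation by [g] becomes composition with [g] on [X], then with [h] on [Y], then with [k]
   on [F], where the mean is invariant under every isometry. *)
- move=> f g bf Sg; have [L [M uLM]] := push_lip f bf.
  have [h gh hF] := Sg; have [k kh] := isom_restriction hF.
  rewrite -(isom_mean_invariant Z_proper Z_net k (v_lip _ _ _ uLM)).
  congr isom_mean; apply/funext => z; rewrite /v /= kh.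
  have -> : push x0 S_group (fun x => f (g * x)%g) = push x0 S_group f \o g.
    by apply/funext => x; exact: push_shift.
  exact: (congr1 (fun w => w (sval z)) (transfer_equiv uLM gh)).
Qed.

End Stabiliser.

Theorem theorem6 (R : realType) (X : metricType R)
    (X_CAT0 : CAT0 X) (X_proper : proper_space X) (X_cocompact : cocompact X)
    (Y : hadamard R)
    (s : refining (Hadamard X_CAT0 (proper_complete X_proper)) Y)
    (F : set Y) (F_flat : flat F) :
  [/\ is_subgroup (flat_stabiliser s F),
      closed (flat_stabiliser s F) &
      amenable R (flat_stabiliser s F)].
Proof.
have [n [phi [phi_mdist FE]]] := F_flat.
have [S_closed S_amenable] :=
  flat_stabiliser_amenable s X_proper X_cocompact phi_mdist FE.
by split=> //; exact: flat_stabiliser_group.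
Qed.
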